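(* Let $K$ be a number field over which the $abc$-conjecture holds, let $\alpha\in K$, and let $0<C_1(\alpha,K)<1$ and $C_2(\alpha,K)$ be constants, depending only on $\alpha$ and $K$, with the following property: for every integer $d\geq 2$ and every $c\in K$, if $f(x)=x^d+c$ satisfies (1) $\varphi(d)>C_1(\alpha,K)\,d$, (2) every prime factor $p\mid d$ satisfies $p>C_2(\alpha,K)$, (3) $\alpha$ is not a fixed point of $f$, and (4) $\min\{h(c),h(c-\alpha)\}>0$, then $f^n(x)-\alpha$ has at most $\tau(d)$ factors in $K[x]$ for all $n\geq 1$. Let $f(x)=x^d+c$ for some $c\in K$ and $d\geq 2$ satisfying conditions (1)--(4). Assume moreover that $\gamma\in K$ is not preperiodic for $f$ and that $S$ is a finite set of places of $K$ containing the archimedean ones. Then $O_f^{-}(\alpha)\cap\mathcal{O}_{S,\gamma}$ is finite.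
   Context: Here $f^n$ denotes the $n$-th iterate of $f$ under composition, $\varphi$ is Euler's totient function, $\tau$ counts positive divisors, $h$ is the absolute logarithmic Weil height, and the number of factors of a polynomial in $K[x]$ means the number of irreducible factors (counted with multiplicity). The paper proves (assuming the $abc$-conjecture over $K$) that constants $C_1(\alpha,K)$, $C_2(\alpha,K)$ with the stated property exist. $O_f^{-}(\alpha)$ denotes the set of all roots in $\overline{K}$ of the polynomials $f^n(x)-\alpha$, for all $n\geq 1$. Given $\gamma\in K$ and a finite set $S$ of places of $K$ containing the archimedean ones, $\beta\in\overline{K}$ is called $S$-integral with respect to $\gamma$ if there is no prime $\mathfrak{q}$ of $K(\beta)$ lying over a prime of $K$ outside of $S$ such that the images of $\gamma$ and $\beta$ modulo $\mathfrak{q}$ (i.e. their reductions in $\mathbb{P}^1$ of the residue field) coincide. $\mathcal{O}_{S,\gamma}$ denotes the set of $\beta\in\overline{K}$ that are $S$-integral with respect to $\gamma$. A point is preperiodic for $f$ if its forward orbit under $f$ is finite. The $abc$-conjecture over a number field $K$ is the following statement. For $a,b,c\in K^*$ let $h(a,b,c)$ be the logarithmic height of the point $[a:b:c]\in\mathbb{P}^2(K)$, and let $\mathrm{rad}(a,b,c)=\frac{1}{[K:\mathbb{Q}]}\sum_{\mathfrak{p}}\log N(\mathfrak{p})$, where the sum is over the nonzero primes $\mathfrak{p}$ of $\mathcal{O}_K$ for which $v_\mathfrak{p}(a),v_\mathfrak{p}(b),v_\mathfrak{p}(c)$ are not all equal. Then for every $\epsilon>0$ there is a constant $C_{K,\epsilon}$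 such that $h(a,b,c)\leq (1+\epsilon)\,\mathrm{rad}(a,b,c)+C_{K,\epsilon}$ for all $a,b,c\in K^*$ with $a+b+c=0$. *)

(* Defs.v *)
(* Number fields are [K : fieldExtType rat]; the
   subfields K(beta) of an algebraic closure are sets, so the arithmetic of
   rings of integers is developed for a subfield E, as a set, of a field F. *)
From HB Require Import structures.
From mathcomp Require Import all_boot all_order all_algebra all_field.
From mathcomp Require Import finmap complex.
From mathcomp Require Import all_classical all_reals all_analysis.

Set Implicit Arguments.
Unset Strict Implicit.
Unset Printing Implicit Defensive.

Import Order.TTheory GRing.Theory Num.Theory.

Local Open Scope classical_set_scope.
Local Open Scope ring_scope.

Section RingsOfIntegers.
Variable F : fieldType.

Definition ring_of_integers (E : set F) : set F :=
  [set x | E x /\ integralOver (intr : int -> F) x].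

Definition nonzero_prime (O P : set F) : Prop :=
  [/\ P `<=` O,
      exists2 x, P x & x != 0,
      (forall x y, P x -> P y -> P (x + y)) /\
      (forall a x, O a -> P x -> P (a * x)),
      ~ P 1 &
      forall x y, O x -> O y -> P (x * y) -> P x \/ P y].

Definition ideal_mul (I J : set F) : set F :=
  [set x | exists s : seq (F * F),
    (forall u, u \in s -> I u.1 /\ J u.2) /\ x = \sum_(u <- s) u.1 * u.2].

Definition ideal_pow (O P : set F) (n : nat) : set F := iter n (ideal_mul P) O.

(* Order at P of a nonzero element of O (unspecified at 0). *)
Definition ideal_ord (O P : set F) (x : F) : nat :=
  xget 0%N [set n | ideal_pow O P n x /\ ~ ideal_pow O P n.+1 x].

(* P-adic valuation on the fraction field of O (unspecified at 0). *)
Definition val_at (O P : set F) (x : F) : int :=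
  xget 0 [set z | exists a b, [/\ O a, O b, a != 0, b != 0 &
    x = a / b /\ z = (ideal_ord O P a)%:Z - (ideal_ord O P b)%:Z]].

Definition ideal_norm (O P : set F) : nat :=
  #|` fset_set [set [set x + y | y in P] | x in O] |.

Definition local_ring (O P : set F) : set F :=
  [set x | exists a s, [/\ O a, O s, ~ P s & x = a / s]].

Definition local_max_ideal (O P : set F) : set F :=
  [set x | exists a s, [/\ P a, O s, ~ P s & x = a / s]].

(* Reduction of [x : 1] to the projective line over the residue field:
   residue classes are cosets of the maximal ideal of the local ring, and
   [None] is the point at infinity. *)
Definition reduction (O P : set F) (x : F) : option (set F) :=
  if `[< local_ring O P x >]
  then Some [set x + y | y in local_max_ideal O P] else None.

End RingsOfIntegers.

Section NumberField.
Variables (R : realType) (K : fieldExtType rat).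

Definition OK : set K := ring_of_integers setT.

Definition primesK : set (set K) := [set P | nonzero_prime OK P].

Definition degQ : R := (\dim {:K})%:R.

Definition embeddings : set (K -> R[i]) :=
  [set s | exists g : {rmorphism K -> R[i]}, s = (g : K -> R[i])].

Definition arch_abs (s : K -> R[i]) (x : K) : R :=
  complex.ComplexField.Normc.normc (s x).

Definition prime_abs (P : set K) (x : K) : R :=
  if x == 0 then 0 else ((ideal_norm OK P)%:R : R) ^ (- val_at OK P x).

(* A place is represented by its normalized absolute value; in particular
   complex-conjugate embeddings give the same place. *)
Definition arch_places : set (K -> R) := [set arch_abs s | s in embeddings].
Definition finite_places : set (K -> R) := [set prime_abs P | P in primesK].
Definition places : set (K -> R) := arch_places `|` finite_places.

(* Absolute logarithmic height of the projective point with coordinates s.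
   Summing over embeddings counts each archimedean place with its local
   degree. *)
Definition proj_height (s : seq K) : R :=
  (\sum_(sigma \in embeddings) ln (\big[Num.max/0]_(x <- s) arch_abs sigma x)
   + \sum_(P \in primesK) ln (\big[Num.max/0]_(x <- s) prime_abs P x)) / degQ.

Definition height (x : K) : R := proj_height [:: x; 1].

Definition radical (a b c : K) : R :=
  (\sum_(P \in [set P | primesK P /\
       ~ (val_at OK P a = val_at OK P b /\ val_at OK P b = val_at OK P c)])
     ln ((ideal_norm OK P)%:R : R)) / degQ.

Definition abc_conjecture : Prop :=
  forall eps : R, 0 < eps -> exists C : R,
    forall a b c : K, a != 0 -> b != 0 -> c != 0 -> a + b + c = 0 ->
      proj_height [:: a; b; c] <= (1 + eps) * radical a b c + C.

End NumberField.

Arguments arch_places : clear implicits.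
Arguments places : clear implicits.

(* Number of irreducible factors of p != 0, counted with multiplicity;
   well defined by unique factorization. *)
Definition num_factors (F : fieldType) (p : {poly F}) : nat :=
  xget 0%N [set k | exists s : seq {poly F},
    [/\ forall q, q \in s -> irreducible_poly q,
        p %= \prod_(q <- s) q & k = size s]].

Section Dynamics.
Variable K : fieldType.

Definition unicritical (d : nat) (c : K) : {poly K} := 'X^d + c%:P.

Definition iter_poly (f : {poly K}) (n : nat) : {poly K} :=
  iter n (fun g => f \Po g) 'X.

Definition preperiodic (f : {poly K}) (x : K) : Prop :=
  finite_set [set iter n (horner f) x | n in [set: nat]].

Definition backward_orbit (Kbar : fieldType) (iota : {rmorphism K -> Kbar})
    (f : {poly K}) (alpha : K) : set Kbar :=
  [set beta | exists2 n : nat, (1 <= n)%N &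
    root (map_poly iota (iter_poly f n - alpha%:P)) beta].

Definition adjoin (Kbar : fieldType) (iota : {rmorphism K -> Kbar})
    (beta : Kbar) : set Kbar :=
  [set z | exists p q : {poly K},
    (map_poly iota q).[beta] != 0 /\
    z = (map_poly iota p).[beta] / (map_poly iota q).[beta]].

End Dynamics.

Definition S_integral (R : realType) (K : fieldExtType rat)
    (Kbar : fieldType) (iota : {rmorphism K -> Kbar})
    (S : set (K -> R)) (gamma : K) : set Kbar :=
  [set beta | ~ exists Q : set Kbar,
    let OL := ring_of_integers (adjoin iota beta) in
    [/\ nonzero_prime OL Q,
        exists P : set K, [/\ primesK P, ~ S (prime_abs R P) &
                              iota @^-1` Q = P] &
        reduction OL Q (iota gamma) = reduction OL Q beta]].

Definition admissible (R : realType) (K : fieldExtType rat) (alpha : K)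
    (C1 C2 : R) (d : nat) (c : K) : Prop :=
  [/\ (totient d)%:R > C1 * d%:R,
      forall p : nat, prime p -> (p %| d)%N -> p%:R > C2,
      (unicritical d c).[alpha] != alpha &
      Num.min (height R c) (height R (c - alpha)) > 0].

(* Main.v *)
(* If the polynomials [f^n - alpha] have boundedly many irreducible factors,
   then for some [m] every irreducible factor [q] of [f^m - alpha] stays
   irreducible after composition with all iterates of [f].  A point [beta] of
   the backward orbit of level [n > m] is then a root of such a polynomial
   [G = (q \Po f) \Po f^k] with [k = n - m - 1], and if it is [S]-integral with
   respect to [gamma], then [G.[gamma] = (q \Po f).[f^k gamma]] is a unit
   outside of a fixed finite set of primes: otherwise a maximal ideal argument
   in the ring of integers of [K(beta)] yields a prime at which [beta] and
   [gamma] have the same reduction.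

   So it is enough to know that, for [g] irreducible of degree at least 2, there
   are finitely many [T]-integers [y] of [K] for which [g.[y]] is a [T]-unit.
   Belyi's construction gives a polynomial [Phi] over the rationals that maps
   the roots of [g] and all critical points of [Phi] into [{0, 1}].  Then
   [Phi * (Phi - 1) = Phi^`() * Q], where [Q] has degree [deg Phi + 1], the same
   roots as the left-hand side, and is divisible by [g], so that [r = Q / g] has
   degree smaller than [deg Phi].  In the abc inequality for
   [Phi.[y] + (1 - Phi.[y]) - 1 = 0] the height is about [deg Phi * h(y)], whereas
   outside of [T] the radical only involves primes dividing [r.[y]], whose
   contribution is at most [deg r * h(y) + O(1)] by the product formula.  Hence
   [h(y)] is bounded, and Northcott's theorem applies.  Finally [f^k gamma]
   takes each value at most once because [gamma] is not preperiodic.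

   The valuation theory of the ring of integers rests on the existence of an
   integral basis (which minimizes the discriminant) and on the fact that every
   nonzero prime [P] has elements [lam], [p], [q] with [p] and [q] in [P],
   [lam P] integral and [1 = p + lam * q]; the powers of [P] are then described
   by [lam] alone. *)
Require Import Defs.
From HB Require Import structures.
From mathcomp Require Import all_boot all_order all_algebra all_field.
From mathcomp Require Import finmap complex.
From mathcomp Require Import all_classical all_reals all_analysis.
From mathcomp Require Import ring lra zify.

Set Implicit Arguments.
Unset Strict Implicit.
Unset Printing Implicit Defensive.

Import Order.TTheory GRing.Theory Num.Theory.

Local Open Scope classical_set_scope.
Local Open Scope ring_scope.

(** * Embeddings and integral bases *)

(** The abc inequality is assumed over K only, whereas the roots of g generate a larger field. This
    is what forces Belyi's construction: [Phi] has coefficients in K, so that the inequality is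
    applied to a point of K although the roots of g are not in K. The extra composition of q with
    [f] matters too: q may be linear, and integers with unit value at a linear polynomial (the line
    punctured at one root and at infinity) can be infinite in number. The degree of [q \Po f] is at
    least 2, which gives at least three punctures. In terms of degrees, deg Q = deg Phi + 1 and deg
    g >= 2 give deg r <= deg Phi - 1, and this gap of one is the whole room left for the factor 1 +
    eps. Two devices keep the algebra elementary. Noetherian arguments are replaced by the finite
    index of principal ideals, used through pigeonhole on powers and through maximal counts of
    residue classes. In K(beta) no valuation is constructed: a prime is obtained from Zorn's lemma,
    and only its local ring is used. *)

Lemma rat_integral_int (q : rat) :
  integralOver (intr : int -> rat) q -> exists z : int, q = z%:~R.
Proof.
case=> p p_mon pq; suff /intrP[z qz] : (ratr q : algC) \is a Num.int.
  by exists z; apply: (fmorph_inj (ratr : rat -> algC)); rewrite /= qz ratr_int.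
apply: Cint_rat_Aint; first exact: Crat_rat.
apply: (@root_monic_Aint (map_poly intr p)).
- have -> : map_poly intr p = map_poly (ratr : rat -> algC) (map_poly intr p).
    by rewrite -map_poly_comp; apply: eq_map_poly => z /=; rewrite ratr_int.
  by rewrite (fmorph_root (ratr : {rmorphism rat -> algC})).
- exact: monic_map.
- by apply/polyOverP => i; rewrite coef_map /= intr_int.
Qed.

Section Embeddings.
Variable (K : fieldExtType rat).
Local Notation n := (\dim {:K}).

Lemma exists_primitive_element : exists (theta : K) (m : {poly rat}),
  [/\ m \is monic, size m = n.+1, separable_poly m,
      forall x, exists p, x = (map_poly (in_alg K) p).[theta] &
      forall p, root (map_poly (in_alg K) p) theta = (m %| p)].
Proof.
have sep : separable 1 {:K}.
  apply/separableP => y _; apply: pcharf0_separable => p.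
  by rewrite (fmorph_pchar (in_alg K)) pchar_num.
pose t := separable_generator 1 {:K}.
have genE : <<1; t>>%VS = {:K}%VS :> {vspace K}.
  by rewrite -eq_adjoin_separable_generator ?subvf.
have /polyOver1P[m mE] := minPolyOver 1 t.
exists t, m; split.
- by rewrite -(map_monic (in_alg K)) -mE monic_minPoly.
- by rewrite -(size_map_poly (in_alg K)) -mE size_minPoly adjoin_degreeE genE
             dimv1 divn1.
- have /separableP/(_ t (memvf _)) := sep.
  by rewrite /separable_element mE separable_map.
- by move=> x; apply/Fadjoin1_polyP; rewrite genE memvf.
- move=> p; rewrite -(dvdp_map (in_alg K)) -mE; apply/idP/idP => [pt|].
    by apply: minPoly_dvdp pt; apply: alg_polyOver.
  move=> dvd; rewrite root_factor_theorem; apply: dvdp_trans dvd.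
  by rewrite -root_factor_theorem root_minPoly.
Qed.

Variable L : numClosedFieldType.

(** A root z of the minimal polynomial [m] of theta gives the embedding p(theta) -> p(z), well
    defined because two polynomials with the same value at theta differ by a multiple of [m];
    separability makes the n roots distinct. The target is left general since both [algC] and the
    complex numbers over [R] are used later. *)
Lemma exists_embeddings : exists (theta : K) (s : 'I_n -> {rmorphism K -> L}),
  [/\ injective (fun i => s i theta),
      forall sigma : {rmorphism K -> L}, exists i, sigma =1 s i &
      forall x, exists a : 'rV[rat]_n, x = \sum_i a 0 i *: theta ^+ i].
Proof.
have [t [m [m_mon m_size m_sep gen m_min]]] := exists_primitive_element.
have lift_root z : root (map_poly ratr m) z ->
    exists sigma : {rmorphism K -> L}, sigma t = z.
  move=> mz; pose p x := projT1 (cid (gen x)).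
  have pE x : x = (map_poly (in_alg K) (p x)).[t] := projT2 (cid (gen x)).
  pose sg x := (map_poly ratr (p x)).[z] : L.
  have sgE x q : x = (map_poly (in_alg K) q).[t] -> sg x = (map_poly ratr q).[z].
    move=> xq; have /dvdpP[u eu] : m %| p x - q.
      by rewrite -m_min rmorphB /root !hornerE -pE -xq subrr.
    apply/eqP; rewrite -subr_eq0 /sg -hornerN -hornerD -rmorphN -rmorphD /= eu.
    by rewrite rmorphM /= hornerM (rootP mz) mulr0.
  have sgB : zmod_morphism sg.
    move=> x y; rewrite (sgE _ (p x - p y)) ?rmorphB ?hornerD ?hornerN //.
    by rewrite -!pE.
  have sgM : monoid_morphism sg.
    split; first by rewrite (sgE _ 1) ?rmorph1 ?hornerC.
    by move=> x y; rewrite (sgE _ (p x * p y)) ?rmorphM ?hornerM -?pE.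
  pose sB := GRing.isZmodMorphism.Build _ _ sg sgB.
  pose sM := GRing.isMonoidMorphism.Build _ _ sg sgM.
  pose sigma : {rmorphism K -> L} := HB.pack sg sB sM.
  exists sigma; rewrite /sigma /= (sgE _ 'X); first by rewrite map_polyX hornerX.
  by rewrite map_polyX hornerX.
have [rs mE] := closed_field_poly_normal (map_poly ratr m : {poly L}).
rewrite lead_coef_map (monicP m_mon) rmorph1 scale1r in mE.
have rs_size : size rs = n.
  apply: succn_inj; rewrite -m_size -(size_map_poly (ratr : {rmorphism rat -> L})).
  by rewrite mE size_prod_XsubC.
have rs_uniq : uniq rs.
  by rewrite -separable_prod_XsubC -mE separable_map.
have rs_root z : (z \in rs) = root (map_poly ratr m) z by rewrite mE root_prod_XsubC.
have rsP (i : 'I_n) : root (map_poly ratr m) rs`_i.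
  by rewrite -rs_root mem_nth // rs_size.
pose s i := projT1 (cid (lift_root _ (rsP i))).
have sE i : s i t = rs`_i := projT2 (cid (lift_root _ (rsP i))).
have map_eval (sigma : {rmorphism K -> L}) q :
    sigma (map_poly (in_alg K) q).[t] = (map_poly ratr q).[sigma t].
  rewrite -horner_map -map_poly_comp; congr (_.[_]).
  by apply: eq_map_poly => a /=; rewrite alg_num_field fmorph_rat.
exists t, s; split.
- move=> i j /=; rewrite !sE => /eqP; rewrite nth_uniq ?rs_size // => /eqP.
  exact: val_inj.
- move=> sigma; have : sigma t \in rs.
    rewrite rs_root /root -map_eval; apply/eqP; rewrite (_ : _.[_] = 0) ?rmorph0 //.
    by apply/rootP; rewrite m_min.
  case/(nthP 0) => i; rewrite rs_size => ltin si.
  exists (Ordinal ltin) => x; have [q ->] := gen x.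
  by rewrite !map_eval sE /= si.
- move=> x; have [q ->] := gen x.
  have -> : (map_poly (in_alg K) q).[t] = (map_poly (in_alg K) (q %% m)).[t].
    rewrite {1}(divp_eq q m) rmorphD rmorphM /= hornerD hornerM.
    have /rootP -> : root (map_poly (in_alg K) m) t by rewrite m_min.
    by rewrite mulr0 add0r.
  exists (poly_rV (q %% m)).
  have le_n : (size (map_poly (in_alg K) (q %% m)) <= n)%N.
    by rewrite size_map_poly -ltnS -m_size ltn_modp monic_neq0.
  rewrite (horner_coef_wide _ le_n); apply: eq_bigr => i _; rewrite mxE coef_map /=.
  by rewrite mulr_algl.
Qed.

End Embeddings.

Section IntegralElements.
Variable (K : fieldExtType rat).
Local Notation n := (\dim {:K}).
Local Notation OK := (@OK K).

Lemma OK_integral x : OK x <-> integralOver (intr : int -> K) x.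
Proof. by split=> [[]|]. Qed.

Lemma OK_int (z : int) : OK z%:~R.
Proof. by apply/OK_integral; apply: (integral_id intr). Qed.

Lemma OK_nat (k : nat) : OK k%:R. Proof. exact: (OK_int k). Qed.

Lemma OK1 : OK 1. Proof. exact: (OK_int 1). Qed.

Lemma OK0 : OK 0. Proof. exact: (OK_int 0). Qed.

Lemma OK_add x y : OK x -> OK y -> OK (x + y).
Proof. by move=> /OK_integral hx /OK_integral hy; apply/OK_integral/integral_add. Qed.

Lemma OK_mul x y : OK x -> OK y -> OK (x * y).
Proof. by move=> /OK_integral hx /OK_integral hy; apply/OK_integral/integral_mul. Qed.

Lemma OK_opp x : OK x -> OK (- x).
Proof. by move=> /OK_integral hx; apply/OK_integral/integral_opp. Qed.

Lemma OK_sub x y : OK x -> OK y -> OK (x - y).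
Proof. by move=> hx /OK_opp; apply: OK_add. Qed.

Lemma OK_exp x k : OK x -> OK (x ^+ k).
Proof.
by move=> hx; elim: k => [|k IHk]; rewrite ?expr0 ?exprS; [exact: OK1 | exact: OK_mul].
Qed.

Lemma OK_sum I (r : seq I) (P : pred I) (F : I -> K) :
  (forall i, P i -> OK (F i)) -> OK (\sum_(i <- r | P i) F i).
Proof. by move=> h; elim/big_ind: _ => //; [exact: OK0 | exact: OK_add]. Qed.

Lemma OK_root (p : {poly K}) x :
  p \is monic -> root p x -> (forall i, OK p`_i) -> OK x.
Proof.
move=> p_mon px hp; apply/OK_integral; apply: integral_root_monic p_mon px _.
by apply/integral_poly => i; apply/OK_integral.
Qed.

Lemma intK_eq0 (z : int) : (z%:~R == 0 :> K) = (z == 0).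
Proof. by rewrite -(rmorph_int (in_alg K)) fmorph_eq0 intr_eq0. Qed.

Lemma natK_eq0 (k : nat) : (k%:R == 0 :> K) = (k == 0)%N.
Proof. exact: (intK_eq0 k). Qed.

(** If x is a root of an integer polynomial [q] of degree d with leading coefficient l, then l x is
    a root of the monic polynomial l^(d-1) q(X/l), which is [r]. The sign of l is removed at the
    end. *)
Lemma OK_scale x : exists2 k : nat, (0 < k)%N & OK (k%:R * x).
Proof.
have /polyOver1P[p pE] := minPolyOver 1 x.
have p_mon : p \is monic by rewrite -(map_monic (in_alg K)) -pE monic_minPoly.
have px : root (map_poly (in_alg K) p) x by rewrite -pE root_minPoly.
have [q [a a_neq0 pq]] := rat_poly_scale p.
have q_neq0 : q != 0.
  by apply: contraTneq p_mon => q0; rewrite pq q0 rmorph0 scaler0 monicE lead_coef0 eq_sym oner_eq0.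
have qx : (map_poly intr q : {poly K}).[x] = 0.
  have : (map_poly (in_alg K) (a%:~R *: p)).[x] = 0.
    by rewrite linearZ /= hornerZ (rootP px) mulr0.
  rewrite pq scalerA divff ?intr_eq0 // scale1r -map_poly_comp => <-.
  by congr (_.[_]); apply: eq_map_poly => z /=; rewrite scaler_int.
pose d := (size q).-1; pose l := lead_coef q.
have d_gt0 : (0 < d)%N.
  rewrite lt0n; apply: contraNneq q_neq0 => d0.
  have qC : q = (q`_0)%:P by apply: size1_polyC; move: d0; rewrite /d; case: (size q) => [|[]].
  by move: qx; rewrite qC map_polyC hornerC /= => /eqP; rewrite intK_eq0 polyC_eq0.
have szq : size q = d.+1 by rewrite prednK // lt0n size_poly_eq0.
pose r : {poly int} := 'X^d + \poly_(i < d) (q`_i * l ^+ (d.-1 - i)).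
have rx : (map_poly intr r).[l%:~R * x] = 0.
  rewrite rmorphD /= map_polyXn hornerD hornerXn.
  rewrite [X in _ + X](@horner_coef_wide _ d); last first.
    by apply: leq_trans (size_poly _ _) _; apply: size_poly.
  have -> : (l%:~R * x) ^+ d = l%:~R ^+ d.-1 * ((q`_d)%:~R * x ^+ d).
    by rewrite exprMn mulrA -lead_coefE -exprSr prednK.
  transitivity (l%:~R ^+ d.-1 * (map_poly intr q : {poly K}).[x]); last by rewrite qx mulr0.
  rewrite (@horner_coef_wide _ d.+1); last by rewrite -szq size_poly.
  rewrite big_ord_recr /= coef_map /= mulrDr addrC; congr (_ + _).
  rewrite big_distrr /=; apply: eq_bigr => i _.
  rewrite !coef_map /= coef_poly ltn_ord rmorphM rmorphXn /= exprMn.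
  have -> : (d.-1 = d.-1 - i + i)%N by have := ltn_ord i; lia.
  by rewrite exprD addnK; ring.
have lx : OK (l%:~R * x).
  apply/OK_integral; exists r; last exact/rootP.
  rewrite monicE lead_coefDl ?lead_coefXn // size_polyXn ltnS.
  exact: size_poly.
exists `|l|%N; first by rewrite absz_gt0 lead_coef_eq0.
rewrite pmulrn abszE; have [l0|l0] := ger0P l; first by [].
by rewrite rmorphN mulNr; apply: OK_opp.
Qed.

Lemma OK_frac x : exists a b : K, [/\ OK a, OK b, b != 0 & x = a / b].
Proof.
have [k k_gt0 kx] := OK_scale x; exists (k%:R * x), k%:R; split=> //; first exact: OK_nat.
  by rewrite natK_eq0 -lt0n.
by rewrite mulrC mulKf // natK_eq0 -lt0n.
Qed.

End IntegralElements.

Section IntegralBasis.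
Variables (K : fieldExtType rat) (L : numClosedFieldType).
Local Notation n := (\dim {:K}).
Local Notation OK := (@OK K).
Variables (theta : K) (s : 'I_n -> {rmorphism K -> L}).
Hypothesis s_inj : injective (fun i => s i theta).
Hypothesis s_gen : forall x, exists a : 'rV[rat]_n, x = \sum_i a 0 i *: theta ^+ i.
Local Notation QtoL := (ratr : rat -> L).

Definition conjugates (x : K) : 'rV[L]_n := \row_k s k x.

(** The square of the determinant of this matrix is the discriminant of the family [w]; for the
    powers of theta it is a Vandermonde matrix. *)
Definition conj_mx (w : 'I_n -> K) : 'M[L]_n := \matrix_(i, k) s k (w i).

Lemma dim_gt0 : (0 < n)%N.
Proof. by rewrite adim_gt0. Qed.

Lemma conjugates_inj : injective conjugates.
Proof.
move=> x y /rowP/(_ (Ordinal dim_gt0)); rewrite !mxE; exact: fmorph_inj.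
Qed.

Lemma conjugates_comb (w : 'I_n -> K) (a : 'rV[rat]_n) :
  conjugates (\sum_i a 0 i *: w i) = map_mx QtoL a *m conj_mx w.
Proof.
apply/rowP => k; rewrite !mxE rmorph_sum; apply: eq_bigr => i _.
by rewrite !mxE rmorphZ_num.
Qed.

Definition powers (i : 'I_n) : K := theta ^+ i.

Lemma powers_unit : conj_mx powers \in unitmx.
Proof.
pose a : 'rV[L]_n := \row_k s k theta.
have -> : conj_mx powers = Vandermonde n a.
  by apply/matrixP => i k; rewrite !mxE rmorphXn.
rewrite unitmxE det_Vandermonde unitfE; apply/prodf_neq0 => i _.
apply/prodf_neq0 => j ltij; rewrite !mxE subr_eq0.
by apply: contraTneq ltij => /s_inj ->; rewrite ltnn.
Qed.

(** The matrix [A] expressing [w] in the powers of theta is rational, and it is invertible because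
    its image over [L] is a factor of the invertible [conj_mx w]. *)
Lemma comb_of_unit (w : 'I_n -> K) x : conj_mx w \in unitmx ->
  exists a : 'rV[rat]_n, x = \sum_i a 0 i *: w i.
Proof.
move=> uw.
pose A : 'M[rat]_n := \matrix_i (projT1 (cid (s_gen (w i)))).
have wA : conj_mx w = map_mx QtoL A *m conj_mx powers.
  apply/row_matrixP => i; rewrite row_mul -map_row rowK -conjugates_comb.
  by rewrite -(projT2 (cid (s_gen (w i)))); apply/rowP => k; rewrite !mxE.
have uA : A \in unitmx.
  by rewrite -(map_unitmx (ratr : {rmorphism rat -> L})); move: uw; rewrite wA unitmx_mul => /andP[].
have [c xc] := s_gen x; exists (c *m invmx A); apply: conjugates_inj.
rewrite conjugates_comb wA map_mxM map_invmx -mulmxA mulKmx ?map_unitmx //.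
by rewrite -conjugates_comb -xc.
Qed.

(** Multiplication by x has a rational matrix in the basis [w], and [conj_mx w] diagonalizes it with
    the conjugates of x as eigenvalues. *)
Lemma mul_matrix (w : 'I_n -> K) x : conj_mx w \in unitmx ->
  exists2 M : 'M[rat]_n, forall i, x * w i = \sum_j M i j *: w j &
    map_mx QtoL M *m conj_mx w = conj_mx w *m diag_mx (conjugates x).
Proof.
move=> uw; pose M : 'M[rat]_n := \matrix_i (projT1 (cid (comb_of_unit (x * w i) uw))).
have ME i : x * w i = \sum_j M i j *: w j.
  rewrite {1}(projT2 (cid (comb_of_unit (x * w i) uw))).
  by apply: eq_bigr => j _; rewrite mxE.
exists M => //; apply/row_matrixP => i; rewrite row_mul -map_row.
have -> : map_mx QtoL (row i M) *m conj_mx w = conjugates (x * w i).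
  by rewrite -conjugates_comb ME; congr conjugates; apply: eq_bigr => j _; rewrite mxE.
apply/rowP => k; rewrite mul_mx_diag !mxE rmorphM mulrC; congr (_ * _).
Qed.

Lemma integral_ratr (q : rat) : integralOver (intr : int -> L) (QtoL q) ->
  exists z : int, q = z%:~R.
Proof.
case=> p p_mon pq; apply: rat_integral_int; exists p => //.
rewrite -(fmorph_root (ratr : {rmorphism rat -> L})) -map_poly_comp.
by congr (root _ _): pq; apply: eq_map_poly => z /=; rewrite ratr_int.
Qed.

Lemma integral_conj x k : OK x -> integralOver (intr : int -> L) (s k x).
Proof.
move=> /OK_integral[p p_mon px]; exists p => //.
rewrite -(fmorph_root (s k)) -map_poly_comp in px.
by congr (root _ _): px; apply: eq_map_poly => z /=; rewrite rmorph_int.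
Qed.

(** The sum is rational, being the trace of the matrix of multiplication by x, and it is a sum of
    algebraic integers. *)
Lemma trace_int x : OK x -> exists z : int, \sum_k s k x = z%:~R.
Proof.
move=> x_int; have [M _ MV] := mul_matrix x powers_unit.
have V_unit := powers_unit.
have trE : QtoL (\tr M) = \sum_k s k x.
  rewrite -(trace_map_mx (ratr : {rmorphism rat -> L})) -[map_mx _ M](mulmxK V_unit) MV.
  rewrite -mulmxA mxtrace_mulC -mulmxA mulVmx // mulmx1 mxtrace_diag.
  by apply: eq_bigr => k _; rewrite mxE.
have [z Mz] : exists z : int, \tr M = z%:~R.
  apply: integral_ratr; rewrite trE.
  elim/big_ind: _ => [|u v|k _]; first exact: (@mxpoly.integral0 _ _ (intr : {rmorphism int -> L})).
    exact: (@integral_add _ _ (intr : {rmorphism int -> L})).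
  exact: integral_conj.
by exists z; rewrite -trE Mz ratr_int.
Qed.

(** The product of [conj_mx w] with its transpose is the Gram matrix of the trace form, whose
    entries are integers. *)
Lemma disc_int (w : 'I_n -> K) : (forall i, OK (w i)) ->
  exists z : int, (\det (conj_mx w)) ^+ 2 = z%:~R.
Proof.
move=> w_int.
have gram i j : exists z : int, \sum_k s k (w i * w j) = z%:~R.
  by apply: trace_int; apply: OK_mul.
pose G : 'M[int]_n := \matrix_(i, j) projT1 (cid (gram i j)).
exists (\det G); rewrite -(det_map_mx (intr : {rmorphism int -> L})) expr2.
rewrite -{2}det_tr -det_mulmx; congr determinant; apply/matrixP => i j.
rewrite !mxE; case: (cid (gram i j)) => z /= <-.
by apply: eq_bigr => k _; rewrite !mxE rmorphM.
Qed.

Lemma det_row_replaced (i : 'I_n) (c : 'rV[L]_n) :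
  \det (\matrix_(k, l) if k == i then c 0 l else (k == l)%:R) = c 0 i.
Proof.
rewrite (expand_det_col _ i) (bigD1 i) //= big1 ?addr0 => [|k /negPf ki]; last first.
  by rewrite !mxE ki mul0r.
rewrite mxE eqxx /cofactor addnn -signr_odd odd_double expr0 mul1r.
rewrite (_ : row' _ _ = 1%:M) ?det1 ?mulr1 //.
apply/matrixP => k l; rewrite !mxE.
by rewrite eq_sym (negPf (neq_lift _ _)) (inj_eq lift_inj).
Qed.

(** If some integral x had a non-integer coordinate with fractional part f at w_i, then replacing
    w_i by x minus floor times w_i would multiply the discriminant by f^2 < 1, against its
    minimality. The transition matrix is the identity with one row replaced, hence
    [det_row_replaced]. *)
Lemma exists_integral_basis : exists w : 'I_n -> K,
  [/\ forall i, OK (w i), conj_mx w \in unitmx &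
      forall x, OK x -> exists a : 'rV[int]_n, x = \sum_i (a 0 i)%:~R * w i].
Proof.
pose P N := `[< exists w : 'I_n -> K, [/\ forall i, OK (w i), conj_mx w \in unitmx &
   `|\det (conj_mx w) ^+ 2| = N%:R] >].
have discN w : (forall i, OK (w i)) -> exists N : nat, `|\det (conj_mx w) ^+ 2| = N%:R.
  move=> /disc_int[z ->]; exists `|z|%N.
  by rewrite -intr_norm -abszE.
have exP : exists N, P N.
  pose k i := projT1 (cid2 (OK_scale (theta ^+ (i : 'I_n)))).
  have k_gt0 i : (0 < k i)%N by rewrite /k; case: (cid2 _).
  have k_int i : OK ((k i)%:R * theta ^+ i) by rewrite /k; case: (cid2 _).
  pose w i := (k i)%:R * theta ^+ i; have [N wN] := discN w k_int.
  exists N; apply/asboolP; exists w; split=> //.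
  have -> : conj_mx w = diag_mx (\row_i (k i)%:R) *m conj_mx powers.
    apply/matrixP => i j; rewrite mul_diag_mx !mxE rmorphM rmorph_nat.
    by rewrite /powers.
  rewrite unitmx_mul powers_unit andbT unitmxE det_diag unitfE.
  by apply/prodf_neq0 => i _; rewrite mxE pnatr_eq0 -lt0n.
case: (ex_minnP exP) => N /asboolP[w [w_int w_unit wN]] minN.
exists w; split=> // x x_int; have [a xa] := comb_of_unit x w_unit.
suff a_int i : exists z : int, a 0 i = z%:~R.
  exists (\row_i projT1 (cid (a_int i))); rewrite xa; apply: eq_bigr => i _.
  by rewrite mxE {1}(projT2 (cid (a_int i))) -mulr_algl scaler_int.
pose f := a 0 i - (Num.floor (a 0 i))%:~R.
have [f0|f_neq0] := eqVneq f 0.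
  by exists (Num.floor (a 0 i)); apply/eqP; rewrite -subr_eq0 -/f f0.
have [f_ge0 f_lt1] : 0 <= f /\ f < 1.
  have /andP[le1 lt1] := floor_itv (a 0 i).
  by rewrite /f subr_ge0 ltrBlDl; split=> //; move: lt1; rewrite rmorphD.
pose w' k := if k == i then x - (Num.floor (a 0 i))%:~R * w i else w k.
have w'_int k : OK (w' k).
  rewrite /w'; case: eqP => // _; apply: OK_sub => //; apply: OK_mul => //.
  exact: OK_int.
pose c : 'rV[L]_n := \row_l (QtoL (a 0 l) - (l == i)%:R * (Num.floor (a 0 i))%:~R).
have detV : \det (conj_mx w') = QtoL f * \det (conj_mx w).
  have -> : QtoL f = c 0 i by rewrite mxE eqxx mul1r rmorphB /= ratr_int.
  rewrite -det_row_replaced -det_mulmx; congr determinant.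
  apply/matrixP => k m; rewrite !mxE /w'; case: (eqVneq k i) => [->|ki]; last first.
    rewrite (bigD1 k) //= !mxE (negPf ki) eqxx mul1r big1 ?addr0 // => l lk.
    by rewrite !mxE (negPf ki) eq_sym (negPf lk) mul0r.
  transitivity ((QtoL (a 0 i) - (Num.floor (a 0 i))%:~R) * s m (w i) +
      \sum_(l < n | l != i) QtoL (a 0 l) * s m (w l)).
    rewrite {1}xa rmorphB rmorphM rmorph_int rmorph_sum (bigD1 i) //= rmorphZ_num.
    rewrite (eq_bigr (fun l => QtoL (a 0 l) * s m (w l))) => [|l _]; last exact: rmorphZ_num.
    by ring.
  rewrite [RHS](bigD1 i) //=; congr (_ + _); first by rewrite !mxE !eqxx mul1r.
  by apply: eq_bigr => l /negPf li; rewrite !mxE eqxx li mul0r subr0.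
have detV_neq0 : \det (conj_mx w) != 0 by rewrite -unitfE -unitmxE.
have Qf_neq0 : QtoL f != 0 by rewrite fmorph_eq0.
have [N' w'N'] := discN w' w'_int.
have : (N <= N')%N.
  apply: minN; apply/asboolP; exists w'; split => //.
  by rewrite unitmxE detV unitfE mulf_neq0.
rewrite leqNgt -(ltr_nat L) -wN -w'N' detV exprMn normrM => /negP[].
rewrite -[ltRHS]mul1r ltr_pM2r ?normr_gt0 ?expf_neq0 //.
rewrite normrX ger0_norm ?ler0q // expr_lt1 ?ler0q //.
by rewrite -[ltRHS](rmorph1 (ratr : {rmorphism rat -> L})) ltr_rat.
Qed.

End IntegralBasis.

(** * Indices of subgroups, determinants, and the norm of a principal ideal *)

Section Index.

Definition subgroup (V : zmodType) (B : set V) : Prop :=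
  B 0 /\ forall x y, B x -> B y -> B (x - y).

(** Indices are witnessed by a finite system of representatives instead of a quotient group, because
    ideals are bare sets of elements of K. *)
Definition has_index (V : zmodType) (A B : set V) (k : nat) : Prop :=
  exists (I : finType) (r : I -> V),
    [/\ #|I| = k, forall i, A (r i), forall x, A x -> exists i, B (x - r i) &
        forall i j, B (r i - r j) -> i = j].

Variable V : zmodType.
Implicit Types A B C : set V.

Lemma subgroupN B x : subgroup B -> B x -> B (- x).
Proof. by move=> [B0 BB] Bx; rewrite -sub0r; apply: BB. Qed.

Lemma subgroupD B x y : subgroup B -> B x -> B y -> B (x + y).
Proof. by move=> sB Bx By; rewrite -[y]opprK; apply: sB.2 => //; apply: subgroupN. Qed.

Lemma has_index_inj A B k (J : finType) (r : J -> V) : subgroup B ->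
  has_index A B k -> (forall j, A (r j)) -> (forall i j, B (r i - r j) -> i = j) ->
  (#|J| <= k)%N.
Proof.
move=> sB [I [r' [<- Ar' AB _]]] Ar r_inj.
pose f j := projT1 (cid (AB _ (Ar j))).
have fP j : B (r j - r' (f j)) := projT2 (cid (AB _ (Ar j))).
apply: (leq_card f) => i j fij; apply: r_inj.
have := sB.2 _ _ (fP i) (fP j).
by rewrite fij opprB addrA addrNK.
Qed.

Lemma has_index_unique A B k l : subgroup B ->
  has_index A B k -> has_index A B l -> k = l.
Proof.
move=> sB idxk idxl; apply/eqP; rewrite eqn_leq.
apply/andP; split.
  by have [I [r [<- Ar _ r_inj]]] := idxk; apply: has_index_inj sB idxl Ar r_inj.
by have [J [r [<- Ar _ r_inj]]] := idxl; apply: has_index_inj sB idxk Ar r_inj.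
Qed.

Lemma has_index_trans A B C k l : subgroup A -> subgroup B -> B `<=` A -> C `<=` B ->
  has_index A B k -> has_index B C l -> has_index A C (k * l).
Proof.
move=> sA sB BA CB [I [r [<- Ar rA r_inj]]] [J [q [<- Bq qB q_inj]]].
exists (I * J)%type, (fun u => r u.1 + q u.2); split.
- by rewrite card_prod.
- by move=> u; apply: subgroupD => //; apply: BA.
- move=> x /rA[i xi]; have [j xj] := qB _ xi; exists (i, j) => /=.
  by rewrite opprD addrA.
- move=> [i j] [i' j'] /= h.
  have ii' : i = i'.
    apply: r_inj; have -> : r i - r i' = (r i + q j - (r i' + q j')) - (q j - q j').
      by rewrite opprD addrACA addrK.
    by apply: sB.2; [exact: CB | apply: sB.2].
  rewrite -ii' opprD addrACA subrr add0r in h.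
  by rewrite ii' (q_inj _ _ h).
Qed.

Lemma has_index1 A : A 0 -> subgroup A -> has_index A A 1.
Proof.
move=> A0 sA; exists unit, (fun=> 0); split=> //; first exact: card_unit.
  by move=> x Ax; exists tt; rewrite subr0.
by move=> [] [].
Qed.

Lemma coset_eq B x y : subgroup B ->
  [set x + z | z in B] = [set y + z | z in B] <-> B (x - y).
Proof.
move=> sB; split=> [e|Bxy].
  have : [set x + z | z in B] x by exists 0; [exact: sB.1|rewrite addr0].
  by rewrite e => -[z Bz <-]; rewrite addrAC subrr add0r.
apply/seteqP; split=> _ [z Bz <-].
  by exists (x - y + z); [exact: subgroupD|rewrite addrA [y + _]addrC subrK].
exists (z - (x - y)); first exact: sB.2.
by rewrite opprB addrCA [x + _]addrC subrK addrC.
Qed.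

End Index.

Lemma has_index_image (V W : zmodType) (phi : {additive V -> W}) (A B : set V) k :
  injective phi -> has_index A B k -> has_index (phi @` A) (phi @` B) k.
Proof.
move=> phi_inj [I [r [<- Ar rA r_inj]]]; exists I, (phi \o r); split=> //.
- by move=> i; exists (r i).
- by move=> _ [x /rA[i xi] <-]; exists i, (x - r i); rewrite // raddfB.
- by move=> i j [y By]; rewrite /= -raddfB => /phi_inj yE; apply: r_inj; rewrite -yE.
Qed.

Lemma eq_of_multiple (a z : int) (x y : nat) :
  a * z = x%:Z - y%:Z -> (x < `|z|)%N -> (y < `|z|)%N -> x = y.
Proof.
have [->|a_neq0] := eqVneq a 0; first by rewrite mul0r; lia.
have : (0 < `|a|)%N by rewrite absz_gt0.
move=> a_gt0 /(congr1 absz); rewrite abszM => h hx hy; nia.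
Qed.

(** The unimodular factors of the Smith normal form do not change the index. For the diagonal factor
    the representatives are the vectors whose i-th coordinate lies between 0 and |d_i| - 1. *)
Lemma has_index_row_mul n (M : 'M[int]_n) : \det M != 0 ->
  has_index [set: 'rV[int]_n] [set v *m M | v in [set: 'rV[int]_n]] `|\det M|%N.
Proof.
have [L uL [R uR [d _ ME]]] := int_Smith_normal_form M => detM.
pose D := diag_mx (\row_(i < n) d`_i).
have {}ME : M = L *m D *m R.
  rewrite ME; congr (_ *m _ *m _); by apply/matrixP => i j; rewrite !mxE.
have abs1 (N : 'M[int]_n) : N \in unitmx -> `|\det N|%N = 1%N.
  rewrite unitmxE => /mulVr/(congr1 absz); rewrite abszM => /eqP.
  by rewrite muln_eq1 => /andP[_ /eqP].
have detE : `|\det M|%N = (\prod_(i < n) `|(d`_i)%R|)%N.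
  rewrite ME !det_mulmx !abszM (abs1 _ uL) (abs1 _ uR) muln1 mul1n det_diag.
  by rewrite (big_morph absz abszM (erefl : `|1%Z|%N = 1%N)); apply: eq_bigr => i _; rewrite mxE.
have d_neq0 (i : 'I_n) : d`_i != 0.
  rewrite -absz_eq0 -lt0n; move: detM; rewrite -absz_eq0 -lt0n detE.
  by move=> /gt0_prodn; apply.
have idxD : has_index [set: 'rV[int]_n] [set v *m D | v in [set: 'rV[int]_n]] `|\det M|%N.
  pose r (f : {dffun forall i : 'I_n, 'I_(`|(d`_i)%R|%N)}) : 'rV[int]_n :=
    \row_i Posz (f i).
  exists {dffun forall i : 'I_n, 'I_(`|(d`_i)%R|%N)}, r; split=> //.
  - rewrite card_dep_ffun foldrE big_image detE; apply: eq_bigr => i _.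
    by rewrite card_ord.
  - move=> v _.
    have ltm i : (`|(v 0%R i %% d`_i)%Z| < `|(d`_i)%R|)%N.
      by have := ltz_mod (v 0 i) (d_neq0 i); have := modz_ge0 (v 0 i) (d_neq0 i); lia.
    exists (finfun (fun i => Ordinal (ltm i))), (\row_(i < n) (v 0%R i %/ (d`_i)%R)%Z) => //.
    apply/rowP => i; rewrite mul_mx_diag !mxE ffunE /= gez0_abs ?modz_ge0 //.
    by rewrite {2}(divz_eq (v 0 i) d`_i) addrK.
  - move=> f g [u _ uE]; apply/ffunP => i; apply: val_inj => /=.
    move/rowP/(_ i): uE; rewrite mul_mx_diag !mxE => uE.
    exact: eq_of_multiple uE (ltn_ord (f i)) (ltn_ord (g i)).
have R_inj : injective (mulmxr R : 'rV[int]_n -> 'rV[int]_n).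
  by apply: (can_inj (g := mulmxr (invmx R))) => v /=; rewrite mulmxK.
have := has_index_image R_inj idxD; congr has_index; apply/seteqP; split=> v //=.
- by move=> _; exists (v *m invmx R) => //; rewrite mulmxKV.
- move=> [_ [u _ <-] <-]; exists (u *m invmx L) => //.
  by rewrite ME !mulmxA mulmxKV.
- by move=> [u _ <-]; exists (u *m L *m D); [exists (u *m L) | rewrite ME !mulmxA].
Qed.

Lemma finite_bounded_int (n m : nat) :
  finite_set [set a : 'rV[int]_n | forall i, (`|a 0%R i| <= m)%N].
Proof.
pose r (f : {ffun 'I_n -> 'I_(m + m).+1}) : 'rV[int]_n :=
  \row_i (Posz (f i) - m%:Z).
apply: (@sub_finite_set _ _ (range r)); last by apply: finite_image; exact: finite_finset.
move=> a /= a_le.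
have lt i : (`|(a 0%R i + m%:Z)%R| < (m + m).+1)%N by have := a_le i; lia.
exists [ffun i => Ordinal (lt i)] => //; apply/rowP => i; rewrite !mxE ffunE /=.
have := a_le i; lia.
Qed.

Section PrincipalIndex.
Variables (K : fieldExtType rat) (L : numClosedFieldType).
Local Notation n := (\dim {:K}).
Local Notation OK := (@OK K).
Variables (s : 'I_n -> {rmorphism K -> L}) (w : 'I_n -> K).
Hypothesis w_int : forall i, OK (w i).
Hypothesis w_unit : conj_mx s w \in unitmx.
Hypothesis w_gen : forall x, OK x -> exists a : 'rV[int]_n, x = \sum_i (a 0 i)%:~R * w i.

Definition of_coords (v : 'rV[int]_n) : K := \sum_i (v 0 i)%:~R * w i.

Lemma conjugates_of_coords v :
  conjugates s (of_coords v) = map_mx (intr : int -> L) v *m conj_mx s w.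
Proof.
apply/rowP => k; rewrite !mxE rmorph_sum; apply: eq_bigr => i _.
by rewrite !mxE rmorphM rmorph_int.
Qed.

Lemma of_coords_int v : OK (of_coords v).
Proof. by apply: OK_sum => i _; apply: OK_mul => //; apply: OK_int. Qed.

Lemma of_coords_inj : injective of_coords.
Proof.
move=> u v /(congr1 (conjugates s)); rewrite !conjugates_of_coords.
move=> /(can_inj (mulmxK w_unit)) => uv.
by apply/rowP => i; move/rowP/(_ i): uv; rewrite !mxE => /intr_inj.
Qed.

Lemma of_coordsB : zmod_morphism of_coords.
Proof.
move=> u v; rewrite /of_coords -sumrB; apply: eq_bigr => i _.
by rewrite !mxE rmorphB mulrBl.
Qed.

(** In the integral basis, multiplication by a is an integer matrix conjugate to the diagonal matrix
    of the conjugates of a. Its determinant is therefore the norm of a, and in absolute value it is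
    also the index. *)
Lemma index_principal a : OK a -> a != 0 ->
  exists2 k : nat, has_index OK [set a * x | x in OK] k & `|\prod_k s k a| = k%:R.
Proof.
move=> a_int a_neq0.
pose M : 'M[int]_n := \matrix_i projT1 (cid (w_gen (OK_mul a_int (w_int i)))).
have rowM i : a * w i = of_coords (row i M).
  by rewrite rowK; case: cid => v.
have mulM v : a * of_coords v = of_coords (v *m M).
  rewrite /of_coords big_distrr /=.
  under eq_bigr do rewrite mulrCA rowM /of_coords big_distrr /=.
  rewrite exchange_big; apply: eq_bigr => j _; rewrite !mxE rmorph_sum big_distrl /=.
  by apply: eq_bigr => i _; rewrite !mxE rmorphM mulrA.
have MV : map_mx (intr : int -> L) M *m conj_mx s w =
    conj_mx s w *m diag_mx (conjugates s a).
  apply/row_matrixP => i; rewrite row_mul -map_row -conjugates_of_coords -rowM.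
  by apply/rowP => k; rewrite mul_mx_diag !mxE rmorphM mulrC.
have detM : (\det M)%:~R = \prod_k s k a.
  have /(congr1 determinant) := MV; rewrite !det_mulmx det_map_mx mulrC.
  move/(mulfI _); rewrite det_diag -unitfE -unitmxE => ->//.
  by apply: eq_bigr => k _; rewrite mxE.
have detM_neq0 : \det M != 0.
  by rewrite -(intr_eq0 L) detM; apply/prodf_neq0 => k _; rewrite fmorph_eq0.
exists `|\det M|%N; last by rewrite -detM -intr_norm -abszE.
pose phiB := GRing.isZmodMorphism.Build _ _ of_coords of_coordsB.
pose phi : {additive 'rV[int]_n -> K} := HB.pack of_coords phiB.
have := has_index_image (of_coords_inj : injective phi) (has_index_row_mul detM_neq0).
congr has_index; apply/seteqP; split=> x //=.
- by move=> [v _ <-]; apply: of_coords_int.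
- by move=> /w_gen[v ->]; exists v.
- move=> [_ [v _ <-] <-]; exists (of_coords v); first exact: of_coords_int.
  by rewrite mulM.
- move=> [_ /w_gen[v ->] <-]; exists (v *m M); first by exists v.
  by rewrite -mulM.
Qed.

End PrincipalIndex.

(** * Valuations of the ring of integers *)

Section Dedekind.
Variable K : fieldExtType rat.
Local Notation OK := (@OK K).

(** The finiteness fact behind the ideal theory that follows: it drives the pigeonhole arguments and
    bounds the counts that are maximized. *)
Lemma OK_finite_index a : OK a -> a != 0 ->
  exists k, has_index OK [set a * x | x in OK] k.
Proof.
have [theta [s [s_inj _ s_gen]]] := exists_embeddings K algC.
have [w [w_int w_unit w_gen]] := exists_integral_basis s_inj s_gen.
by move=> a_int /(index_principal w_int w_unit w_gen a_int)[k ? _]; exists k.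
Qed.

Lemma OK_pigeonhole a (f : nat -> K) : OK a -> a != 0 -> (forall i, OK (f i)) ->
  exists i j t, [/\ (i < j)%N, OK t & f j - f i = a * t].
Proof.
move=> a_int a_neq0 f_int; have [k [I [r [_ _ rA _]]]] := OK_finite_index a_int a_neq0.
pose g i := projT1 (cid (rA _ (f_int i))).
have gP i : exists2 t, OK t & a * t = f i - r (g i).
  by have [t t_int tE] := projT2 (cid (rA _ (f_int i))); exists t.
have [i [j [lt_ij gij]]] : exists i j, (i < j)%N /\ g i = g j.
  pose h (i : 'I_#|I|.+1) := g i.
  have /injectivePn[x [y xy hxy]] : ~~ injectiveb h.
    by apply/negP => /injectiveP/leq_card; rewrite card_ord ltnn.
  have [ltxy|ltyx|/val_inj eqxy] := ltngtP x y; last by rewrite eqxy eqxx in xy.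
    by exists x, y.
  by exists y, x.
have [t t_int tE] := gP i; have [u u_int uE] := gP j.
exists i, j, (u - t); split=> //; first exact: OK_sub.
by rewrite mulrBr tE uE gij opprB addrA subrK.
Qed.

(** Almost integral elements are integral: two of the elements x^k a agree modulo a, and dividing by
    a leaves the monic equation x^j - x^i = t with t integral. *)
Lemma OK_of_powers a x : OK a -> a != 0 -> (forall k, OK (x ^+ k * a)) -> OK x.
Proof.
move=> a_int a_neq0 /(OK_pigeonhole a_int a_neq0)[i [j [t [lt_ij t_int]]]].
rewrite -mulrBl mulrC => /(mulfI a_neq0) tE.
apply: (@OK_root _ ('X^j - ('X^i + t%:P))).
- rewrite monicE lead_coefDl ?lead_coefXn // size_polyN size_polyXn ltnS.
  apply: leq_trans (size_polyD _ _) _; rewrite size_polyXn geq_max lt_ij /=.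
  by rewrite (leq_trans (size_polyC_leq1 _)) // (leq_ltn_trans _ lt_ij).
- by rewrite /root !hornerE -tE; apply/eqP; ring.
- move=> k; rewrite coefB coefD !coefXn coefC.
  apply: OK_sub; first exact: OK_nat.
  apply: OK_add; first exact: OK_nat.
  by case: ifP => _; [|exact: OK0].
Qed.

Section Prime.
Variable P : set K.
Hypothesis P_prime : nonzero_prime OK P.

Lemma prime_int x : P x -> OK x. Proof. by case: P_prime => PO _ _ _ _; apply: PO. Qed.

Lemma primeD x y : P x -> P y -> P (x + y).
Proof. by case: P_prime => _ _ [PD _] _ _; apply: PD. Qed.

Lemma primeM a x : OK a -> P x -> P (a * x).
Proof. by case: P_prime => _ _ [_ PM] _ _; apply: PM. Qed.

Lemma primeMr a x : OK a -> P x -> P (x * a).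
Proof. by rewrite mulrC; apply: primeM. Qed.

Lemma primeN x : P x -> P (- x).
Proof. by rewrite -mulN1r; apply: primeM; apply: (OK_int _ (-1)). Qed.

Lemma primeB x y : P x -> P y -> P (x - y).
Proof. by move=> Px /primeN; apply: primeD. Qed.

Lemma prime1 : ~ P 1. Proof. by case: P_prime. Qed.

Lemma prime_subgroup : subgroup P.
Proof.
split; last exact: primeB.
by have [_ [x Px _] _ _ _] := P_prime; rewrite -(mul0r x); apply: primeM; first exact: OK0.
Qed.

Lemma prime_mul x y : OK x -> OK y -> P (x * y) -> P x \/ P y.
Proof. by case: P_prime => _ _ _ _; apply. Qed.

Lemma primeX x k : OK x -> P (x ^+ k) -> P x.
Proof.
move=> x_int; elim: k => [/prime1|k IHk] //.
by rewrite exprS => /prime_mul[] //; apply: OK_exp.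
Qed.

(** Nonzero primes are maximal. Two powers of z agree modulo an element of P, so P contains z^i (1 -
    z^(j-i)) and hence its second factor; the inverse is z^(j-i-1). *)
Lemma prime_inverse z : OK z -> ~ P z -> exists2 z', OK z' & P (1 - z * z').
Proof.
move=> z_int Pz; have [_ [a Pa a_neq0] _ _ _] := P_prime.
have [i [j [t [lt_ij t_int tE]]]] :=
  OK_pigeonhole (prime_int Pa) a_neq0 (fun i => OK_exp i z_int).
exists (z ^+ (j - i).-1); first exact: OK_exp.
have : P (z ^+ i * (1 - z * z ^+ (j - i).-1)).
  rewrite -exprS prednK ?subn_gt0 // mulrBr mulr1 -exprD subnKC 1?ltnW //.
  by rewrite -opprB tE; apply: primeN; apply: primeMr.
case/prime_mul => //; first exact: OK_exp.
  by apply: OK_sub; [exact: OK1|apply: OK_mul => //; exact: OK_exp].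
by move=> /(primeX z_int).
Qed.

(* [b] is chosen so that the annihilator of its class modulo [a] is maximal
   among the annihilators contained in [P]; in the finite ring [OK / a OK]
   such an annihilator is [P] itself. *)
Lemma prime_annihilator a : P a -> a != 0 -> exists2 b, OK b &
  forall z, OK z -> P z <-> exists2 t, OK t & z * b = a * t.
Proof.
move=> Pa a_neq0; have a_int := prime_int Pa.
have [k [I [r [_ r_int rA _]]]] := OK_finite_index a_int a_neq0.
pose ann b z := exists2 t, OK t & z * b = a * t.
have annM b z y : OK y -> ann b z -> ann b (y * z).
  by move=> y_int [t t_int tE]; exists (y * t); [exact: OK_mul|rewrite -mulrA tE mulrCA].
have annD b z y : ann b z -> ann b y -> ann b (z + y).
  by move=> [t t_int tE] [u u_int uE]; exists (t + u); [exact: OK_add|rewrite mulrDl tE uE mulrDr].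
pose S b := [set i : I | `[< ann b (r i) >]]%SET.
pose good b := OK b /\ forall z, OK z -> ann b z -> P z.
pose Q m := `[< exists2 b, good b & #|S b| = m >].
have exQ : exists m, Q m.
  exists #|S 1|; apply/asboolP; exists 1 => //; split; first exact: OK1.
  by move=> z _ [t t_int]; rewrite mulr1 => ->; apply: primeMr.
have ubQ m : Q m -> (m <= #|I|)%N by move=> /asboolP[b _ <-]; apply: max_card.
case: (ex_maxnP exQ ubQ) => m /asboolP[b [b_int b_good] bm] maxm {exQ ubQ}.
have max_ann b' z : good b' -> (forall y, OK y -> ann b y -> ann b' y) ->
    OK z -> ann b' z -> ann b z.
  move=> b'_good bb' z_int b'z.
  have SbE : S b = S b'.
    apply/eqP; rewrite eqEcard; apply/andP; split; last first.
      by rewrite bm; apply: maxm; apply/asboolP; exists b'.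
    apply/fintype.subsetP => i; rewrite !inE => h; exact: (bb' _ (r_int i) h).
  have [i [t t_int tE]] := rA _ z_int.
  have zr c : OK c -> ann c (z - r i).
    by move=> c_int; exists (t * c); [exact: OK_mul|rewrite -tE mulrA].
  have : i \in S b'.
    rewrite !inE (_ : r i = z + -1 * (z - r i)); last by ring.
    apply: (annD _ _ _ b'z); apply: annM; first exact: (OK_int _ (-1)).
    by apply: zr; case: b'_good.
  rewrite -SbE !inE => bri; rewrite -(subrK (r i) z).
  by apply: (annD _ _ _ (zr _ b_int)).
exists b => // z z_int; split=> [Pz|]; last exact: b_good.
apply: contrapT => bz.
have annZ i y : ann (z ^+ i * b) y <-> ann b (y * z ^+ i).
  by split=> [] [t t_int tE]; exists t => //; rewrite -tE mulrA.
(* If some y outside P killed z^i b, then y b would still be good, since P is prime, and its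
   annihilator would contain that of b together with z^i; maximality would put z^i in the
   annihilator of b. *)
have good_exp i : ~ ann b (z ^+ i) -> good (z ^+ i * b).
  have zi_int := OK_exp i z_int => bzi; split; first exact: OK_mul.
  move=> y y_int /annZ byz; apply: contrapT => Py; apply: bzi.
  apply: (max_ann (y * b)) => //.
  - split; first exact: OK_mul.
    move=> u u_int [t t_int tE].
    have : P (u * y) by apply: b_good; [exact: OK_mul|exists t; rewrite -?tE ?mulrA].
    by case/prime_mul.
  - move=> u u_int bu; have [t t_int tE] := annM _ _ _ y_int bu.
    by exists t => //; rewrite -tE mulrA [u * y]mulrC.
  - by case: byz => t t_int tE; exists t => //; rewrite -tE mulrCA mulrA.
have ann_le i y : OK y -> ann b y -> ann (z ^+ i * b) y.
  by move=> y_int by_; apply/annZ; rewrite mulrC; apply: annM => //; apply: OK_exp.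
have nann i : ~ ann b (z ^+ i).
  elim: i => [|i IHi]; first by rewrite expr0 => b1; apply: prime1; apply: b_good b1; apply: OK1.
  rewrite exprS => /annZ bz'; apply: bz; apply: max_ann bz' => //; first exact: good_exp.
  by move=> y; apply: ann_le.
(* No power of z kills b, yet two powers agree modulo a. Then z^(j-i) - 1 kills the good element z^i
   b, so it lies in P along with z, which would give 1 in P. *)
have [i [j [t [lt_ij t_int tE]]]] := OK_pigeonhole a_int a_neq0 (fun i => OK_exp i z_int).
have zij_int : OK (z ^+ (j - i) - 1) by apply: OK_sub; [exact: OK_exp|exact: OK1].
have : P (z ^+ (j - i) - 1).
  apply: (good_exp i (nann i)).2 => //; apply/annZ; rewrite mulrBl mul1r -exprD subnK 1?ltnW //.
  by rewrite tE; exists (t * b); [exact: OK_mul|rewrite mulrA].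
move=> Pz1; apply: prime1; rewrite -(subKr (z ^+ (j - i)) 1); apply: primeB => //.
by rewrite -(prednK (_ : 0 < j - i)%N) ?subn_gt0 // exprS; apply: primeMr => //; apply: OK_exp.
Qed.

(** Invertibility of P, with lam = b / a in its inverse. By the choice of b, an integer x lies in P
    exactly when lam x is integral. If lam P were contained in P, then lam would be integral by
    [OK_of_powers], which would put 1 in P; so some lam q0 escapes P, and it is inverted modulo
    P. *)
Lemma prime_local_generator : exists lam p q : K,
  [/\ P p, P q, 1 = p + lam * q & forall x, P x -> OK (lam * x)].
Proof.
have [_ [a Pa a_neq0] _ _ _] := P_prime.
have [b b_int bP] := prime_annihilator Pa a_neq0.
pose lam := b / a.
have lamP x : OK x -> P x <-> OK (lam * x).
  move=> x_int; rewrite bP //; split=> [[t t_int tE]|lx].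
    by rewrite /lam mulrAC [b * x]mulrC tE mulrAC mulfV // mul1r.
  by exists (lam * x) => //; rewrite /lam; field.
have [q0 [Pq0 nPq0]] : exists q0, P q0 /\ ~ P (lam * q0).
  apply: contrapT => h.
  have lamPP x : P x -> P (lam * x) by move=> Px; apply: contrapT => nP; apply: h; exists x.
  have : OK lam.
    apply: (@OK_of_powers a) => // [|k]; first exact: prime_int.
    apply: prime_int; elim: k => [|k IHk]; first by rewrite expr0 mul1r.
    by rewrite exprS -mulrA; apply: lamPP.
  by rewrite -[lam]mulr1 => /(lamP _ (OK1 K)); apply: prime1.
have u_int : OK (lam * q0) by apply/lamP => //; exact: prime_int.
have [u' u'_int Pu'] := prime_inverse u_int nPq0.
exists lam, (1 - lam * q0 * u'), (q0 * u'); split=> //.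
- exact: primeMr.
- by rewrite mulrA subrK.
- by move=> x Px; apply/lamP => //; apply: prime_int.
Qed.

End Prime.
End Dedekind.

Section LocalGenerator.
Variables (K : fieldExtType rat) (P : set K).
Local Notation OK := (@OK K).
Hypothesis P_prime : nonzero_prime OK P.
Variables lam p q : K.
Hypotheses (Pp : P p) (Pq : P q) (pq1 : 1 = p + lam * q).
Hypothesis lamP : forall x, P x -> OK (lam * x).

Lemma mem_prime x : OK x -> P x <-> OK (lam * x).
Proof.
move=> x_int; split=> [/lamP//|lx_int].
rewrite -[x]mul1r pq1 mulrDl [lam * q]mulrC -mulrA.
by apply: primeD => //; apply: primeMr.
Qed.

Lemma generator_not_int : ~ OK lam.
Proof.
move=> lam_int; apply: (prime1 P_prime); rewrite pq1.
by apply: primeD => //; apply: primeM.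
Qed.

(** The n-th power of lam^m x is (lam^n x)^m x^(n-m), which is integral, so lam^m x is integral
    too. *)
Lemma generator_pow_le x m n : OK x -> OK (lam ^+ n * x) -> (m <= n)%N ->
  OK (lam ^+ m * x).
Proof.
move=> x_int nx; case: n nx => [|n] nx le_mn; first by move: le_mn; case: m.
pose r := ((lam ^+ n.+1 * x) ^+ m * x ^+ (n.+1 - m)).
apply: (@OK_root K ('X^(n.+1) - r%:P)).
- exact: monicXnsubC.
- rewrite /root !hornerE /r !exprMn -!exprM mulnC -{2}(subnKC le_mn) exprD.
  by apply/eqP; ring.
- move=> i; rewrite coefB coefXn coefC; apply: OK_sub; first exact: OK_nat.
  case: ifP => _; last exact: OK0.
  by apply: OK_mul; apply: OK_exp.
Qed.

Lemma mem_ideal_pow n x : ideal_pow OK P n x <-> OK x /\ OK (lam ^+ n * x).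
Proof.
elim: n x => [|n IHn] x; first by rewrite expr0 mul1r; split=> [|[]].
split=> [[u [uP ->]]|[x_int nx]].
  split; last rewrite big_distrr /=.
    rewrite big_seq; apply: OK_sum => v /uP[Pv1 /IHn[v2_int _]].
    by apply: OK_mul => //; apply: prime_int Pv1.
  rewrite big_seq; apply: OK_sum => v /uP[Pv1 /IHn[_ v2_int]].
  have -> : lam ^+ n.+1 * (v.1 * v.2) = (lam * v.1) * (lam ^+ n * v.2).
    by rewrite exprS; ring.
  by apply: OK_mul => //; apply: lamP.
have lx : OK (lam * x) by rewrite -[lam]expr1; apply: (generator_pow_le x_int nx).
have nx' : OK (lam ^+ n * x) by apply: (generator_pow_le x_int nx).
(* Multiplying 1 = p + lam q by x writes x as p x + q (lam x); both x and lam x remain integral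
   after multiplication by lam^n, so they lie in the n-th power. *)
exists [:: (p, x); (q, lam * x)]; split.
  move=> v; rewrite !inE => /orP[] /eqP -> /=; split=> //; apply/IHn => //.
  by split=> //; rewrite mulrA -exprSr.
by rewrite !big_cons big_nil addr0 /= {1}[x](esym (mul1r x)) {1}pq1 mulrDl -mulrA mulrCA.
Qed.

Lemma generator_pow_exists x : OK x -> x != 0 ->
  exists n, OK (lam ^+ n * x) /\ ~ OK (lam ^+ n.+1 * x).
Proof.
move=> x_int x_neq0; apply: contrapT => h; apply: generator_not_int.
apply: (@OK_of_powers _ x) => //; elim=> [|k IHk]; first by rewrite expr0 mul1r.
by apply: contrapT => nk; apply: h; exists k.
Qed.

Lemma ideal_ord_eq x n : OK x -> OK (lam ^+ n * x) -> ~ OK (lam ^+ n.+1 * x) ->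
  ideal_ord OK P x = n.
Proof.
move=> x_int nx nx1; apply: xget_unique.
  by split; [apply/mem_ideal_pow|move=> /mem_ideal_pow[]].
move=> m /= [hm hm1]; have [_ mx] := (mem_ideal_pow m x).1 hm.
have mx1 : ~ OK (lam ^+ m.+1 * x).
  by move=> h; apply: hm1; exact: (mem_ideal_pow m.+1 x).2 (conj x_int h).
have [lt|lt|//] := ltngtP m n; exfalso; [apply: mx1 | apply: nx1].
  exact: generator_pow_le nx lt.
exact: generator_pow_le mx lt.
Qed.

Lemma ideal_ord_spec x (n := ideal_ord OK P x) : OK x -> x != 0 ->
  OK (lam ^+ n * x) /\ ~ P (lam ^+ n * x).
Proof.
move=> x_int x_neq0; have [m [mx mx1]] := generator_pow_exists x_int x_neq0.
rewrite /n (ideal_ord_eq x_int mx mx1); split=> //.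
by move=> /(mem_prime mx); rewrite mulrA -exprS.
Qed.

Lemma ideal_ord_unique x n : OK x -> OK (lam ^+ n * x) -> ~ P (lam ^+ n * x) ->
  ideal_ord OK P x = n.
Proof.
move=> x_int nx Pnx; apply: ideal_ord_eq => // h; apply: Pnx.
by apply/mem_prime => //; rewrite mulrA -exprS.
Qed.

Lemma ideal_ord_mul x y : OK x -> OK y -> x != 0 -> y != 0 ->
  ideal_ord OK P (x * y) = (ideal_ord OK P x + ideal_ord OK P y)%N.
Proof.
move=> x_int y_int x_neq0 y_neq0.
have [nx Pnx] := ideal_ord_spec x_int x_neq0; have [ny Pny] := ideal_ord_spec y_int y_neq0.
apply: ideal_ord_unique; first exact: OK_mul; rewrite exprD mulrACA; first exact: OK_mul.
by case/(prime_mul P_prime).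
Qed.

Lemma ideal_ord_gt0 x : OK x -> x != 0 -> P x <-> (0 < ideal_ord OK P x)%N.
Proof.
move=> x_int x_neq0; have [] := ideal_ord_spec x_int x_neq0.
case: (posnP (ideal_ord OK P x)) => [-> /=|n_gt0 nx _].
  by rewrite expr0 mul1r => _ Px; split.
split=> // _; apply/mem_prime => //; rewrite -[lam]expr1.
exact: generator_pow_le nx n_gt0.
Qed.

(** Numerator and denominator are both multiplied by lam to the order of b, which moves the
    denominator out of P and keeps the numerator integral. *)
Lemma local_fraction a b : OK a -> OK b -> a != 0 -> b != 0 ->
  (ideal_ord OK P b <= ideal_ord OK P a)%N ->
  exists c t, [/\ OK c, OK t, ~ P t & a / b = c / t].
Proof.
move=> a_int b_int a_neq0 b_neq0 le_ba.
have [nb Pnb] := ideal_ord_spec b_int b_neq0; have [na _] := ideal_ord_spec a_int a_neq0.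
exists (lam ^+ ideal_ord OK P b * a), (lam ^+ ideal_ord OK P b * b); split=> //.
  exact: generator_pow_le na le_ba.
rewrite -mulf_div divff ?mul1r //; apply: expf_neq0.
by apply/eqP => lam0; apply: generator_not_int; rewrite lam0; apply: OK0.
Qed.

Lemma generator_uniformizer : q != 0 /\ ideal_ord OK P q = 1%N.
Proof.
have lq_int : OK (lam * q) by apply: lamP.
split.
  apply/eqP => q0; apply: (prime1 P_prime); rewrite pq1.
  by rewrite q0 mulr0 addr0.
apply: ideal_ord_unique; rewrite ?expr1 //; first exact: prime_int Pq.
by move=> Plq; apply: (prime1 P_prime); rewrite pq1; apply: primeD.
Qed.

End LocalGenerator.

Section Valuation.
Variables (K : fieldExtType rat) (P : set K).
Local Notation OK := (@OK K).
Hypothesis P_prime : nonzero_prime OK P.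
Local Notation ord := (ideal_ord OK P).
Local Notation val := (val_at OK P).

Let ordM x y : OK x -> OK y -> x != 0 -> y != 0 -> ord (x * y) = (ord x + ord y)%N.
Proof.
have [lam [p [q [Pp Pq pq1 lamP]]]] := prime_local_generator P_prime.
exact: (ideal_ord_mul P_prime Pp Pq pq1 lamP).
Qed.

Lemma val_at_frac a b : OK a -> OK b -> a != 0 -> b != 0 ->
  val (a / b) = (ord a)%:Z - (ord b)%:Z.
Proof.
move=> a_int b_int a_neq0 b_neq0; apply: xget_unique; first by exists a, b.
move=> z [c [t [c_int t_int c_neq0 t_neq0 [abct ->]]]].
have : a * t = c * b.
  by rewrite -[a](divfK b_neq0) abct; field.
move/(congr1 ord); rewrite !ordM //; lia.
Qed.

Lemma val_at_int a : OK a -> a != 0 -> val a = (ord a)%:Z.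
Proof.
move=> a_int a_neq0; have /= := ordM (OK1 K) (OK1 K) (oner_neq0 K) (oner_neq0 K).
rewrite mulr1 => o1.
have := val_at_frac a_int (OK1 K) a_neq0 (oner_neq0 K); rewrite divr1 => ->.
by lia.
Qed.

Lemma val_atM x y : x != 0 -> y != 0 -> val (x * y) = val x + val y.
Proof.
have [a [b [a_int b_int b_neq0 ->]]] := OK_frac x.
have [c [t [c_int t_int t_neq0 ->]]] := OK_frac y.
rewrite !mulf_eq0 !invr_eq0 !negb_or => /andP[a_neq0 _] /andP[c_neq0 _].
rewrite mulf_div !val_at_frac ?mulf_neq0 //; try exact: OK_mul.
by rewrite !ordM //; lia.
Qed.

Lemma val_at_ge0P x : x != 0 -> local_ring OK P x <-> 0 <= val x.
Proof.
have [lam [p [q [Pp Pq pq1 lamP]]]] := prime_local_generator P_prime.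
move=> x_neq0; split=> [[a [t [a_int t_int Pt xE]]]|].
  have t_neq0 : t != 0 by apply: contra_not_neq Pt => ->; case: (prime_subgroup P_prime).
  have a_neq0 : a != 0 by apply: contraNneq x_neq0 => a0; rewrite xE a0 mul0r.
  rewrite xE val_at_frac //.
  have : ~ (0 < ord t)%N by move=> /(ideal_ord_gt0 P_prime Pp Pq pq1 lamP t_int t_neq0).
  lia.
have [a [b [a_int b_int b_neq0 xE]]] := OK_frac x.
have a_neq0 : a != 0 by apply: contraNneq x_neq0 => a0; rewrite xE a0 mul0r.
rewrite xE val_at_frac // subr_ge0 lez_nat => le_ba.
exact: (local_fraction P_prime Pp Pq pq1 lamP).
Qed.

Lemma val_at_gt0P x : OK x -> x != 0 -> P x <-> 0 < val x.
Proof.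
have [lam [p [q [Pp Pq pq1 lamP]]]] := prime_local_generator P_prime.
move=> x_int x_neq0; rewrite val_at_int // ltz_nat.
exact: (ideal_ord_gt0 P_prime Pp Pq pq1 lamP).
Qed.

Lemma exists_uniformizer : exists q, [/\ P q, q != 0 & val q = 1].
Proof.
have [lam [p [q [Pp Pq pq1 lamP]]]] := prime_local_generator P_prime.
have [q_neq0 q1] := generator_uniformizer P_prime Pp Pq pq1 lamP.
by exists q; split=> //; rewrite val_at_int ?q1 //; apply: prime_int Pq.
Qed.

End Valuation.

(** * The product formula *)

Section Ideals.
Variable K : fieldExtType rat.
Local Notation OK := (@OK K).

Lemma ideal_powB P n x y : nonzero_prime OK P ->
  ideal_pow OK P n x -> ideal_pow OK P n y -> ideal_pow OK P n (x - y).
Proof.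
move=> P_prime; have [lam [p [q [Pp Pq pq1 lamP]]]] := prime_local_generator P_prime.
rewrite !(mem_ideal_pow P_prime Pp Pq pq1 lamP) mulrBr.
by move=> [x_int nx] [y_int ny]; split; apply: OK_sub.
Qed.

Lemma ideal_powM P n a x : nonzero_prime OK P ->
  OK a -> ideal_pow OK P n x -> ideal_pow OK P n (a * x).
Proof.
move=> P_prime; have [lam [p [q [Pp Pq pq1 lamP]]]] := prime_local_generator P_prime.
rewrite !(mem_ideal_pow P_prime Pp Pq pq1 lamP) mulrCA.
by move=> a_int [x_int nx]; split; apply: OK_mul.
Qed.

Lemma ideal_powX P n x : nonzero_prime OK P -> P x -> ideal_pow OK P n (x ^+ n).
Proof.
move=> P_prime; have [lam [p [q [Pp Pq pq1 lamP]]]] := prime_local_generator P_prime.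
move=> Px; apply/(mem_ideal_pow P_prime Pp Pq pq1 lamP).
by rewrite -exprMn; split; apply: OK_exp; [exact: prime_int Px | exact: lamP].
Qed.

Lemma prime_incl P Q : nonzero_prime OK P -> nonzero_prime OK Q -> Q `<=` P -> Q = P.
Proof.
move=> P_prime Q_prime QP; apply/seteqP; split=> // z Pz; apply: contrapT => Qz.
have z_int := prime_int P_prime Pz.
have [z' z'_int /QP Pz'] := prime_inverse Q_prime z_int Qz.
apply: (prime1 P_prime); rewrite -[1](subrK (z * z')); apply: primeD => //.
exact: primeMr.
Qed.

Lemma prime_separated P Q : nonzero_prime OK P -> nonzero_prime OK Q -> P <> Q ->
  exists2 z, Q z & ~ P z.
Proof.
move=> P_prime Q_prime PQ; apply: contrapT => h; apply: PQ; apply/esym.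
by apply: prime_incl => // z Qz; apply: contrapT => Pz; apply: h; exists z.
Qed.

(** A prime containing a is a union of classes modulo a, so it is determined by the finite set of
    representatives that it contains. *)
Lemma finite_primes_containing a : OK a -> a != 0 ->
  finite_set [set P | primesK P /\ P a].
Proof.
move=> a_int a_neq0; have [k [I [r [_ r_int rA _]]]] := OK_finite_index a_int a_neq0.
pose g (S : {set I}) : set K := [set x | exists2 i, i \in S & exists2 t, OK t & x = r i + a * t].
apply: (@sub_finite_set _ _ (range g)); last by apply: finite_image; apply: finite_finset.
move=> P [P_prime Pa]; exists [set i | `[< P (r i) >]]%SET => //.
apply/seteqP; split=> x /=.
  case=> i; rewrite !inE => Pri [t t_int ->]; apply: primeD => //.
  exact: primeMr.
move=> Px; have [i [t t_int tE]] := rA x (prime_int P_prime Px).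
exists i; last by exists t => //; rewrite tE addrC subrK.
rewrite !inE -[r i](subKr x) -tE; apply: primeB => //; exact: primeMr.
Qed.

(* The ideal of denominators of a suitable multiple of [x] is maximal among
   such ideals, hence prime. *)
Lemma prime_of_denominators x : ~ OK x -> exists2 P, nonzero_prime OK P &
  forall z, OK z -> OK (z * x) -> P z.
Proof.
move=> x_nint; have [k k_gt0 kx] := OK_scale x.
have k_neq0 : (k%:R : K) != 0 by rewrite natK_eq0 -lt0n.
have [_ [I [r [_ r_int rA _]]]] := OK_finite_index (OK_nat K k) k_neq0.
pose S c := [set i : I | `[< OK (r i * (c * x)) >]]%SET.
pose good c := OK c /\ ~ OK (c * x).
pose Q m := `[< exists2 c, good c & #|S c| = m >].
have exQ : exists m, Q m.
  exists #|S 1|; apply/asboolP; exists 1 => //; split; first exact: OK1.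
  by rewrite mul1r.
have ubQ m : Q m -> (m <= #|I|)%N by move=> /asboolP[b _ <-]; apply: max_card.
case: (ex_maxnP exQ ubQ) => m /asboolP[c [c_int cx] cm] maxm {exQ ubQ}.
have red b z : OK b -> OK z -> exists2 i, OK (z * (b * x)) <-> OK (r i * (b * x)) &
    exists2 t, OK t & k%:R * t = z - r i.
  move=> b_int z_int; have [i [t t_int tE]] := rA _ z_int; exists i; last by exists t.
  have h : OK ((z - r i) * (b * x)).
    by rewrite -tE (_ : _ * _ = t * b * (k%:R * x)); [apply: OK_mul => //; apply: OK_mul|ring].
  by split=> h'; [have := OK_sub h' h | have := OK_add h' h]; congr OK; ring.
exists [set z | OK z /\ OK (z * (c * x))]; last first.
  by move=> z z_int zx; split=> //; rewrite mulrCA; apply: OK_mul.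
split.
- by move=> z [].
- exists k%:R => //; split; first exact: OK_nat.
  by rewrite mulrCA; apply: OK_mul.
- split=> [z y [z_int zx] [y_int yx]|a z a_int [z_int zx]]; split.
  + exact: OK_add.
  + by rewrite mulrDl; apply: OK_add.
  + exact: OK_mul.
  + by rewrite -mulrA; apply: OK_mul.
- by move=> [_]; rewrite mul1r.
move=> z y z_int y_int [_ zyx].
have [zx|zx] := pselect (OK (z * (c * x))); first by left.
right; split=> //.
have zc_good : good (z * c) by split; [exact: OK_mul|rewrite -mulrA].
have SE : S c = S (z * c).
  apply/eqP; rewrite eqEcard; apply/andP; split; last first.
    by rewrite cm; apply: maxm; apply/asboolP; exists (z * c).
  apply/fintype.subsetP => i; rewrite !inE => h.
  by rewrite -mulrA mulrCA; apply: OK_mul.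
have [i iP [t t_int tE]] := red c y c_int y_int; apply/iP.
have : i \in S (z * c).
  have riE : r i = y - k%:R * t by rewrite tE; ring.
  rewrite !inE; have -> : r i * (z * c * x) = z * y * (c * x) - z * t * c * (k%:R * x).
    by rewrite riE; ring.
  by apply: OK_sub => //; apply: OK_mul => //; apply: OK_mul => //; apply: OK_mul.
by rewrite -SE !inE.
Qed.

(** Were x not integral, [prime_of_denominators] would give a prime P containing every denominator
    of x; but a nonnegative valuation at P provides a denominator outside P. *)
Lemma val_at_ge0_int x : x != 0 ->
  (forall P, nonzero_prime OK P -> 0 <= val_at OK P x) -> OK x.
Proof.
move=> x_neq0 valx; apply: contrapT => /prime_of_denominators[P P_prime PD].
have /(val_at_ge0P P_prime x_neq0)[a [t [a_int t_int Pt xE]]] := valx P P_prime.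
apply: Pt; apply: PD => //; rewrite xE mulrC divfK //.
by apply: contra_neqN x_neq0 => /eqP t0; rewrite xE t0 invr0 mulr0.
Qed.

Lemma ideal_norm_index P : nonzero_prime OK P -> has_index OK P (ideal_norm OK P).
Proof.
move=> P_prime; have sP := prime_subgroup P_prime.
have [_ [a Pa a_neq0] _ _ _] := P_prime.
have [k [I [r [_ r_int rA _]]]] := OK_finite_index (prime_int P_prime Pa) a_neq0.
pose C := [set [set x + y | y in P] | x in OK].
(* [fset_set] has the expected cardinality for finite sets only, so finiteness of the set of cosets
   comes before any statement about [ideal_norm]. *)
have C_fin : finite_set C.
  apply: (@sub_finite_set _ _ [set [set r i + y | y in P] | i in [set: I]]); last first.
    by apply: finite_image; apply: finite_finset.
  move=> _ [x x_int <-]; have [i [t t_int tE]] := rA x x_int; exists i => //.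
  by apply/esym/coset_eq => //; rewrite -tE; apply: primeMr.
have repC (c : fset_set C) : exists2 x, OK x & [set x + y | y in P] = val c.
  by have := valP c; rewrite in_fset_set // inE.
pose rep c := s2val (cid2 (repC c)).
have rep_int c : OK (rep c) := s2valP (cid2 (repC c)).
have repE c : [set rep c + y | y in P] = val c := s2valP' (cid2 (repC c)).
exists (fset_set C), rep; split=> //.
- by rewrite /ideal_norm -/C cardfE.
- move=> x x_int.
  have xC : [set x + y | y in P] \in fset_set C.
    by rewrite in_fset_set // inE; exists x.
  by exists [` xC]%fset; apply/coset_eq => //; rewrite repE.
- move=> c c' /(coset_eq _ _ sP); rewrite !repE; exact: val_inj.
Qed.

Lemma ideal_norm_gt1 P : nonzero_prime OK P -> (1 < ideal_norm OK P)%N.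
Proof.
move=> P_prime; have sP := prime_subgroup P_prime.
have := has_index_inj sP (ideal_norm_index P_prime) (r := fun b : bool => (b : nat)%:R).
rewrite card_bool; apply; first by case; [exact: OK1 | exact: OK0].
case=> -[] //=; rewrite ?subr0 ?sub0r => P1; case: (prime1 P_prime) => //.
by rewrite -[1]opprK; apply: primeN.
Qed.

End Ideals.

(** * The index of a principal ideal computed from its prime factorization *)

Section IdealChain.
Variable K : fieldExtType rat.
Local Notation OK := (@OK K).
Local Notation ord := (ideal_ord OK).

Lemma mem_ideal_pow_ord P n x : nonzero_prime OK P -> OK x -> x != 0 ->
  ideal_pow OK P n x <-> (n <= ord P x)%N.
Proof.
move=> P_prime x_int x_neq0.
have [lam [p [q [Pp Pq pq1 lamP]]]] := prime_local_generator P_prime.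
rewrite (mem_ideal_pow P_prime Pp Pq pq1 lamP).
have [ox Pox] := ideal_ord_spec P_prime Pp Pq pq1 lamP x_int x_neq0.
split=> [[_ nx]|le_n]; last first.
  by split=> //; apply: (generator_pow_le x_int ox le_n).
rewrite leqNgt; apply/negP => lt_n; apply: Pox.
apply/(mem_prime P_prime Pp Pq pq1 lamP) => //; rewrite mulrA -exprS.
exact: (generator_pow_le x_int nx lt_n).
Qed.

Variable T : seq (set K).
Hypothesis T_prime : forall P, P \in T -> nonzero_prime OK P.

(** This stands for the product of the ideals P^(e P), which for distinct primes equals their
    intersection; the intersection has the advantage that membership is tested one prime at a
    time. *)
Definition pow_inter (e : set K -> nat) : set K :=
  [set z | OK z /\ forall P, P \in T -> ideal_pow OK P (e P) z].

Lemma pow_inter_subgroup e : subgroup (pow_inter e).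
Proof.
have OK_sg : subgroup OK by split; [exact: OK0 | exact: OK_sub].
split=> [|x y [x_int xe] [y_int ye]]; split; try exact: OK0; try exact: OK_sub.
  move=> P PT; have [_ [a Pa _] _ _ _] := T_prime PT.
  have ae := ideal_powX (e P) (T_prime PT) Pa.
  by rewrite -(subrr (a ^+ e P)); apply: ideal_powB => //; apply: T_prime.
by move=> P PT; apply: ideal_powB; [exact: T_prime | exact: xe | exact: ye].
Qed.

Lemma pow_interM e a x : OK a -> pow_inter e x -> pow_inter e (a * x).
Proof.
move=> a_int [x_int xe]; split; first exact: OK_mul.
by move=> P PT; apply: ideal_powM; [exact: T_prime | | exact: xe].
Qed.

(** A uniformizer at P to the power e P is multiplied, for each other Q in T, by the power e Q of an
    element of Q outside P, which leaves the order at P unchanged. *)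
Lemma pow_inter_generator e P : P \in T -> exists t, [/\ pow_inter e t, t != 0 & ord P t = e P].
Proof.
move=> PT; have P_prime := T_prime PT.
have [lam [p [q [Pp Pq pq1 lamP]]]] := prime_local_generator P_prime.
have [q_neq0 q1] := generator_uniformizer P_prime Pp Pq pq1 lamP.
have sep Q : exists s, Q \in T -> Q != P -> Q s /\ ~ P s.
  have [QT|] := boolP (Q \in T); last by exists 0.
  have [->|/eqP QP] := eqVneq Q P; first by exists 0.
  have [|s Qs Ps] := prime_separated P_prime (T_prime QT); first by move=> e'; apply: QP.
  by exists s.
pose s Q := projT1 (cid (sep Q)).
have sP Q : Q \in T -> Q != P -> Q (s Q) /\ ~ P (s Q) := projT2 (cid (sep Q)).
pose t := q ^+ e P * \prod_(Q <- T | Q != P) s Q ^+ e Q.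
have s_int Q : Q \in T -> Q != P -> OK (s Q).
  by move=> QT QP; apply: (prime_int (T_prime QT)); case: (sP Q QT QP).
have u_int (r : seq (set K)) : {subset r <= T} -> OK (\prod_(Q <- r | Q != P) s Q ^+ e Q) /\
    ~ P (\prod_(Q <- r | Q != P) s Q ^+ e Q).
  elim: r => [|Q r IHr] rT; first by rewrite big_nil; split; [exact: OK1 | exact: prime1].
  have [|r_int Pr] := IHr; first by move=> Q' Q'r; apply: rT; rewrite inE Q'r orbT.
  have QT : Q \in T by apply: rT; rewrite inE eqxx.
  rewrite big_cons; case: ifP => // QP; split; first by apply: OK_mul => //; apply: OK_exp; apply: s_int.
  case/(prime_mul P_prime) => //; first by apply: OK_exp; apply: s_int.
  by move=> /(primeX P_prime (s_int _ QT QP)); case: (sP Q QT QP).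
have [T_int PT'] := u_int T (fun _ => id).
have qe_int : OK (q ^+ e P) by apply: OK_exp; apply: prime_int Pq.
have t_int : OK t by apply: OK_mul.
have lq_int : OK (lam * q) by apply: lamP.
have nPlq : ~ P (lam * q).
  by move=> Plq; apply: (prime1 P_prime); rewrite pq1; apply: primeD.
have tE : lam ^+ e P * t = (lam * q) ^+ e P * \prod_(Q <- T | Q != P) s Q ^+ e Q.
  by rewrite /t mulrA exprMn.
exists t; split.
- split=> // Q QT; have [->|QP] := eqVneq Q P.
    by rewrite /t mulrC; apply: ideal_powM => //; apply: ideal_powX.
  rewrite /t (big_rem Q) //= QP mulrCA mulrC; apply: ideal_powM; first exact: T_prime.
    apply: OK_mul => //; apply: (u_int _ _).1 => Q'; exact: mem_rem.
  by apply: ideal_powX; [exact: T_prime | case: (sP Q QT QP)].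
- rewrite mulf_neq0 ?expf_neq0 //; apply: contra_not_neq PT' => ->.
  by case: (prime_subgroup P_prime).
- apply: (ideal_ord_unique P_prime Pp Pq pq1 lamP) => //; rewrite tE.
    by apply: OK_mul => //; apply: OK_exp.
  case/(prime_mul P_prime) => //; first exact: OK_exp.
  by move=> /(primeX P_prime lq_int).
Qed.

(** With I the ideal of exponents e, multiplication by the generator t identifies OK / P with I / P
    I. The class of w in I is recovered from lam^(e P) w times the inverse [t'] of lam^(e P) t
    modulo P. *)
Lemma index_pow_inter_step e P : P \in T ->
  has_index (pow_inter e) (pow_inter (fun Q => e Q + (Q == P))%N) (ideal_norm OK P).
Proof.
move=> PT; have P_prime := T_prime PT.
have [lam [p [q [Pp Pq pq1 lamP]]]] := prime_local_generator P_prime.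
have powP := mem_ideal_pow P_prime Pp Pq pq1 lamP.
have [t [te t_neq0 ordt]] := pow_inter_generator e PT.
have [t_int tP] := te.
have [t0_int Pt0] := ideal_ord_spec P_prime Pp Pq pq1 lamP t_int t_neq0.
rewrite ordt in t0_int Pt0; set t0 := lam ^+ e P * t in t0_int Pt0.
have [t' t'_int Pt'] := prime_inverse P_prime t0_int Pt0.
have memS z : pow_inter (fun Q => e Q + (Q == P))%N z <->
    pow_inter e z /\ P (lam ^+ e P * z).
  split=> [[z_int ze]|[[z_int ze] Pz]].
    have := ze P PT; rewrite eqxx addn1 => /powP[_ zP].
    have ez : pow_inter e z.
      split=> // Q QT; have := ze Q QT.
      case: (eqVneq Q P) => [->|]; last by rewrite addn0.
      rewrite addn1 => /powP[_ h]; apply/powP; split=> //.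
      exact: generator_pow_le h _.
    split=> //; have /powP[_ h] := ez.2 P PT.
    by apply/(mem_prime P_prime Pp Pq pq1 lamP) => //; rewrite mulrA -exprS.
  split=> // Q QT; case: (eqVneq Q P) => [->|_]; last by rewrite addn0; apply: ze.
  by rewrite addn1; apply/powP; split=> //; rewrite exprS -mulrA; apply: lamP.
have [I [r [cI r_int rA r_inj]]] := ideal_norm_index P_prime.
exists I, (fun i => r i * t); split=> //.
- by move=> i; apply: pow_interM.
- move=> w we; have [w_int /(_ P PT)/powP[_ w0_int]] := we.
  have z_int : OK (lam ^+ e P * w * t') by apply: OK_mul.
  have [i Pi] := rA _ z_int; exists i; apply/memS; split.
    by apply: (pow_inter_subgroup e).2 => //; apply: pow_interM.
  rewrite (_ : lam ^+ e P * (w - r i * t) =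
    (1 - t0 * t') * (lam ^+ e P * w) + (lam ^+ e P * w * t' - r i) * t0); last first.
    by rewrite /t0; ring.
  by apply: primeD => //; apply: primeMr.
- move=> i j /memS[_]; rewrite -mulrBl mulrCA => /(prime_mul P_prime) h; apply: r_inj.
  by case: h => //; apply: OK_sub.
Qed.

Lemma index_pow_inter e : uniq T ->
  has_index OK (pow_inter e) (\prod_(P <- T) ideal_norm OK P ^ e P)%N.
Proof.
move=> T_uniq; have OK_sg : subgroup OK by split; [exact: OK0 | exact: OK_sub].
move: {2}(\sum_(P <- T) e P)%N (leqnn (\sum_(P <- T) e P)) => m.
elim: m e => [|m IHm] e le_m; last have [/hasP[P PT eP]|/hasPn e0] := boolP (has (fun P => 0 < e P)%N T).
- have e0 P : P \in T -> e P = 0%N.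
    move=> PT; apply/eqP; rewrite -leqn0 (leq_trans _ le_m) //.
    by rewrite (big_rem P) //= leq_addr.
  rewrite big_seq big1 => [|P /e0->]; last by rewrite expn0.
  have -> : pow_inter e = OK; last exact: (has_index1 (OK0 K) OK_sg).
  apply/seteqP; split=> [z []//|z z_int]; split=> // P /e0 ->.
  exact: z_int.
- pose e' Q := (e Q - (Q == P))%N.
  have eE : e = (fun Q => e' Q + (Q == P))%N.
    by apply/funext => Q; rewrite /e' subnK //; case: eqP => // ->.
  have le' : (\sum_(Q <- T) e' Q <= m)%N.
    rewrite -ltnS (leq_trans _ le_m) //.
    have -> : (\sum_(Q <- T) e Q = \sum_(Q <- T) e' Q + \sum_(Q <- T) (Q == P))%N.
      by rewrite {1}eE big_split.
    rewrite -addn1 leq_add2l.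
    by rewrite (big_rem P) //= eqxx.
  have -> : (\prod_(Q <- T) ideal_norm OK Q ^ e Q =
      (\prod_(Q <- T) ideal_norm OK Q ^ e' Q) * ideal_norm OK P)%N.
    rewrite {1}eE; under eq_bigr do rewrite expnD.
    rewrite big_split /=; congr (_ * _)%N.
    rewrite (bigD1_seq P) //= eqxx expn1 big1 ?muln1 // => Q /negPf ->.
    by rewrite expn0.
  have := index_pow_inter_step e' PT; rewrite -eE => step.
  apply: (has_index_trans OK_sg (pow_inter_subgroup e') _ _ (IHm _ le') step).
    by move=> z [].
  move=> z [z_int ze]; split=> // Q QT; have := ze Q QT; have Q_prime := T_prime QT.
  have [->|z_neq0] := eqVneq z 0.
    by move=> _; apply: (pow_inter_subgroup e').1.2.
  by rewrite !mem_ideal_pow_ord // => /(leq_trans _); apply; rewrite /e' leq_subr.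
- have e0' P : P \in T -> e P = 0%N by move=> /e0; rewrite -leqNgt leqn0 => /eqP.
  by apply: IHm; rewrite big_seq big1.
Qed.

(** An element z of the intersection has order at least that of a at every prime, so z / a has no
    negative valuation and is integral. *)
Lemma pow_inter_principal a : OK a -> a != 0 ->
  (forall P, nonzero_prime OK P -> P a -> P \in T) ->
  pow_inter (ord^~ a) = [set a * x | x in OK].
Proof.
move=> a_int a_neq0 Ta; apply/seteqP; split=> z; last first.
  move=> [x x_int <-]; split; first exact: OK_mul.
  move=> P PT; rewrite mulrC; apply: ideal_powM => //; first exact: T_prime.
  by apply/mem_ideal_pow_ord => //; apply: T_prime.
move=> [z_int za]; exists (z / a); last by rewrite mulrC divfK.
have [->|z_neq0] := eqVneq z 0; first by rewrite mul0r; apply: OK0.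
apply: val_at_ge0_int => [|P P_prime]; first by rewrite mulf_neq0 ?invr_neq0.
rewrite val_at_frac // subr_ge0 lez_nat.
have [PT|PT] := boolP (P \in T); first by apply/mem_ideal_pow_ord => //; apply: za.
have [lam [p [q [Pp Pq pq1 lamP]]]] := prime_local_generator P_prime.
rewrite leqNgt; apply: contraNN PT => lt; apply: Ta => //.
apply/(ideal_ord_gt0 P_prime Pp Pq pq1 lamP) => //.
exact: leq_trans lt.
Qed.

End IdealChain.

(** * Absolute values *)

Section ComplexEmbeddings.
Variables (R : realType) (K : fieldExtType rat).
Local Notation n := (\dim {:K}).
Local Notation OK := (@OK K).
Local Notation normc := (@complex.ComplexField.Normc.normc R).
Local Notation ord := (ideal_ord OK).

Lemma normc_norm (z : R[i]) : `|z| = (normc z)%:C%C.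
Proof. by []. Qed.

Lemma normc_ge0 (z : R[i]) : 0 <= normc z.
Proof. by rewrite -lecR -normc_norm normr_ge0. Qed.

Lemma normcD (x y : R[i]) : normc (x + y) <= normc x + normc y.
Proof. by rewrite -lecR rmorphD /= -!normc_norm ler_normD. Qed.

Lemma normc_eq0 (x : R[i]) : (normc x == 0) = (x == 0).
Proof.
apply/eqP/eqP => [/complex.ComplexField.Normc.eq0_normc //|->].
exact: complex.ComplexField.Normc.normc0.
Qed.

Lemma normc_prod I (r : seq I) (F : I -> R[i]) :
  normc (\prod_(i <- r) F i) = \prod_(i <- r) normc (F i).
Proof.
elim: r => [|i r IHr]; first by rewrite !big_nil complex.ComplexField.Normc.normc1.
by rewrite !big_cons complex.ComplexField.Normc.normcM IHr.
Qed.

Lemma normc_int (z : int) : normc z%:~R = (`|z|%N)%:R.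
Proof.
apply: (fmorph_inj (real_complex R)); rewrite /= -normc_norm -intr_norm -abszE.
by rewrite rmorph_nat.
Qed.

Lemma normc_sum I (r : seq I) (F : I -> R[i]) :
  normc (\sum_(i <- r) F i) <= \sum_(i <- r) normc (F i).
Proof.
elim: r => [|i r IHr]; first by rewrite !big_nil complex.ComplexField.Normc.normc0.
by rewrite !big_cons (le_trans (normcD _ _)) // lerD2l.
Qed.

Lemma finite_le_nat (B : R) : exists m : nat, B <= m%:R.
Proof.
exists (Num.truncn (Num.max B 0)).+1; apply: le_trans (ltW (truncnS_gt _)).
by rewrite le_max lexx.
Qed.

(** The middle claim compares two computations of the index of a OK, as a determinant and along the
    chain of prime powers. The last one holds because inverting [conj_mx] bounds the integer
    coordinates in the integral basis in terms of the conjugates. *)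
Lemma exists_complex_embeddings : exists s : 'I_n -> {rmorphism K -> R[i]},
  [/\ forall F : (K -> R[i]) -> R,
        \sum_(sigma \in @embeddings R K) F sigma = \sum_k F (s k),
      forall (a : K) (T : seq (set K)), OK a -> a != 0 -> uniq T -> (forall P, P \in T -> primesK P) ->
        (forall P, primesK P -> P a -> P \in T) ->
        \prod_k normc (s k a) = (\prod_(P <- T) ideal_norm OK P ^ ord P a)%:R &
      forall B : R, finite_set [set x | OK x /\ forall k, normc (s k x) <= B]].
Proof.
have [theta [s [s_inj s_all s_gen]]] := exists_embeddings K (R[i]).
have [w [w_int w_unit w_gen]] := exists_integral_basis s_inj s_gen.
exists s; split.
- move=> F; pose r := [seq (s k : K -> R[i]) | k <- enum 'I_n].
  have r_uniq : uniq r.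
    rewrite map_inj_uniq ?enum_uniq // => i j e; apply: s_inj.
    by rewrite e.
  have -> : @embeddings R K = [set` r].
    apply/seteqP; split=> sigma /=.
      move=> [g ->]; have [k gk] := s_all g; apply/mapP; exists k; first by rewrite mem_enum.
      by apply/funext.
    by case/mapP => k _ ->; exists (s k).
  by rewrite -fsbig_seq // big_map big_enum.
- move=> a T a_int a_neq0 T_uniq T_prime Ta.
  have [k idx normE] := index_principal w_int w_unit w_gen a_int a_neq0.
  have := index_pow_inter T_prime (ord^~ a) T_uniq.
  rewrite pow_inter_principal // => idx'.
  have sg : subgroup [set a * x | x in OK].
    split; first by exists 0; rewrite ?mulr0 //; apply: OK0.
    by move=> _ _ [x ? <-] [y ? <-]; exists (x - y); [exact: OK_sub|rewrite mulrBr].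
  rewrite -(has_index_unique sg idx idx').
  apply: (fmorph_inj (real_complex R)); rewrite /= -normc_prod -normc_norm normE.
  by rewrite rmorph_nat.
move=> B; pose U := invmx (conj_mx s w).
have [m Bm] := finite_le_nat (\sum_(i < n) \sum_(k < n) B * normc (U k i)).
apply: (@sub_finite_set _ _ (of_coords w @` [set a : 'rV[int]_n | forall i, (`|a 0%R i| <= m)%N])).
  move=> x [/w_gen[a xa] sx]; exists a => //= i.
  have B_ge0 : 0 <= B := le_trans (normc_ge0 _) (sx i).
  rewrite -(ler_nat R) (le_trans _ Bm) // -normc_int.
  have -> : ((a 0 i)%:~R : R[i]) = \sum_k s k x * U k i.
    have := conjugates_of_coords s w a; rewrite /of_coords -xa => /(congr1 (mulmx^~ U)).
    by rewrite mulmxK // => /rowP/(_ i); rewrite !mxE => <-; apply: eq_bigr => k _; rewrite !mxE.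
  rewrite (le_trans (normc_sum _ _)) // [leRHS](bigD1 i) //= -[leLHS]addr0 lerD //.
    apply: ler_sum => k _; rewrite complex.ComplexField.Normc.normcM.
    by rewrite ler_wpM2r ?normc_ge0.
  by do 2![apply: sumr_ge0 => ? _]; rewrite mulr_ge0 ?normc_ge0.
by apply: finite_image; apply: finite_bounded_int.
Qed.

End ComplexEmbeddings.

Section PrimeAbs.
Variables (R : realType) (K : fieldExtType rat) (P : set K).
Local Notation OK := (@OK K).
Hypothesis P_prime : nonzero_prime OK P.
Local Notation N := ((ideal_norm OK P)%:R : R).
Local Notation abs := (prime_abs R P).

Let N_gt1 : 1 < N. Proof. by rewrite ltr1n ideal_norm_gt1. Qed.

Let N_neq0 : N != 0. Proof. by rewrite gt_eqF // (lt_trans ltr01). Qed.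

Lemma prime_absE x : x != 0 -> abs x = N ^ (- val_at OK P x).
Proof. by rewrite /prime_abs => /negPf ->. Qed.

Lemma prime_abs0 : abs 0 = 0. Proof. by rewrite /prime_abs eqxx. Qed.

Lemma prime_abs_gt0 x : x != 0 -> 0 < abs x.
Proof. by move=> x0; rewrite prime_absE // exprz_gt0 // (lt_trans ltr01). Qed.

Lemma prime_abs_ge0 x : 0 <= abs x.
Proof. by have [->|/prime_abs_gt0/ltW//] := eqVneq x 0; rewrite prime_abs0. Qed.

Lemma prime_absM x y : abs (x * y) = abs x * abs y.
Proof.
have [->|x0] := eqVneq x 0; first by rewrite mul0r prime_abs0 mul0r.
have [->|y0] := eqVneq y 0; first by rewrite mulr0 prime_abs0 mulr0.
by rewrite !prime_absE ?mulf_neq0 // (val_atM P_prime) // opprD expfzDr.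
Qed.

Lemma prime_abs1 : abs 1 = 1.
Proof.
have := prime_absM 1 1; rewrite mulr1 -{1}[abs 1]mulr1.
by move/(mulfI (lt0r_neq0 (prime_abs_gt0 (oner_neq0 K)))).
Qed.

Lemma prime_absX x k : abs (x ^+ k) = abs x ^+ k.
Proof. by elim: k => [|k IHk]; rewrite ?prime_abs1 // !exprS prime_absM IHk. Qed.

Lemma prime_absV x : abs x^-1 = (abs x)^-1.
Proof.
have [->|x0] := eqVneq x 0; first by rewrite invr0 prime_abs0 invr0.
have ax0 := lt0r_neq0 (prime_abs_gt0 x0).
by apply: (mulfI ax0); rewrite -prime_absM !mulfV // prime_abs1.
Qed.

Lemma prime_abs_le1 x : x != 0 -> (abs x <= 1) = (0 <= val_at OK P x).
Proof.
by move=> x0; rewrite prime_absE // -[X in _ <= X](expr0z N) ler_eXz2l // oppr_le0.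
Qed.

Lemma prime_abs_lt1 x : x != 0 -> (abs x < 1) = (0 < val_at OK P x).
Proof.
by move=> x0; rewrite prime_absE // -[X in _ < X](expr0z N) ltr_eXz2l // oppr_lt0.
Qed.

Lemma prime_abs_le1P x : abs x <= 1 <-> local_ring OK P x.
Proof.
have [->|x0] := eqVneq x 0; last by rewrite prime_abs_le1 // (val_at_ge0P P_prime).
rewrite prime_abs0 ler01; split=> // _; exists 0, 1; split; rewrite ?mul0r //.
- exact: OK0.
- exact: OK1.
- exact: prime1.
Qed.

Lemma prime_abs_int x : OK x -> abs x <= 1.
Proof.
move=> x_int; apply/prime_abs_le1P; exists x, 1; split; rewrite ?divr1 //.
  exact: OK1.
exact: prime1.
Qed.

Lemma prime_abs_lt1P x : OK x -> P x <-> abs x < 1.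
Proof.
move=> x_int; have [->|x0] := eqVneq x 0; last first.
  by rewrite prime_abs_lt1 // (val_at_gt0P P_prime).
by rewrite prime_abs0 ltr01; split=> // _; case: (prime_subgroup P_prime).
Qed.

Lemma prime_abs_eq1P x : OK x -> ~ P x <-> abs x = 1.
Proof.
move=> x_int; rewrite (prime_abs_lt1P x_int); have := prime_abs_int x_int.
rewrite le_eqVlt => /orP[/eqP ->|lt1]; first by rewrite ltxx; split.
by split=> [//|x1]; rewrite x1 ltxx in lt1.
Qed.

Lemma prime_absD1 x : abs x <= 1 -> abs (1 + x) <= 1.
Proof.
move=> /prime_abs_le1P[a [t [a_int t_int Pt ->]]]; apply/prime_abs_le1P.
have t0 : t != 0 by apply: contra_not_neq Pt => ->; case: (prime_subgroup P_prime).
exists (t + a), t; split=> //; first exact: OK_add.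
by rewrite mulrDl divff.
Qed.

Lemma prime_absD x y : abs (x + y) <= Num.max (abs x) (abs y).
Proof.
wlog le : x y / abs x <= abs y.
  move=> h; case/orP: (le_total (abs x) (abs y)) => le; first exact: h.
  by rewrite addrC maxC; apply: h.
have [y0|y0] := eqVneq y 0.
  by rewrite y0 addr0 le_max lexx.
have -> : x + y = y * (1 + x / y) by field.
rewrite prime_absM le_max; apply/orP; right.
rewrite -[leRHS]mulr1 ler_wpM2l ?prime_abs_ge0 // prime_absD1 //.
by rewrite prime_absM prime_absV ler_pdivrMr ?mul1r // prime_abs_gt0.
Qed.

Lemma prime_abs_add x y : abs (x + y) <= abs x + abs y.
Proof.
rewrite (le_trans (prime_absD x y)) // ge_max lerDl lerDr !prime_abs_ge0 //.
Qed.

End PrimeAbs.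

Section ProductFormula.
Variables (R : realType) (K : fieldExtType rat).
Local Notation n := (\dim {:K}).
Local Notation OK := (@OK K).
Local Notation normc := (@complex.ComplexField.Normc.normc R).
Local Notation ord := (ideal_ord OK).

Lemma finite_seq (T : choiceType) (A : set T) : finite_set A ->
  exists2 r : seq T, uniq r & forall x, x \in r <-> A x.
Proof.
move=> A_fin; exists (fset_set A); first exact: fset_uniq.
by move=> x; rewrite in_fset_set // inE.
Qed.

Lemma finite_prime_abs_neq1 (x : K) : x != 0 ->
  finite_set [set P | primesK P /\ prime_abs R P x != 1].
Proof.
have [a [b [a_int b_int b_neq0 ->]]] := OK_frac x => ab_neq0.
have a_neq0 : a != 0 by apply: contraNneq ab_neq0 => ->; rewrite mul0r.
apply: (@sub_finite_set _ _ [set P | primesK P /\ P (a * b)]); last first.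
  by apply: finite_primes_containing; [exact: OK_mul | rewrite mulf_neq0].
move=> P [P_prime Px]; split=> //; apply: contrapT => /(prime_abs_eq1P R P_prime (OK_mul a_int b_int)).
have [Pa|/(prime_abs_eq1P R P_prime a_int) Pa] := pselect (P a).
  by move=> /(prime_abs_eq1P R P_prime (OK_mul a_int b_int)); apply; apply: primeMr.
rewrite prime_absM // Pa mul1r => Pb; move: Px.
by rewrite prime_absM // prime_absV // Pa Pb invr1 mulr1 eqxx.
Qed.

Lemma finite_prime_abs_gt1 (x : K) : finite_set [set P | primesK P /\ 1 < prime_abs R P x].
Proof.
have [->|x0] := eqVneq x 0.
  apply: (@sub_finite_set _ _ set0) => // P [_]; rewrite prime_abs0 ltNge ler01 //.
apply: sub_finite_set (finite_prime_abs_neq1 x0) => P [P_prime gt1]; split=> //.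
by rewrite gt_eqF.
Qed.

Variable s : 'I_n -> {rmorphism K -> R[i]}.
Hypothesis s_norm : forall (a : K) (T : seq (set K)), OK a -> a != 0 -> uniq T ->
  (forall P, P \in T -> primesK P) -> (forall P, primesK P -> P a -> P \in T) ->
  \prod_k normc (s k a) = (\prod_(P <- T) ideal_norm OK P ^ ord P a)%:R.
Hypothesis s_finite : forall B : R, finite_set [set x | OK x /\ forall k, normc (s k x) <= B].

Let product_formula_int (a : K) (T : seq (set K)) : OK a -> a != 0 -> uniq T ->
  (forall P, P \in T -> primesK P) -> (forall P, primesK P -> P a -> P \in T) ->
  \prod_k normc (s k a) * \prod_(P <- T) prime_abs R P a = 1.
Proof.
move=> a_int a_neq0 T_uniq T_prime Ta; rewrite (s_norm a_int a_neq0 T_uniq) //.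
rewrite natr_prod -big_split /= big_seq big1 // => P /T_prime P_prime.
rewrite prime_absE // val_at_int // -exprnN natrX mulfV // expf_neq0 //.
by rewrite pnatr_eq0 -lt0n (ltn_trans _ (ideal_norm_gt1 P_prime)).
Qed.

Lemma product_formula (x : K) (T : seq (set K)) : x != 0 -> uniq T ->
  (forall P, P \in T -> primesK P) ->
  (forall P, primesK P -> prime_abs R P x != 1 -> P \in T) ->
  \prod_k normc (s k x) * \prod_(P <- T) prime_abs R P x = 1.
Proof.
have [a [b [a_int b_int b_neq0 xE]]] := OK_frac x => x_neq0 T_uniq T_prime Tx.
have a_neq0 : a != 0 by apply: contraNneq x_neq0 => a0; rewrite xE a0 mul0r.
have ab_neq0 : a * b != 0 by rewrite mulf_neq0.
have [r r_uniq rP] := finite_seq (finite_primes_containing (OK_mul a_int b_int) ab_neq0).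
(* Numerator and denominator of x may share primes outside [T], which cancel in x. They are added to
   [T] so that the integral case applies to each separately. *)
pose T' := T ++ [seq P <- r | P \notin T].
have T'_uniq : uniq T'.
  rewrite cat_uniq T_uniq filter_uniq // andbT; apply/hasPn => P.
  by rewrite mem_filter => /andP[].
have memT' P : (P \in T') = (P \in T) || (P \in r).
  by rewrite mem_cat mem_filter; case: (P \in T).
have T'_prime P : P \in T' -> primesK P.
  by rewrite memT' => /orP[/T_prime //|/rP[]].
have -> : \prod_(P <- T) prime_abs R P x = \prod_(P <- T') prime_abs R P x.
  rewrite big_cat /= [X in _ * X]big_seq [X in _ * X]big1 ?mulr1 // => P.
  rewrite mem_filter => /andP[PT /rP[P_prime _]].
  by apply/eqP; apply: contraNT PT => Px; apply: Tx.
have aE : \prod_k normc (s k a) * \prod_(P <- T') prime_abs R P a = 1.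
  apply: product_formula_int => // P P_prime Pa; rewrite memT'; apply/orP; right.
  by apply/rP; split=> //; apply: primeMr.
have bE : \prod_k normc (s k b) * \prod_(P <- T') prime_abs R P b = 1.
  apply: product_formula_int => // P P_prime Pa; rewrite memT'; apply/orP; right.
  by apply/rP; split=> //; apply: primeM.
rewrite xE.
rewrite (eq_bigr (fun k => normc (s k a) / normc (s k b))) => [|k _]; last first.
  by rewrite fmorph_div complex.ComplexField.Normc.normcM complex.ComplexField.Normc.normcV.
rewrite [X in _ * X]big_seq (eq_bigr (fun P => prime_abs R P a / prime_abs R P b)) => [|P PT]; last first.
  by rewrite prime_absM ?prime_absV //; apply: T'_prime.
by rewrite -big_seq !big_split /= !prodfV mulrACA aE mul1r -invfM bE invr1.
Qed.

(** A common denominator for all elements bounded by B at the primes of [T]: the product over [T] of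
    m-th powers of uniformizers. It works because N(P)^m > m >= B. *)
Lemma exists_small_integer (T : seq (set K)) (B : R) : (forall P, P \in T -> primesK P) ->
  exists t, [/\ OK t, t != 0 & forall P, P \in T -> prime_abs R P t * B <= 1].
Proof.
move=> T_prime; have [m Bm] := finite_le_nat B.
elim: T T_prime => [|P T IHT] T_prime; first by exists 1; split; [exact: OK1|exact: oner_neq0|].
have [|t [t_int t_neq0 tT]] := IHT; first by move=> Q QT; apply: T_prime; rewrite inE QT orbT.
have P_prime : nonzero_prime OK P by apply: T_prime; rewrite inE eqxx.
have [q [Pq q_neq0 q1]] := exists_uniformizer P_prime.
have q_int := prime_int P_prime Pq.
exists (q ^+ m * t); split.
- by apply: OK_mul => //; apply: OK_exp.
- by rewrite mulf_neq0 ?expf_neq0.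
move=> Q; rewrite inE => /orP[/eqP ->|QT].
  have [B0|B0] := leP B 0.
    by rewrite (le_trans _ ler01) // mulr_ge0_le0 // prime_abs_ge0.
  rewrite prime_absM // prime_absX // prime_absE // q1 exprN1 exprVn mulrAC.
  rewrite mulr_ile1 ?prime_abs_ge0 ?prime_abs_int //.
    by rewrite mulr_ge0 ?invr_ge0 ?exprn_ge0 ?ler0n // ltW.
  rewrite mulrC ler_pdivrMr ?mul1r; last first.
    by rewrite exprn_gt0 // ltr0n (ltn_trans _ (ideal_norm_gt1 P_prime)).
  apply: le_trans Bm _; rewrite -natrX ler_nat ltnW // ltn_expl //.
  exact: ideal_norm_gt1.
have Q_prime : nonzero_prime OK Q by apply: T_prime; rewrite inE QT orbT.
rewrite prime_absM // -mulrA; have [B0|B0] := leP (prime_abs R Q t * B) 0.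
  by rewrite (le_trans _ ler01) // mulr_ge0_le0 // prime_abs_ge0.
apply: mulr_ile1; [exact: prime_abs_ge0 | exact: ltW | | exact: tT].
by apply: prime_abs_int => //; apply: OK_exp.
Qed.

(** Northcott's theorem in the form needed: multiplication by one fixed [t] carries all these y to
    integers with bounded conjugates. *)
Lemma finite_bounded_places (T : seq (set K)) (B : R) : (forall P, P \in T -> primesK P) ->
  finite_set [set y | [/\ forall P, primesK P -> P \notin T -> prime_abs R P y <= 1,
     forall P, P \in T -> prime_abs R P y <= B & forall k, normc (s k y) <= B]].
Proof.
move=> T_prime; have [t [t_int t_neq0 tT]] := exists_small_integer B T_prime.
pose B' := \sum_k normc (s k t) * `|B|.
have := finite_image (fun z => z / t) (s_finite B').
apply: sub_finite_set => y [yP yT ys]; exists (t * y); last by rewrite mulrC mulKf.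
split=> [|k].
  have [->|y_neq0] := eqVneq y 0; first by rewrite mulr0; apply: OK0.
  apply: val_at_ge0_int => [|P P_prime]; first by rewrite mulf_neq0.
  rewrite -(prime_abs_le1 R P_prime) ?mulf_neq0 // prime_absM //.
  have [PT|PT] := boolP (P \in T).
    by apply: le_trans (tT _ PT); rewrite ler_wpM2l ?prime_abs_ge0 // yT.
  apply: mulr_ile1; [exact: prime_abs_ge0 | exact: prime_abs_ge0 | | exact: yP].
  exact: prime_abs_int.
rewrite rmorphM complex.ComplexField.Normc.normcM /B' (bigD1 k) //= -[leLHS]addr0 lerD //.
  by rewrite ler_wpM2l ?normc_ge0 // (le_trans (ys k)) // ler_norm.
by apply: sumr_ge0 => i _; rewrite mulr_ge0 ?normc_ge0.
Qed.

End ProductFormula.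

(** * Belyi polynomials *)

Section Belyi.
Variables (L : closedFieldType) (j : {rmorphism rat -> L}).
Local Notation "p ^j" := (map_poly j p) (at level 2, format "p ^j").

Lemma horner_mx_eigen (F : fieldType) m (A : 'M[F]_m.+1) (v : 'rV[F]_m.+1) a (p : {poly F}) :
  v *m A = a *: v -> v *m horner_mx A p = p.[a] *: v.
Proof.
move=> vA; elim/poly_ind: p => [|p c IHp]; first by rewrite rmorph0 horner0 mulmx0 scale0r.
rewrite rmorphD rmorphM /= horner_mx_X horner_mx_C hornerMXaddC mulmxDr.
by rewrite mulmxA IHp -scalemxAl vA scalerA mul_mx_scalar scalerDl.
Qed.

(** P2 is the characteristic polynomial of P(A), with A the companion matrix of F: an eigenvector of
    A for x is an eigenvector of P(A) for P(x). This keeps rational coefficients and does not raise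
    the degree. *)
Lemma poly_image_roots (F P : {poly rat}) : F != 0 ->
  exists P2 : {poly rat}, [/\ P2 != 0, (size P2 <= size F)%N &
    forall x, root F^j x -> root P2^j P^j.[x]].
Proof.
move=> F_neq0; have [szF|/size1_polyC FC] := ltnP 1 (size F); last first.
  exists 1; split; rewrite ?oner_neq0 ?size_poly1 ?lt0n ?size_poly_eq0 //.
  move=> x; rewrite FC map_polyC rootC fmorph_eq0 => /eqP F0.
  by move: F_neq0; rewrite FC F0 eqxx.
pose F' := (lead_coef F)^-1 *: F.
have lc_neq0 : (lead_coef F)^-1 != 0 by rewrite invr_neq0 ?lead_coef_eq0.
have F'_mon : F' \is monic by rewrite monicE lead_coefZ mulVf ?lead_coef_eq0.
have szF' : size F' = size F by rewrite size_scale.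
have [m [A [szA charA]]] : exists m (A : 'M[rat]_m.+1), size F = m.+2 /\ char_poly A = F'.
  have := companionmxK F'_mon; move: (companionmx F'); rewrite szF'.
  by case: (size F) szF => [|[|m]] //= _ A AE; exists m, A.
exists (char_poly (horner_mx A P)); split.
- by rewrite monic_neq0 ?char_poly_monic.
- by rewrite size_char_poly szA.
move=> x Fx; have : root (char_poly (map_mx j A)) x.
  by rewrite -map_char_poly charA /F' map_polyZ rootZ ?fmorph_eq0.
rewrite -eigenvalue_root_char => /eigenvalueP[v vA v_neq0].
rewrite map_char_poly -eigenvalue_root_char; apply/eigenvalueP; exists v => //.
by rewrite map_horner_mx; apply: horner_mx_eigen.
Qed.

Lemma size_deriv_rat (p : {poly rat}) : size p^`() = (size p).-1.
Proof.
have [->|p_neq0] := eqVneq p 0; first by rewrite derivC size_poly0.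
apply/eqP; rewrite eqn_leq -ltnS prednK ?lt_size_deriv ?lt0n ?size_poly_eq0 //=.
case sz : (size p) => [|[|m]] //=; rewrite ltnNge; apply/negP => /leq_sizeP/(_ m (leqnn _)).
rewrite coef_deriv => /eqP; rewrite mulrn_eq0 /= -[m.+1]/(m.+2.-1) -sz -lead_coefE.
by rewrite lead_coef_eq0 (negPf p_neq0).
Qed.

Lemma size_comp_gt1 (F : fieldType) (p q : {poly F}) :
  (1 < size p)%N -> (1 < size q)%N -> (1 < size (p \Po q))%N.
Proof.
move=> p1 q1; have := size_comp_poly p q.
by case: (size p) p1 => [|[|?]] //; case: (size q) q1 => [|[|?]] //; case: (size _) => [|[]].
Qed.

Lemma deriv_comp_root (p q : {poly L}) x : root (p \Po q)^`() x ->
  root p^`() q.[x] \/ root q^`() x.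
Proof.
rewrite deriv_comp /root hornerM mulf_eq0 horner_comp => /orP[]; by [left|right].
Qed.

(* The critical values of [Phi2 \Po P] are the critical values of [Phi2] and
   the images under [Phi2] of those of [P]; the latter are roots of a rational
   polynomial of degree smaller than that of [P]. *)
Lemma belyi_rational (P : {poly rat}) : P != 0 ->
  exists2 Phi : {poly rat}, (1 < size Phi)%N & forall x,
    root P^j x \/ root (Phi^j)^`() x -> exists t : rat, Phi^j.[x] = j t.
Proof.
have [k] := ubnP (size P); elim: k P => // k IHk P; rewrite ltnS => le_k P_neq0.
have [sz|/size1_polyC PC] := ltnP 1 (size P); last first.
  exists 'X => [|x]; rewrite ?size_polyX // map_polyX derivX hornerX => -[].
    rewrite PC map_polyC rootC fmorph_eq0 => /eqP P0.
    by move: P_neq0; rewrite PC P0 eqxx.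
  by rewrite rootC oner_eq0.
have P'_neq0 : P^`() != 0 by rewrite -size_poly_eq0 size_deriv_rat -lt0n; case: (size P) sz => [|[]].
have [P2 [P2_neq0 P2_le P2P]] := poly_image_roots P P'_neq0.
have [|Phi2 Phi2_gt1 Phi2P] := IHk P2 _ P2_neq0.
  by rewrite (leq_ltn_trans P2_le) // (leq_trans _ le_k) // lt_size_deriv.
exists (Phi2 \Po P) => [|x]; first exact: size_comp_gt1.
rewrite map_comp_poly horner_comp => -[/rootP ->|/deriv_comp_root[h|]].
- by exists Phi2.[0]; rewrite -(rmorph0 j) horner_map.
- by apply: Phi2P; right.
- by rewrite deriv_map => /P2P h; apply: Phi2P; left.
Qed.

Lemma two_values_or_three (T : seq rat) :
  (exists a b, a != b /\ {subset T <= [:: a; b]}) \/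
  (exists a b c, [/\ a < b, b < c & {subset [:: a; b; c] <= T}]).
Proof.
case: T => [|a T]; first by left; exists 0, 1.
have [/allP Ta|/allPn[b bT ba]] := boolP (all (pred1 a) (a :: T)).
  left; exists a, (a + 1); split; first by apply/eqP; lra.
  by move=> t /Ta /eqP ->; rewrite inE eqxx.
have [/allP Tab|/allPn[c cT]] := boolP (all (mem [:: a; b]) (a :: T)).
  by left; exists a, b; split=> [|t /Tab //]; rewrite eq_sym.
rewrite /= !inE negb_or => /andP[ca cb]; right.
have aT : a \in a :: T by rewrite inE eqxx.
have sub x y z : x \in a :: T -> y \in a :: T -> z \in a :: T ->
    {subset [:: x; y; z] <= a :: T}.
  by move=> xT yT zT t; rewrite !inE => /or3P[] /eqP ->; rewrite -1?[_ || _]/(_ \in a :: T).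
move: ba => /= ba.
case: (ltgtP a b) ba => // ab _; case: (ltgtP a c) ca => // ac _; case: (ltgtP b c) cb => // bc _;
  first [ exfalso; lra | by exists a, b, c; split=> //; apply: sub
  | by exists a, c, b; split=> //; apply: sub | by exists c, a, b; split=> //; apply: sub
  | by exists b, a, c; split=> //; apply: sub | by exists b, c, a; split=> //; apply: sub
  | by exists c, b, a; split=> //; apply: sub ].
Qed.

(** Belyi's polynomial, a multiple of (x - a)^m (c - x)^n with m : n = (b - a) : (c - b). This ratio
    places the only remaining critical point at b, and [kap] normalizes the value there to 1. *)
Lemma belyi_three_points (a b c : rat) : a < b -> b < c ->
  exists Psi : {poly rat}, [/\ (1 < size Psi)%N, Psi.[a] = 0, Psi.[c] = 0 & Psi.[b] = 1] /\
    forall x, root (Psi^j)^`() x -> x \in [:: j a; j b; j c].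
Proof.
move=> ab bc; pose rho := (b - a) / (c - b).
have rho_gt0 : 0 < rho by rewrite divr_gt0 // subr_gt0.
pose m := `|numq rho|%N; pose n := `|denq rho|%N.
have m_gt0 : (0 < m)%N by rewrite absz_gt0 numq_eq0 gt_eqF.
have n_gt0 : (0 < n)%N by rewrite absz_gt0 denq_neq0.
have mn : m%:R * (c - b) = n%:R * (b - a).
  have h : m%:R = rho * n%:R.
    rewrite /m /n !pmulrn !absz_denq gez0_abs ?numq_ge0 ?ltW //.
    by rewrite -{2}(divq_num_den rho) divfK // intr_eq0 denq_neq0.
  by rewrite h /rho; field; rewrite subr_eq0 gt_eqF.
clearbody m n.
pose kap := ((b - a) ^+ m * (c - b) ^+ n)^-1.
have kap_neq0 : kap != 0.
  by rewrite invr_neq0 // mulf_neq0 // expf_neq0 // subr_eq0 gt_eqF.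
pose u : {poly rat} := 'X - a%:P; pose w : {poly rat} := c%:P - 'X.
pose Psi := kap *: (u ^+ m * w ^+ n).
have Psia : Psi.[a] = 0.
  rewrite /Psi hornerZ hornerM horner_exp (_ : u.[a] = 0) ?hornerXsubC ?subrr //.
  by rewrite -(prednK m_gt0) exprS !mul0r mulr0.
have Psic : Psi.[c] = 0.
  rewrite /Psi hornerZ hornerM [(w ^+ n).[c]]horner_exp (_ : w.[c] = 0).
    by rewrite -(prednK n_gt0) exprS mul0r !mulr0.
  by rewrite /w hornerD hornerN hornerX hornerC subrr.
have Psib : Psi.[b] = 1.
  rewrite /Psi /u /w hornerZ hornerM !horner_exp !(hornerD, hornerN, hornerX, hornerC) /kap mulVf //.
  by rewrite mulf_neq0 // expf_neq0 // subr_eq0 gt_eqF.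
exists Psi; split; first split=> //.
  rewrite ltnNge; apply/negP => /size1_polyC PsiC.
  by move: Psia Psib; rewrite PsiC !hornerC => -> /eqP; rewrite eq_sym oner_eq0.
(* Since u' = 1 and w' = -1, the derivative of u^m w^n is u^(m-1) w^(n-1) (m w - n u); by the choice
   of m and n the linear factor vanishes at b. *)
have key : w *+ m - u *+ n = (m + n)%:R *: (b%:P - 'X).
  have cst : m%:R * c%:P + n%:R * a%:P - (m + n)%:R * b%:P = 0 :> {poly rat}.
    rewrite -!(rmorph_nat polyC) -!rmorphM -rmorphD -rmorphB -[RHS](rmorph0 polyC) /=.
    by congr (_%:P); rewrite natrD; move: mn; lra.
  rewrite -mul_polyC rmorph_nat -[w *+ m]mulr_natl -[u *+ n]mulr_natl; apply/eqP.
  rewrite -subr_eq0 -[X in _ == X]cst; apply/eqP; rewrite /u /w natrD; ring.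
have derE : Psi^`() = (kap * (m + n)%:R) *: (u ^+ m.-1 * w ^+ n.-1 * (b%:P - 'X)).
  have um : u ^+ m = u * u ^+ m.-1 by rewrite -exprS prednK.
  have wn : w ^+ n = w * w ^+ n.-1 by rewrite -exprS prednK.
  have u' : u^`() = 1 by rewrite /u derivXsubC.
  have w' : w^`() = -1 by rewrite /w derivB derivC derivX sub0r.
  rewrite /Psi derivZ -scalerA; congr (_ *: _).
  rewrite derivM !deriv_exp u' w' um wn scalerAr -key.
  by rewrite mul1r mulN1r mulNrn mulrN mulrnAl mulrnAr mulrBr mulrnAr mulrnAr; congr (_ *+ _ - _ *+ _); ring.
move=> x; rewrite deriv_map derE map_polyZ rootZ ?fmorph_eq0; last first.
  by apply: mulf_neq0 => //; rewrite pnatr_eq0 -lt0n addn_gt0 m_gt0.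
rewrite !rmorphM /= !rmorphXn !rmorphB /= !map_polyX !map_polyC /= !rootM.
have rX p k : root (p ^+ k) x -> root p x.
  by rewrite /root horner_exp expf_eq0 => /andP[].
have rC (t : rat) : root ('X - (j t)%:P) x -> x = j t by rewrite root_XsubC => /eqP.
have rC' (t : rat) : root ((j t)%:P - 'X) x -> x = j t.
  by rewrite -opprB rootN; apply: rC.
by case/orP => [/orP[/rX/rC|/rX/rC']|/rC'] ->; rewrite !inE eqxx ?orbT.
Qed.

Lemma belyi_zero_one (T : seq rat) : exists Psi : {poly rat},
  [/\ (1 < size Psi)%N, forall t, t \in T -> Psi.[t] \in [:: 0; 1] &
      forall x, root (Psi^j)^`() x -> Psi^j.[x] \in [:: 0; 1]].
Proof.
have [k] := ubnP (size T); elim: k T => // k IHk T; rewrite ltnS => le_k.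
have [[a [b [ab Tab]]]|[a [b [c [ab bc abcT]]]]] := two_values_or_three T.
  have ba0 : (b - a)^-1 != 0 by rewrite invr_neq0 // subr_eq0 eq_sym.
  exists ((b - a)^-1 *: ('X - a%:P)); split.
  - by rewrite size_scale // size_XsubC.
  - move=> t /Tab; rewrite !inE !hornerE => /orP[] /eqP ->; rewrite ?subrr ?mulr0 ?eqxx //.
    by rewrite mulVf ?eqxx ?orbT // -invr_eq0.
  - move=> x; rewrite deriv_map derivZ derivXsubC map_polyZ rmorph1 rootZ ?fmorph_eq0 //.
    by rewrite rootC oner_eq0.
have [Psi1 [[Psi1_gt1 Pa Pc Pb] Psi1_crit]] := belyi_three_points ab bc.
have aT : a \in T by apply: abcT; rewrite !inE eqxx.
have bT : b \in T by apply: abcT; rewrite !inE eqxx orbT.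
have cT : c \in T by apply: abcT; rewrite !inE eqxx !orbT.
have ac : a != c by rewrite lt_eqF // (lt_trans ab).
have bc' : b != c by rewrite lt_eqF.
have [|Psi2 [Psi2_gt1 Psi2T Psi2_crit]] := IHk [seq Psi1.[t] | t <- rem c T].
  by rewrite size_map size_rem // (leq_trans _ le_k) // ltn_predL; case: (T) cT.
have Psi_T t : t \in T -> Psi2.[Psi1.[t]] \in [:: 0; 1].
  move=> tT; have [->|tc] := eqVneq t c.
    by rewrite Pc -[X in Psi2.[X]]Pa; apply: Psi2T; apply/mapP; exists a => //; apply: rem_mem.
  by apply: Psi2T; apply/mapP; exists t => //; apply: rem_mem.
have jE (p : {poly rat}) t : p.[t] \in [:: 0; 1] -> p^j.[j t] \in [:: 0; 1].
  by rewrite horner_map !inE fmorph_eq0 fmorph_eq1.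
exists (Psi2 \Po Psi1); split=> [|t|x]; first exact: size_comp_gt1.
  by rewrite horner_comp; apply: Psi_T.
rewrite map_comp_poly horner_comp => /deriv_comp_root[|/Psi1_crit]; first exact: Psi2_crit.
have jPsi t : t \in T -> Psi2^j.[Psi1^j.[j t]] \in [:: 0; 1].
  by move=> tT; rewrite [Psi1^j.[_]]horner_map; apply/jE/Psi_T.
by rewrite in_cons in_cons mem_seq1 => /or3P[] /eqP ->; apply: jPsi.
Qed.

(** [Phi1] makes the values at the roots of P and at its own critical points rational; [Psi] then
    sends these finitely many rationals to 0 or 1 without creating other critical values. *)
Lemma belyi_polynomial (P : {poly rat}) : P != 0 -> exists2 Phi : {poly rat},
  (1 < size Phi)%N & forall x, root P^j x \/ root (Phi^j)^`() x -> Phi^j.[x] \in [:: 0; 1].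
Proof.
move=> P_neq0; have [Phi1 Phi1_gt1 Phi1P] := belyi_rational P_neq0.
have Phi1'_neq0 : Phi1^`() != 0.
  by rewrite -size_poly_eq0 size_deriv_rat -lt0n; case: (size Phi1) Phi1_gt1 => [|[]].
have [rs rsE] := closed_field_poly_normal (P * Phi1^`())^j.
have rs_root x : root P^j x \/ root (Phi1^j)^`() x -> x \in rs.
  move=> h; have : root (P * Phi1^`())^j x.
    by rewrite rmorphM rootM /=; case: h => [->//|]; rewrite deriv_map => ->; rewrite orbT.
  by rewrite rsE rootZ ?root_prod_XsubC // lead_coef_eq0 map_poly_eq0 mulf_neq0.
pose t x := if pselect (exists t : rat, Phi1^j.[x] = j t) is left e then projT1 (cid e) else 0.
have tP x : x \in rs -> root P^j x \/ root (Phi1^j)^`() x -> Phi1^j.[x] = j (t x).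
  by move=> _ /Phi1P h; rewrite /t; case: pselect => // e; case: (cid e).
have [Psi [Psi_gt1 PsiT Psi_crit]] := belyi_zero_one [seq t x | x <- rs].
exists (Psi \Po Phi1) => [|x]; first exact: size_comp_gt1.
rewrite map_comp_poly horner_comp => h.
have [h'|] : (root P^j x \/ root (Phi1^j)^`() x) \/ root (Psi^j)^`() Phi1^j.[x].
    by case: h => [|/deriv_comp_root[]]; [left; left | right | left; right].
  have xrs := rs_root x h'; rewrite (tP x xrs h').
  have := PsiT (t x) (map_f t xrs).
  by rewrite horner_map !inE fmorph_eq0 fmorph_eq1.
exact: Psi_crit.
Qed.

End Belyi.

Section BelyiDivisor.
Variables (L : closedFieldType) (j : {rmorphism rat -> L}).

(** If gcd(F, U) were a proper divisor of F, a root x of the cofactor would occur in F once more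
    than in the gcd, whereas the full power of X - x dividing F divides both. *)
Lemma dvdp_multiplicity (F U : {poly L}) : F != 0 ->
  (forall x k, ('X - x%:P) ^+ k %| F -> ('X - x%:P) ^+ k %| U) -> F %| U.
Proof.
move=> F_neq0 FU; have /dvdpP[q FE] := dvdp_gcdl F U.
have [/eqP/size_poly1P[a a_neq0 qa]|sz_q] := eqVneq (size q) 1%N.
  apply: dvdp_trans (dvdp_gcdr F U); rewrite {1}FE qa mul_polyC.
  by rewrite dvdpZl.
have /closed_rootP[x /factor_theorem[q' qE]] := sz_q.
have d_dvd : ('X - x%:P) ^+ mup x F %| gcdp F U.
  have h : ('X - x%:P) ^+ mup x F %| F by rewrite -mup_geq.
  by rewrite dvdp_gcd h FU.
have : (mup x F < mup x F)%N.
  by rewrite mup_geq // [X in _ %| X]FE qE exprS -mulrA dvdp_mull // dvdp_mul.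
by rewrite ltnn.
Qed.

(** With F = B (X - x)^l, what is left of the derivative after removing (X - x)^(l-1) takes the
    value l B(x) at x, and this is nonzero since the embedding [j] of the rationals forces
    characteristic 0. *)
Lemma multiplicity_deriv (F : {poly L}) x : F != 0 -> root F x ->
  exists2 l, ('X - x%:P) ^+ l %| F & forall k, ('X - x%:P) ^+ k %| F^`() -> (k < l)%N.
Proof.
move=> F_neq0 Fx; have [l [B Bx FE]] := multiplicity_XsubC F x.
rewrite F_neq0 /= in Bx.
have l_gt0 : (0 < l)%N.
  by rewrite lt0n; apply: contraNneq Bx => l0; move: Fx; rewrite FE l0 mulr1.
exists l => [|k]; first by rewrite FE dvdp_mull.
apply: contraTT; rewrite -leqNgt => le_lk; apply/negP => /(dvdp_trans (dvdp_exp2l _ le_lk)).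
rewrite FE derivM deriv_exp derivXsubC mul1r -(prednK l_gt0) /= exprS.
have -> : B^`() * (('X - x%:P) * ('X - x%:P) ^+ l.-1) + B * (('X - x%:P) ^+ l.-1 *+ l.-1.+1) =
    ('X - x%:P) ^+ l.-1 * (B^`() * ('X - x%:P) + B *+ l.-1.+1).
  by rewrite mulrDr mulrnAr mulrnAr; congr (_ + _ *+ _); ring.
rewrite [('X - x%:P) * ('X - x%:P) ^+ _]mulrC dvdp_mul2l ?expf_neq0 ?polyXsubC_eq0 //.
rewrite dvdp_addr ?dvdp_mull // dvdp_XsubCl /root hornerMn -mulr_natl mulf_eq0.
by rewrite -(rmorph_nat j) fmorph_eq0 pnatr_eq0 /= -/(root B x) (negPf Bx).
Qed.

Variable Phi : {poly rat}.
Local Notation F := (map_poly j Phi).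
Hypothesis Phi_gt1 : (1 < size Phi)%N.
Hypothesis Phi_crit : forall x, root F^`() x -> F.[x] \in [:: 0; 1].

Let F_neq0 c : F - c%:P != 0.
Proof.
rewrite subr_eq0; apply/eqP => Fc.
by have := leq_ltn_trans (size_polyC_leq1 c) Phi_gt1; rewrite -Fc size_map_poly ltnn.
Qed.

Let F'_neq0 : F^`() != 0.
Proof.
rewrite deriv_map map_poly_eq0 -size_poly_eq0 size_deriv_rat -lt0n.
by case: (size Phi) Phi_gt1 => [|[]].
Qed.

Let deriv_const c : (F - c%:P)^`() = F^`().
Proof. by rewrite derivB derivC subr0. Qed.

Lemma root_value x : F.[x] \in [:: 0; 1] -> exists c, [/\ root (F - c%:P) x &
  F - c%:P %| F * (F - 1)].
Proof.
rewrite !inE => /orP[] /eqP Fx; [exists 0|exists 1].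
  by rewrite subr0 dvdp_mulr //; split=> //; apply/rootP.
by rewrite dvdp_mull //; split=> //; rewrite /root !hornerE Fx subrr.
Qed.

(** At a point where F takes the value c in {0, 1} with multiplicity l, the multiplicity of F' is
    smaller than l. Hence F' divides F (F - 1), all of its own roots being such points, and the
    quotient still vanishes at each of them. *)
Lemma critical_quotient : exists2 Q : {poly L}, F * (F - 1) = F^`() * Q &
  forall x, root (F * (F - 1)) x -> root Q x.
Proof.
have /dvdpP[Q QE] : F^`() %| F * (F - 1).
  apply: dvdp_multiplicity => // x [|k] dvd_k; first by rewrite expr0 dvd1p.
  have x_crit : root F^`() x.
    by rewrite -dvdp_XsubCl; apply: dvdp_trans dvd_k; rewrite exprS dvdp_mulr.
  have [c [Fx Fc]] := root_value (Phi_crit x_crit).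
  have [l Fl lt_l] := multiplicity_deriv (F_neq0 c) Fx.
  rewrite deriv_const in lt_l.
  by apply: dvdp_trans Fc; apply: dvdp_trans Fl; apply: dvdp_exp2l; apply/ltnW/lt_l.
exists Q => [|x]; first by rewrite QE mulrC.
rewrite rootM => h; have [|c [Fx Fc]] := @root_value x.
  rewrite !inE; case/orP: h => [/rootP ->|]; rewrite ?eqxx //.
  by rewrite /root hornerD hornerN hornerC subr_eq0 => ->; rewrite orbT.
have [l Fl lt_l] := multiplicity_deriv (F_neq0 c) Fx.
rewrite deriv_const in lt_l; apply: contraT => Qx.
suff /lt_l : ('X - x%:P) ^+ l %| F^`() by rewrite ltnn.
have cop : coprimep (('X - x%:P) ^+ l) Q.
  by apply: coprimep_expl; rewrite coprimep_sym coprimep_XsubC.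
by rewrite -(Gauss_dvdpr _ cop) -QE; apply: dvdp_trans Fc.
Qed.

End BelyiDivisor.

Section BelyiNumberField.
Variables (K : fieldExtType rat) (Kbar : closedFieldType).
Variable iota : {rmorphism K -> Kbar}.
Local Notation "p ^i" := (map_poly iota p) (at level 2, format "p ^i").

Lemma algebraic_over_rat (g : {poly K}) x : g != 0 -> root g^i x ->
  exists2 P : {poly rat}, P != 0 & root (map_poly (iota \o in_alg K) P) x.
Proof.
move=> g_neq0 gx.
have [P P_mon Px] : integralOver (iota \o in_alg K : {rmorphism rat -> Kbar}) x.
  apply: (@integral_root _ _ _ g^i) => //; first by rewrite map_poly_eq0.
  apply/integral_poly => i; rewrite coef_map /=.
  have /polyOver1P[p pE] := minPolyOver 1 g`_i.
  exists p; first by rewrite -(map_monic (in_alg K)) -pE monic_minPoly.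
  rewrite map_poly_comp fmorph_root -pE; exact: root_minPoly.
by exists P => //; apply: monic_neq0.
Qed.

Lemma dvdp_exp_roots (U Q : {poly Kbar}) : U != 0 ->
  (forall x, root U x -> root Q x) -> U %| Q ^+ (size U).
Proof.
move=> U_neq0 UQ; have [rs UE] := closed_field_poly_normal U.
have rsQ x : x \in rs -> 'X - x%:P %| Q.
  by move=> xrs; rewrite dvdp_XsubCl UQ // UE rootZ ?lead_coef_eq0 // root_prod_XsubC.
have size_rs : (size rs <= size U)%N.
  by rewrite UE size_scale ?lead_coef_eq0 // size_prod_XsubC.
rewrite [X in X %| _]UE dvdpZl ?lead_coef_eq0 //; apply: dvdp_trans (dvdp_exp2l Q size_rs).
elim: rs rsQ {UE size_rs} => [|x rs IHrs] rsQ; first by rewrite big_nil dvd1p.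
rewrite big_cons exprS dvdp_mul ?rsQ ?inE ?eqxx // IHrs // => y yrs.
by apply: rsQ; rewrite inE yrs orbT.
Qed.

Lemma irreducible_dvd_root (g h : {poly K}) x : irreducible_poly g ->
  root g^i x -> root h^i x -> g %| h.
Proof.
move=> g_irr gx hx; apply: contraT; rewrite -irreducible_poly_coprime //.
rewrite -(coprimep_map iota) => /coprimep_root/(_ gx).
by rewrite -/(root h^i x) hx.
Qed.

(** Here deg Phi = D + 1, so Q = g r has degree D + 2 and deg r <= D because deg g >= 2. The
    cofactor [W] is a certificate over K that Phi (Phi - 1) and Q have the same roots: it will show
    that, outside finitely many primes, a prime dividing the value of Phi (Phi - 1) divides that of
    g r. *)
Lemma belyi_factor (g : {poly K}) : irreducible_poly g -> (2 < size g)%N ->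
  exists (D N : nat) (Phi W r : {poly K}),
    [/\ size Phi = D.+2, r != 0, (size r <= D.+1)%N &
        Phi * (Phi - 1) * W = (g * r) ^+ N].
Proof.
move=> g_irr g_gt2; have g_neq0 : g != 0 by rewrite -size_poly_eq0; case: (size g) g_gt2.
have [x gx] : exists x, root g^i x.
  by apply/closed_rootP; rewrite size_map_poly neq_ltn (ltn_trans _ g_gt2) ?orbT.
have [P P_neq0 Px] := algebraic_over_rat g_neq0 gx.
pose j : {rmorphism rat -> Kbar} := iota \o in_alg K.
have [Phi Phi_gt1 PhiP] := belyi_polynomial j P_neq0.
have [||Q' UQ' rootQ'] := @critical_quotient _ j Phi => //; first by move=> y h; apply: PhiP; right.
pose F := map_poly (in_alg K) Phi.
have Fj : F^i = map_poly j Phi by rewrite /F -map_poly_comp.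
have F'_neq0 : F^`() != 0.
  rewrite deriv_map map_poly_eq0 -size_poly_eq0 size_deriv_rat -lt0n.
  by case: (size Phi) Phi_gt1 => [|[]].
have szF : size F = size Phi by rewrite size_map_poly.
have F1_size : size (F - 1) = size F by rewrite size_polyDl // size_polyN size_poly1 szF.
have UF : (F * (F - 1))^i = map_poly j Phi * (map_poly j Phi - 1).
  by rewrite rmorphM rmorphB rmorph1 /= Fj.
have /dvdpP[Q UQ] : F^`() %| F * (F - 1).
  by rewrite -(dvdp_map iota) UF UQ' -deriv_map Fj dvdp_mulr.
have Q'E : Q^i = Q'.
  apply: (mulfI (_ : (map_poly j Phi)^`() != 0)); last first.
    by rewrite -UQ' -UF UQ mulrC rmorphM /= -deriv_map Fj.
  by rewrite -Fj deriv_map map_poly_eq0.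
have F_neq0 : F != 0 by rewrite -size_poly_eq0 szF; case: (size Phi) Phi_gt1.
have F1_neq0 : F - 1 != 0 by rewrite -size_poly_eq0 F1_size szF; case: (size Phi) Phi_gt1.
have U_neq0 : F * (F - 1) != 0 by rewrite mulf_neq0.
have Q_neq0 : Q != 0 by apply: contraNneq U_neq0 => Q0; rewrite UQ Q0 mul0r.
have Q_size : size Q = (size Phi).+1.
  have szF' : size F^`() = (size Phi).-1.
    by rewrite deriv_map size_map_poly size_deriv_rat.
  have := congr1 (fun p : {poly K} => size p) UQ; rewrite !size_mul // F1_size szF szF'.
  by move: (size Phi) (size Q) Phi_gt1 => m q; lia.
have Qx : root Q^i x.
  rewrite Q'E; apply: rootQ'; have := PhiP x (or_introl Px).
  rewrite rootM !inE => /orP[/eqP h|h]; first by rewrite /root h eqxx.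
  by rewrite /root hornerD hornerN hornerC subr_eq0 h orbT.
have [r QE] : exists r, Q = r * g.
  by apply/dvdpP; apply: irreducible_dvd_root gx Qx.
have r_neq0 : r != 0 by apply: contraNneq Q_neq0 => r0; rewrite QE r0 mul0r.
have /dvdpP[W WE] : F * (F - 1) %| Q ^+ size (F * (F - 1))^i.
  rewrite -(dvdp_map iota) rmorphXn; apply: dvdp_exp_roots; first by rewrite map_poly_eq0.
  by move=> y; rewrite UF => /rootQ'; rewrite -Q'E.
exists (size Phi).-2, (size (F * (F - 1))^i), F, W, r; split=> //.
- by rewrite szF; case: (size Phi) Phi_gt1 => [|[]].
- have := congr1 (fun p : {poly K} => size p) QE; rewrite size_mul // Q_size.
  by move: (size Phi) (size r) (size g) Phi_gt1 g_gt2 => m q e; lia.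
- by rewrite mulrC -WE QE mulrC.
Qed.

End BelyiNumberField.

(** * Finiteness from the abc conjecture and a Belyi polynomial *)

Section LocalEstimates.
Variables (R : realType) (K : fieldType).

(** Only the triangle inequality is required, so that archimedean and prime absolute values share
    the growth estimates below. *)
Definition absolute_value (v : K -> R) : Prop :=
  [/\ forall x, 0 <= v x, v 0 = 0, v 1 = 1, {morph v : x y / x * y} &
      (forall x y, v (x + y) <= v x + v y) /\ forall x, v x = 0 -> x = 0].

Variable v : K -> R.
Hypothesis v_abs : absolute_value v.

Local Notation M y := (Num.max 1 (v y)).

Lemma abs_val_sum I (r : seq I) (F : I -> K) :
  v (\sum_(i <- r) F i) <= \sum_(i <- r) v (F i).
Proof.
have [_ v0 _ _ [vD _]] := v_abs.
elim: r => [|i r IHr]; first by rewrite !big_nil v0.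
by rewrite !big_cons (le_trans (vD _ _)) // lerD2l.
Qed.

Lemma abs_valX x k : v (x ^+ k) = v x ^+ k.
Proof.
have [_ _ v1 vM _] := v_abs.
by elim: k => [|k IHk]; rewrite ?v1 // !exprS vM IHk.
Qed.

Lemma abs_valN1 : v (-1) = 1.
Proof.
have [v_ge0 _ v1 _ _] := v_abs.
have : v (-1) ^+ 2 = 1 by rewrite -abs_valX sqrrN expr1n v1.
move/eqP; rewrite sqrf_eq1 => /orP[] /eqP // vN1.
by have := v_ge0 (-1); rewrite vN1 oppr_ge0 ler10.
Qed.

Lemma max1_ge1 y : 1 <= M y. Proof. by rewrite le_max lexx. Qed.

Lemma max1_gt0 y : 0 < M y. Proof. exact: lt_le_trans ltr01 (max1_ge1 y). Qed.

Lemma abs_sum_le (c : nat -> K) m k y : (k <= m.+1)%N ->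
  v (\sum_(i < k) c i * y ^+ i) <= (\sum_(i < k) v (c i)) * M y ^+ m.
Proof.
have [v_ge0 _ _ vM _] := v_abs => le_k.
rewrite (le_trans (abs_val_sum _ _)) // big_distrl /=; apply: ler_sum => i _.
rewrite vM abs_valX ler_wpM2l // (@le_trans _ _ (M y ^+ i)) //.
  by rewrite lerXn2r ?nnegrE // ?(ltW (max1_gt0 y)) // le_max lexx orbT.
by rewrite ler_weXn2l ?max1_ge1 // -ltnS (leq_trans (ltn_ord i)).
Qed.

Lemma abs_horner_le (p : {poly K}) m : (size p <= m.+1)%N ->
  exists2 C : R, 1 <= C & forall y, v p.[y] <= C * M y ^+ m.
Proof.
have [v_ge0 _ _ _ _] := v_abs => le_m.
exists (1 + \sum_(i < size p) v p`_i).
  by rewrite lerDl; apply: sumr_ge0.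
move=> y; rewrite horner_coef (le_trans (abs_sum_le _ _ le_m)) //.
by rewrite ler_wpM2r ?exprn_ge0 ?(ltW (max1_gt0 y)) // lerDr.
Qed.

(** Beyond the threshold [M0] the leading term is at least twice the sum of the others, so v(p(y))
    is at least half of it; below the threshold the left-hand side is bounded outright. *)
Lemma abs_horner_ge (p : {poly K}) m : size p = m.+1 ->
  exists2 C : R, 1 <= C & forall y, M y ^+ m <= C * M p.[y].
Proof.
have [v_ge0 v0 v1 vM [vD v_eq0]] := v_abs.
case: m => [|m] sz_p; first by exists 1 => // y; rewrite expr0 mul1r max1_ge1.
pose a := v p`_m.+1; pose B := \sum_(i < m.+1) v p`_i.
have a_gt0 : 0 < a.
  rewrite lt_neqAle v_ge0 andbT eq_sym; apply/eqP => /v_eq0 /eqP.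
  by rewrite -[m.+1]/(m.+2.-1) -sz_p -lead_coefE lead_coef_eq0 -size_poly_eq0 sz_p.
have B_ge0 : 0 <= B by apply: sumr_ge0.
pose M0 := Num.max 1 (2 * B / a).
have M0_ge1 : 1 <= M0 by rewrite le_max lexx.
exists (Num.max (2 / a) (M0 ^+ m.+1)).
  by rewrite le_max exprn_ege1 ?orbT.
move=> y; have [le|gt] := leP (v y) M0.
  have le_MM0 : M y <= M0 by rewrite ge_max M0_ge1.
  have : M y ^+ m.+1 <= M0 ^+ m.+1 by rewrite lerXn2r ?nnegrE // ?(ltW (max1_gt0 y)) // (le_trans ler01).
  move=> /le_trans; apply; rewrite -[leLHS]mulr1 ler_pM ?exprn_ge0 ?max1_ge1 //.
    by rewrite (le_trans ler01).
  by rewrite le_max lexx orbT.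
have y_gt1 : 1 < v y by apply: le_lt_trans gt.
have ME : M y = v y by rewrite maxEle (ltW y_gt1).
have h2 : 2 * B <= a * v y.
  have : 2 * B / a <= v y by rewrite (le_trans _ (ltW gt)) // le_max lexx orbT.
  by rewrite ler_pdivrMr // [v y * a]mulrC.
have h1 : a * v y ^+ m.+1 <= v p.[y] + B * v y ^+ m.
  rewrite /a -abs_valX -vM.
  have -> : p`_m.+1 * y ^+ m.+1 = p.[y] + (-1) * \sum_(i < m.+1) p`_i * y ^+ i.
    by rewrite horner_coef sz_p big_ord_recr /= mulN1r addrAC subrr add0r.
  rewrite (le_trans (vD _ _)) // lerD2l vM.
  rewrite abs_valN1.
  by have := abs_sum_le (fun i => p`_i) y (leqnn m.+1); rewrite mul1r ME.
have Y_gt0 : 0 < v y ^+ m by rewrite exprn_gt0 // (lt_trans ltr01).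
have h3 : a * v y ^+ m.+1 <= 2 * v p.[y].
  move: h1; rewrite exprS; set Y := v y ^+ m in Y_gt0 *; nra.
rewrite ME (@le_trans _ _ (2 / a * v p.[y])) //.
  by rewrite mulrAC ler_pdivlMr // mulrC.
have a2_gt0 : 0 < 2 / a by rewrite divr_gt0.
by rewrite ler_pM ?(ltW a2_gt0) ?v_ge0 // le_max lexx // orbT.
Qed.

Lemma ln_abs_horner_le (p : {poly K}) m : (size p <= m.+1)%N ->
  exists C : R, forall y, ln (v p.[y]) <= m%:R * ln (M y) + C.
Proof.
have [v_ge0 _ _ _ _] := v_abs.
move=> /abs_horner_le[C C_ge1 pC]; exists (ln C) => y.
have C_gt0 : 0 < C := lt_le_trans ltr01 C_ge1.
(* [ln] takes the value 0 at 0, so roots of p need the right-hand side to be nonnegative. *)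
have [p0|p_gt0] := leP (v p.[y]) 0.
  by rewrite ln0 // addr_ge0 ?mulr_ge0 ?ln_ge0 ?max1_ge1.
have := pC y; rewrite -ler_ln ?posrE ?mulr_gt0 ?exprn_gt0 ?max1_gt0 //.
by rewrite lnM ?posrE ?exprn_gt0 ?max1_gt0 // lnXn ?max1_gt0 // mulr_natl addrC.
Qed.

Lemma ln_abs_horner_ge (p : {poly K}) m : size p = m.+1 ->
  exists C : R, forall y, m%:R * ln (M y) <= ln (M p.[y]) + C.
Proof.
move=> /abs_horner_ge[C C_ge1 pC]; exists (ln C) => y.
have C_gt0 : 0 < C := lt_le_trans ltr01 C_ge1.
have : ln (M y ^+ m) <= ln (C * M p.[y]).
  by rewrite ler_ln ?posrE ?mulr_gt0 ?exprn_gt0 ?max1_gt0.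
by rewrite lnM ?posrE ?max1_gt0 // lnXn ?max1_gt0 // mulr_natl addrC.
Qed.

End LocalEstimates.

Section AbcFiniteness.
Variables (R : realType) (K : fieldExtType rat).
Local Notation n := (\dim {:K}).
Local Notation OK := (@OK K).
Local Notation normc := (@complex.ComplexField.Normc.normc R).
Local Notation abs := (prime_abs R).

Lemma prime_abs_absolute (P : set K) : primesK P -> absolute_value (abs P).
Proof.
move=> P_prime; split.
- exact: prime_abs_ge0.
- exact: prime_abs0.
- exact: prime_abs1.
- exact: prime_absM.
split; first exact: prime_abs_add.
move=> x x0; apply/eqP/negP => /negP/(prime_abs_gt0 R P_prime).
by rewrite x0 ltxx.
Qed.

Lemma normc_absolute (sigma : {rmorphism K -> R[i]}) : absolute_value (normc \o sigma).
Proof.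
split=> /=.
- by move=> x; apply: normc_ge0.
- by rewrite rmorph0 complex.ComplexField.Normc.normc0.
- by rewrite rmorph1 complex.ComplexField.Normc.normc1.
- by move=> x y /=; rewrite rmorphM complex.ComplexField.Normc.normcM.
split=> [x y|x /eqP]; first by rewrite rmorphD normcD.
by rewrite normc_eq0 fmorph_eq0 => /eqP.
Qed.

Definition bad_primes (p : {poly K}) : set (set K) :=
  [set P | primesK P /\ exists i, 1 < abs P p`_i].

Lemma finite_bad_primes p : finite_set (bad_primes p).
Proof.
apply: (@sub_finite_set _ _ (\bigcup_(i in `I_(size p)) [set P | primesK P /\ 1 < abs P p`_i])).
  move=> P [P_prime [i gt1]]; exists i => //=; rewrite ltnNge; apply/negP => le_i.
  by move: gt1; rewrite nth_default // prime_abs0 ltNge ler01.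
by apply: bigcup_finite => // i _; apply: finite_prime_abs_gt1.
Qed.

Lemma prime_abs_horner_le1 (p : {poly K}) P y : primesK P -> ~ bad_primes p P ->
  abs P y <= 1 -> abs P p.[y] <= 1.
Proof.
move=> P_prime Pp y1; rewrite horner_coef.
elim/big_ind: _ => [|a b a1 b1|i _]; first by rewrite prime_abs0 ler01.
  by rewrite (le_trans (prime_absD R P_prime a b)) // ge_max a1.
rewrite prime_absM // prime_absX //; apply: mulr_ile1; rewrite ?prime_abs_ge0 ?exprn_ge0 ?prime_abs_ge0 //.
  by rewrite leNgt; apply/negP => gt1; apply: Pp; split=> //; exists i.
by apply: exprn_ile1 => //; apply: prime_abs_ge0.
Qed.

Lemma sum_sub_le (T : eqType) (r1 r2 : seq T) (F : T -> R) : uniq r1 -> uniq r2 ->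
  {subset r1 <= r2} -> (forall x, x \in r2 -> 0 <= F x) ->
  \sum_(x <- r1) F x <= \sum_(x <- r2) F x.
Proof.
move=> u1 u2 sub F_ge0; rewrite [leRHS](bigID (mem r1)) /=.
have -> : \sum_(x <- r2 | x \in r1) F x = \sum_(x <- r1) F x.
  rewrite -big_filter; apply: perm_big; apply: uniq_perm; rewrite ?filter_uniq // => x.
  by rewrite mem_filter; case: (boolP (x \in r1)) => // /sub.
by rewrite lerDl big_seq_cond; apply: sumr_ge0 => x /andP[/F_ge0].
Qed.

Lemma ln_prod_seq (T : eqType) (r : seq T) (F : T -> R) :
  (forall x, x \in r -> 0 < F x) ->
  ln (\prod_(x <- r) F x) = \sum_(x <- r) ln (F x).
Proof.
elim: r => [|x r IHr] F_gt0; first by rewrite !big_nil ln1.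
have F_gt0' y : y \in r -> 0 < F y by move=> yr; apply: F_gt0; rewrite inE yr orbT.
rewrite !big_cons lnM ?posrE ?IHr ?F_gt0 ?inE ?eqxx //.
by rewrite big_seq; apply: prodr_gt0.
Qed.

Lemma finite_roots (F : idomainType) (p : {poly F}) : p != 0 ->
  finite_set [set x | root p x].
Proof.
have [k] := ubnP (size p); elim: k p => // k IHk p; rewrite ltnS => le_k p_neq0.
have [/cid[a pa]|noroot] := pselect (exists a, root p a); last first.
  apply: (@sub_finite_set _ _ set0) => // x px; apply: noroot; by exists x.
have /factor_theorem[q pE] := pa.
have q_neq0 : q != 0 by apply: contraNneq p_neq0 => q0; rewrite pE q0 mul0r.
have lt_q : (size q < k)%N.
  apply: leq_trans le_k; rewrite pE size_Mmonic ?monicXsubC // size_XsubC addn2 ltnS.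
  exact: leqnn.
apply: (@sub_finite_set _ _ ([set a] `|` [set x | root q x])); last first.
  by rewrite finite_setU; split; [exact: finite_set1 | exact: IHk].
by move=> x /=; rewrite pE rootM root_XsubC => /orP[qx|/eqP xa]; [right|left].
Qed.

Lemma val_at_abs1 P x : primesK P -> x != 0 -> abs P x = 1 -> val_at OK P x = 0.
Proof.
move=> P_prime x0 x1; apply/eqP; rewrite eq_le -(prime_abs_le1 R P_prime x0) x1 lexx andbT.
by rewrite leNgt -(prime_abs_lt1 R P_prime x0) x1 ltxx.
Qed.

(** The radical counts log N(P) once, whereas the right-hand side counts it as many times as the
    valuation of x, which is at least 1. *)
Lemma ln_norm_le_abs P x : primesK P -> x != 0 -> abs P x < 1 ->
  ln ((ideal_norm OK P)%:R : R) <= - ln (abs P x).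
Proof.
move=> P_prime x0; rewrite (prime_abs_lt1 R P_prime x0) => v_gt0.
have N_gt1 : 1 < (ideal_norm OK P)%:R :> R by rewrite ltr1n ideal_norm_gt1.
have N_gt0 := lt_trans ltr01 N_gt1.
rewrite prime_absE // -lnV ?posrE ?exprz_gt0 // invr_expz opprK.
rewrite ler_ln ?posrE ?exprz_gt0 // -[X in X <= _]expr1z ler_eXz2l //.
Qed.

Hypothesis abcK : abc_conjecture R K.

(* With [y] integral and [g.[y]] a unit outside of [T0], the primes dividing
   [Phi.[y] * (Phi.[y] - 1)] divide [r.[y]], whose height is smaller than that
   of [Phi.[y]] because [r] has smaller degree than [Phi]. *)
Lemma abc_finite_units (D N : nat) (Phi W g r : {poly K}) (T0 : set (set K)) :
  size Phi = D.+2 -> r != 0 -> (size r <= D.+1)%N ->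
  Phi * (Phi - 1) * W = (g * r) ^+ N -> finite_set T0 ->
  finite_set [set y | forall P, primesK P -> ~ T0 P ->
                abs P y <= 1 /\ 1 <= abs P g.[y]].
Proof.
move=> Phi_size r_neq0 r_size PhiW T0_fin.
have [s [s_sum s_norm s_fin]] := exists_complex_embeddings R K.
(* Outside of these primes [Phi], [W] and [r] have integral coefficients and so take integral values
   at y. *)
pose bad := [set P | primesK P /\ (T0 P \/ bad_primes Phi P \/ bad_primes W P \/ bad_primes r P)].
have bad_fin : finite_set bad.
  apply: (@sub_finite_set _ _ (T0 `|` (bad_primes Phi `|` (bad_primes W `|` bad_primes r)))).
    by move=> P [_ h].
  by rewrite !finite_setU; split=> //; split; [|split]; exact: finite_bad_primes.
have [T T_uniq TP] := finite_seq bad_fin.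
have T_prime P : P \in T -> primesK P by move=> /TP[].
have notT P : primesK P -> P \notin T ->
    [/\ ~ T0 P, ~ bad_primes Phi P, ~ bad_primes W P & ~ bad_primes r P].
  by move=> P_prime /negP PT; split=> h; apply: PT; apply/TP; split=> //; tauto.
(* For y integral outside [T] this is [K : Q] times the height of y. *)
pose H y := \sum_k ln (Num.max 1 (normc (s k y))) +
            \sum_(P <- T) ln (Num.max 1 (abs P y)).
have max_gt0 (x : R) : 0 < Num.max 1 x by rewrite lt_max ltr01.
have lnmax_ge0 (x : R) : 0 <= ln (Num.max 1 x) by rewrite ln_ge0 // le_max lexx.
have Phi_ge : exists C : R, forall y, D.+1%:R * H y <=
    \sum_k ln (Num.max 1 (normc (s k Phi.[y]))) +
    \sum_(P <- T) ln (Num.max 1 (abs P Phi.[y])) + C.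
  pose Ck k := projT1 (cid (ln_abs_horner_ge (normc_absolute (s k)) Phi_size)).
  have CkP k := projT2 (cid (ln_abs_horner_ge (normc_absolute (s k)) Phi_size)).
  have ex P : exists C : R, P \in T -> forall y,
      D.+1%:R * ln (Num.max 1 (abs P y)) <= ln (Num.max 1 (abs P Phi.[y])) + C.
    have [PT|] := boolP (P \in T); last by exists 0.
    by have [C PC] := ln_abs_horner_ge (prime_abs_absolute (T_prime _ PT)) Phi_size; exists C.
  pose CP P := projT1 (cid (ex P)); have CPP P := projT2 (cid (ex P)).
  exists (\sum_k Ck k + \sum_(P <- T) CP P) => y.
  rewrite /H mulrDr !mulr_sumr addrACA -!big_split /=; apply: lerD.
    by apply: ler_sum => k _; apply: CkP.
  by rewrite big_seq [leRHS]big_seq; apply: ler_sum => P PT; apply: CPP.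
have r_le : exists C : R, forall y, \sum_k ln (normc (s k r.[y])) +
    \sum_(P <- T) ln (abs P r.[y]) <= D%:R * H y + C.
  pose Ck k := projT1 (cid (ln_abs_horner_le (normc_absolute (s k)) r_size)).
  have CkP k := projT2 (cid (ln_abs_horner_le (normc_absolute (s k)) r_size)).
  have ex P : exists C : R, P \in T -> forall y,
      ln (abs P r.[y]) <= D%:R * ln (Num.max 1 (abs P y)) + C.
    have [PT|] := boolP (P \in T); last by exists 0.
    by have [C PC] := ln_abs_horner_le (prime_abs_absolute (T_prime _ PT)) r_size; exists C.
  pose CP P := projT1 (cid (ex P)); have CPP P := projT2 (cid (ex P)).
  exists (\sum_k Ck k + \sum_(P <- T) CP P) => y.
  rewrite /H mulrDr !mulr_sumr addrACA -!big_split /=; apply: lerD.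
    by apply: ler_sum => k _; apply: CkP.
  by rewrite big_seq [leRHS]big_seq; apply: ler_sum => P PT; apply: CPP.
have [C1 Phi_geC] := Phi_ge; have [C2 r_leC] := r_le.
(* Chosen so that (1 + eps) D <= D + 1/2. Against the coefficient D + 1 of H(y) on the height side
   this leaves H(y)/2, which explains the factor 2 in [B]. *)
pose eps : R := (2 * D.+1%:R)^-1.
have eps_gt0 : 0 < eps by rewrite invr_gt0 mulr_gt0 ?ltr0n.
have [C3 abcC] := abcK eps_gt0.
pose lnN (P : set K) := ln ((ideal_norm OK P)%:R : R).
pose dK : R := degQ R K.
have dK_gt0 : 0 < dK by rewrite ltr0n dim_gt0.
pose B := 2 * (C1 + (1 + eps) * (\sum_(P <- T) lnN P + C2) + dK * C3).
have lnN_ge0 P : primesK P -> 0 <= lnN P.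
  by move=> P_prime; rewrite ln_ge0 // ler1n ltnW // ideal_norm_gt1.
suff H_le y : Phi.[y] != 0 -> Phi.[y] - 1 != 0 -> r.[y] != 0 ->
    (forall P, primesK P -> ~ T0 P -> abs P y <= 1 /\ 1 <= abs P g.[y]) -> H y <= B.
  have bnd_fin := finite_bounded_places s_fin (expR B) T_prime.
  have Phi_neq0 : Phi != 0 by rewrite -size_poly_eq0 Phi_size.
  have Phi1_neq0 : Phi - 1 != 0.
    by rewrite subr_eq0; apply: contra_eq_neq Phi_size => ->; rewrite size_poly1.
  (* The abc inequality needs nonzero terms and the product formula needs r(y) nonzero; the y
     violating this are roots of three fixed polynomials. *)
  apply: (@sub_finite_set _ _ (([set y | root Phi y] `|` [set y | root (Phi - 1) y]) `|`
      [set y | root r y] `|` _)); last first.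
    rewrite !finite_setU; split; last exact: bnd_fin.
    by split; [split|]; apply: finite_roots.
  move=> y yP.
  have [p0|p0] := eqVneq Phi.[y] 0; first by left; left; left; apply/rootP.
  have [p1|p1] := eqVneq (Phi.[y] - 1) 0.
    by left; left; right; rewrite /= /root !hornerE p1.
  have [ry|ry] := eqVneq r.[y] 0; first by left; right; apply/rootP.
  have HB := H_le y p0 p1 ry yP; right; split.
  - move=> P P_prime PT; have [T0P _ _ _] := notT P P_prime PT.
    by case: (yP P P_prime T0P).
  - move=> P PT; have h : ln (Num.max 1 (abs P y)) <= B.
      apply: le_trans HB; rewrite /H addrC (big_rem P) //= -addrA lerDl addr_ge0 //.
        by apply: sumr_ge0.
      by apply: sumr_ge0.
    rewrite (@le_trans _ _ (Num.max 1 (abs P y))) ?le_max ?lexx ?orbT //.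
    by rewrite -(lnK (_ : Num.max 1 (abs P y) \is Num.pos)) ?ler_expR // posrE max_gt0.
  - move=> k; have h : ln (Num.max 1 (normc (s k y))) <= B.
      apply: le_trans HB; rewrite /H (bigD1 k) //= -addrA lerDl addr_ge0 //.
        by apply: sumr_ge0.
      by apply: sumr_ge0.
    rewrite (@le_trans _ _ (Num.max 1 (normc (s k y)))) ?le_max ?lexx ?orbT //.
    by rewrite -(lnK (_ : Num.max 1 (normc (s k y)) \is Num.pos)) ?ler_expR // posrE max_gt0.
move=> Phi0 Phi1 ry0 yP.
have yT P : primesK P -> P \notin T -> abs P y <= 1 /\ 1 <= abs P g.[y].
  by move=> P_prime /(notT P P_prime)[T0P _ _ _]; apply: yP.
have [x0 b0] : Phi.[y] != 0 /\ 1 - Phi.[y] != 0 by rewrite -opprB oppr_eq0.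
have abs_b P : primesK P -> abs P (1 - Phi.[y]) = abs P (Phi.[y] - 1).
  move=> P_prime; have -> : 1 - Phi.[y] = -1 * (Phi.[y] - 1) by ring.
  rewrite (prime_absM R P_prime).
  by rewrite (abs_valN1 (prime_abs_absolute P_prime)) mul1r.
have Phi_le1 P : primesK P -> P \notin T -> abs P Phi.[y] <= 1 /\ abs P (Phi.[y] - 1) <= 1.
  move=> P_prime PT; have [_ bP _ _] := notT P P_prime PT.
  have [y1 _] := yT P P_prime PT.
  have h := prime_abs_horner_le1 P_prime bP y1; split=> //.
  rewrite (le_trans (prime_absD R P_prime _ _)) // ge_max h.
  by rewrite (abs_valN1 (prime_abs_absolute P_prime)) lexx.
(* At such P the absolute values of Phi(y), Phi(y) - 1 and W(y) are at most 1, while their product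
   is |g(y) r(y)|^N >= 1; so each of the first two must be 1. *)
have Phi_eq1 P : primesK P -> P \notin T -> abs P r.[y] = 1 ->
    abs P Phi.[y] = 1 /\ abs P (1 - Phi.[y]) = 1.
  move=> P_prime PT r1; have [a1 b1] := Phi_le1 P P_prime PT.
  have [y1 g1] := yT P P_prime PT; have [_ _ WP _] := notT P P_prime PT.
  have W1 := prime_abs_horner_le1 P_prime WP y1.
  have : 1 <= abs P Phi.[y] * abs P (Phi.[y] - 1) * abs P W.[y].
    rewrite -!prime_absM //; have /(congr1 (horner^~ y)) := PhiW.
    rewrite horner_exp !hornerM hornerD hornerN hornerC => ->; rewrite prime_absX // prime_absM // r1 mulr1.
    exact: exprn_ege1.
  have := prime_abs_ge0 R P_prime Phi.[y]; have := prime_abs_ge0 R P_prime (Phi.[y] - 1).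
  have := prime_abs_ge0 R P_prime W.[y]; rewrite abs_b //.
  set u := abs P Phi.[y] in a1 *; set w := abs P (Phi.[y] - 1) in b1 *.
  set z := abs P W.[y] in W1 * => z0 w0 u0 h.
  have uw_le : u * w * z <= u * w by rewrite ler_piMr // mulr_ge0.
  have u_le : u * w <= u by rewrite ler_piMr.
  have w_le : u * w <= w by rewrite ler_piMl.
  by split; apply/eqP; rewrite eq_le ?a1 ?b1 (le_trans h) // (le_trans uw_le).
have N1 : (-1 : K) != 0 by rewrite oppr_eq0 oner_neq0.
have abc0 : Phi.[y] + (1 - Phi.[y]) + -1 = 0 by ring.
have abc := abcC _ _ _ x0 b0 N1 abc0.
pose m (v : K -> R) := \big[Num.max/0]_(x <- [:: Phi.[y]; 1 - Phi.[y]; -1]) v x.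
have m_ge v : absolute_value v -> Num.max 1 (v Phi.[y]) <= m v.
  move=> v_abs; rewrite /m !big_cons big_nil (abs_valN1 v_abs).
  by rewrite ge_max; apply/andP; split; rewrite !le_max lexx ?orbT.
(* The coordinate -1 makes every local maximum at least 1. Outside [T] it equals 1, so the sum over
   all primes collapses to [T]. *)
have ph_ge : \sum_k ln (Num.max 1 (normc (s k Phi.[y]))) +
    \sum_(P <- T) ln (Num.max 1 (abs P Phi.[y])) <=
    dK * proj_height R [:: Phi.[y]; 1 - Phi.[y]; -1].
  rewrite /proj_height mulrC divfK ?gt_eqF //; apply: lerD.
    rewrite s_sum; apply: ler_sum => k _.
    have le_m := m_ge _ (normc_absolute (s k)).
    suff : ln (Num.max 1 (normc (s k Phi.[y]))) <= ln (m (normc \o s k)) by [].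
    by rewrite ler_ln ?posrE // (lt_le_trans (max_gt0 _) le_m).
  rewrite (fsbigE T) //; last first.
    move=> P P_prime PT; have [a1 b1] := Phi_le1 P P_prime PT.
    have := m_ge _ (prime_abs_absolute P_prime); rewrite -/(m _) => m_ge'.
    suff -> : m (abs P) = 1 by rewrite ln1.
    apply/eqP; rewrite eq_le (le_trans _ m_ge') ?le_max ?lexx // andbT.
    rewrite /m !big_cons big_nil (abs_valN1 (prime_abs_absolute P_prime)) abs_b //.
    by rewrite !ge_max a1 b1 lexx ler01.
  rewrite big_seq [leRHS]big_seq_cond [leRHS](eq_bigl (mem T)) => [|P]; last first.
    have [PT|/negPf PT] := boolP (P \in T); last by rewrite /= [RHS]PT.
    by rewrite mem_set //; apply: T_prime.
  apply: ler_sum => P /T_prime P_prime; have vP := prime_abs_absolute P_prime.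
  rewrite ler_ln ?posrE ?max_gt0 //; first exact: m_ge.
  exact: lt_le_trans (max_gt0 _) (m_ge _ vP).
(* The primes of the radical lie in [T] or in the set [Z] of primes outside [T] dividing r(y). By
   the product formula the contribution of [Z] is at most the size of r(y) at the embeddings and at
   [T], hence at most D H(y) + C2. *)
have rad_le : dK * radical R Phi.[y] (1 - Phi.[y]) (-1) <=
    \sum_(P <- T) lnN P + (D%:R * H y + C2).
  rewrite /radical mulrC divfK ?gt_eqF //.
  have [r1 r1_uniq r1P] := finite_seq (finite_prime_abs_neq1 R ry0).
  pose Z := [seq P <- r1 | P \notin T].
  have ZP P : P \in Z -> [/\ P \notin T, primesK P & abs P r.[y] < 1].
    rewrite mem_filter => /andP[PT /r1P[P_prime neq1]]; split=> //.
    have [_ _ _ rP] := notT P P_prime PT; rewrite lt_neqAle neq1.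
    exact: prime_abs_horner_le1 P_prime rP (yT P P_prime PT).1.
  have TZ_uniq : uniq (T ++ Z).
    rewrite cat_uniq T_uniq filter_uniq // andbT; apply/hasPn => P.
    by rewrite mem_filter => /andP[].
  have TZ_prime P : P \in T ++ Z -> primesK P.
    by rewrite mem_cat => /orP[/T_prime|/ZP[]].
  have TZ_neq1 P : primesK P -> abs P r.[y] != 1 -> P \in T ++ Z.
    move=> P_prime neq1; rewrite mem_cat mem_filter.
    by have [//|PT /=] := boolP (P \in T); apply/r1P.
  set A := [set P | _ /\ _].
  have A_TZ P : A P -> P \in T ++ Z.
    move=> [P_prime neq]; apply: contrapT => /negP PTZ; apply: neq.
    have r1' : abs P r.[y] = 1.
      by apply/eqP; apply: contraNT PTZ; apply: TZ_neq1.
    have PT : P \notin T by apply: contraNN PTZ; rewrite mem_cat => ->.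
    have [a1 b1] := Phi_eq1 P P_prime PT r1'.
    rewrite (val_at_abs1 P_prime x0 a1) (val_at_abs1 P_prime b0 b1).
    by rewrite (val_at_abs1 P_prime N1) // (abs_valN1 (prime_abs_absolute P_prime)).
  have A_fin : finite_set A.
    by apply: (@sub_finite_set _ _ [set` T ++ Z]) => //.
  rewrite fsbig_finite //.
  apply: (@le_trans _ _ (\sum_(P <- T ++ Z) lnN P)).
    apply: sum_sub_le => // [P|P /TZ_prime]; last exact: lnN_ge0.
    by rewrite in_fset_set // inE; apply: A_TZ.
  rewrite big_cat lerD2l.
  have pf := product_formula s_norm ry0 TZ_uniq TZ_prime TZ_neq1.
  have ln_pf : \sum_k ln (normc (s k r.[y])) + \sum_(P <- T) ln (abs P r.[y]) +
      \sum_(P <- Z) ln (abs P r.[y]) = 0.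
    rewrite -addrA -big_cat /= -ln_prod_seq => [|k _]; last first.
      by rewrite lt_neqAle normc_ge0 andbT eq_sym normc_eq0 fmorph_eq0.
    rewrite -ln_prod_seq => [|P /TZ_prime P_prime]; last exact: prime_abs_gt0.
    rewrite -lnM ?posrE; [by rewrite pf ln1 | |].
      by apply: prodr_gt0 => k _; rewrite lt_neqAle normc_ge0 andbT eq_sym normc_eq0 fmorph_eq0.
    by rewrite big_seq; apply: prodr_gt0 => P /TZ_prime P_prime; apply: prime_abs_gt0.
  have Z_le : \sum_(P <- Z) lnN P <= - \sum_(P <- Z) ln (abs P r.[y]).
    rewrite -sumrN big_seq [leRHS]big_seq; apply: ler_sum => P /ZP[_ P_prime lt1].
    exact: ln_norm_le_abs.
  by have := r_leC y; lra.
have H_ge0 : 0 <= H y by apply: addr_ge0; apply: sumr_ge0.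
have PhiC := Phi_geC y.
set ph := proj_height _ _ in ph_ge abc; set rd := radical _ _ _ _ in rad_le abc.
have abc' : dK * ph <= (1 + eps) * (dK * rd) + dK * C3.
  by have := ler_wpM2l (ltW dK_gt0) abc; lra.
have eps1_ge0 : 0 <= 1 + eps by rewrite addr_ge0 // ltW.
have rad' : (1 + eps) * (dK * rd) <= (1 + eps) * (\sum_(P <- T) lnN P + (D%:R * H y + C2)).
  by rewrite ler_wpM2l.
have epsD : eps * D%:R <= 2^-1.
  rewrite /eps invfM -mulrA ler_piMr ?invr_ge0 // ler_pdivrMl ?ltr0n // mulr1 ler_nat.
  exact: leqnSn.
have epsH : eps * D%:R * H y <= 2^-1 * H y by rewrite ler_wpM2r.
rewrite /B; rewrite -natr1 in PhiC.
set Hy := H y in epsH rad' PhiC H_ge0 *; set S0 := \sum_(P <- T) lnN P in rad' *.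
set SP := \sum_k _ + \sum_(P <- T) _ in PhiC ph_ge.
nra.
Qed.

End AbcFiniteness.

(** * Integral points relative to gamma *)

Section Integrality.
Variables (R : realType) (K : fieldExtType rat) (P : set K).
Local Notation OK := (@OK K).
Hypothesis P_prime : nonzero_prime OK P.
Local Notation abs := (prime_abs R P).

Lemma prime_absN x : abs (- x) = abs x.
Proof.
by rewrite -mulN1r prime_absM // (abs_valN1 (prime_abs_absolute R P_prime)) mul1r.
Qed.

Definition integral_at (p : {poly K}) : Prop := forall i, abs p`_i <= 1.

Lemma prime_abs_sum_le1 I (r : seq I) (Q : pred I) (F : I -> K) :
  (forall i, Q i -> abs (F i) <= 1) -> abs (\sum_(i <- r | Q i) F i) <= 1.
Proof.
move=> F1; elim/big_ind: _ => [|x y x1 y1|]; [by rewrite prime_abs0 ler01 | | exact: F1].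
by rewrite (le_trans (prime_absD R P_prime x y)) // ge_max x1.
Qed.

Lemma prime_absM_le1 x y : abs x <= 1 -> abs y <= 1 -> abs (x * y) <= 1.
Proof. by move=> x1 y1; rewrite prime_absM // mulr_ile1 ?prime_abs_ge0. Qed.

Lemma integral_atC c : abs c <= 1 -> integral_at c%:P.
Proof. by move=> c1 i; rewrite coefC; case: ifP; rewrite ?prime_abs0 ?ler01. Qed.

Lemma integral_atX : integral_at 'X.
Proof. by move=> i; rewrite coefX; apply/prime_abs_int/OK_nat. Qed.

Lemma integral_atD p q : integral_at p -> integral_at q -> integral_at (p + q).
Proof.
by move=> p1 q1 i; rewrite coefD (le_trans (prime_absD R P_prime _ _)) // ge_max p1 q1.
Qed.

Lemma integral_atN p : integral_at p -> integral_at (- p).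
Proof. by move=> p1 i; rewrite coefN prime_absN. Qed.

Lemma integral_atM p q : integral_at p -> integral_at q -> integral_at (p * q).
Proof.
move=> p1 q1 i; rewrite coefM; apply: prime_abs_sum_le1 => k _.
exact: prime_absM_le1.
Qed.

Lemma integral_at_comp p q : integral_at p -> integral_at q -> integral_at (p \Po q).
Proof.
move=> p1 q1; rewrite comp_polyE; elim/big_ind: _ => [||k _].
- by move=> i; rewrite coef0 prime_abs0 ler01.
- exact: integral_atD.
rewrite -mul_polyC; apply: integral_atM; first exact: integral_atC.
elim: (nat_of_ord k) => [|m IHm]; first by apply: integral_atC; rewrite prime_abs1.
by rewrite exprS; apply: integral_atM.
Qed.

Lemma integral_at_horner p x : integral_at p -> abs x <= 1 -> abs p.[x] <= 1.
Proof.
move=> p1 x1; rewrite horner_coef; apply: prime_abs_sum_le1 => i _.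
apply: prime_absM_le1 => //; rewrite prime_absX //; apply: exprn_ile1 => //.
exact: prime_abs_ge0.
Qed.

(** Descending induction on i: with e = deg G and G monic, the coefficient i + e of H G is H_i plus
    products of coefficients of G with H_k for k > i. *)
Lemma integral_at_quotient (G H : {poly K}) : G \is monic -> integral_at G ->
  integral_at (H * G) -> integral_at H.
Proof.
move=> G_mon G1 HG1 i.
have [m] := ubnP (size H - i); elim: m i => // m IHm i; rewrite ltnS => le_m.
have [ltH|leH] := ltnP i (size H); last by rewrite nth_default // prime_abs0 ler01.
pose e := (size G).-1.
have szG : size G = e.+1 by rewrite prednK // lt0n size_poly_eq0 monic_neq0.
have eG : G`_e = 1 by rewrite -(monicP G_mon) lead_coefE.
clearbody e; have := coefM H G (i + e); rewrite (bigD1 (inord i)) //= inordK ?ltnS ?leq_addr // addKn eG mulr1.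
move/eqP; rewrite -subr_eq => /eqP <-; rewrite (le_trans (prime_absD R P_prime _ _)) //.
rewrite ge_max HG1 prime_absN; apply: prime_abs_sum_le1 => k ki.
have [lt_k|lt_k|eq_k] := ltngtP k i.
- rewrite [G`__]nth_default ?mulr0 ?prime_abs0 ?ler01 //.
  by rewrite szG; lia.
- by apply: prime_absM_le1 => //; apply: IHm; have := ltH; move: (size H) le_m => h; lia.
- by case/eqP: ki; apply: val_inj; rewrite /= inordK ?ltnS ?leq_addr.
Qed.

Lemma common_denominator (p : {poly K}) : integral_at p ->
  exists t, [/\ OK t, ~ P t & forall i, OK (t * p`_i)].
Proof.
elim/poly_ind: p => [|p c IHp] p1.
  by exists 1; split; [exact: OK1 | exact: prime1 | move=> i; rewrite coef0 mulr0; exact: OK0].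
have coefE i : (p * 'X + c%:P)`_i = if i is i'.+1 then p`_i' else c.
  by rewrite coefD coefMX coefC; case: i => [|i]; rewrite ?add0r ?addr0.
have [|t [t_int Pt tp]] := IHp; first by move=> i; have := p1 i.+1; rewrite coefE.
have := p1 0%N; rewrite coefE => /(prime_abs_le1P R P_prime)[a [u [a_int u_int Pu cE]]].
have u_neq0 : u != 0 by apply: contra_not_neq Pu => ->; case: (prime_subgroup P_prime).
exists (t * u); split=> [||i]; first exact: OK_mul.
  by case/(prime_mul P_prime).
rewrite coefE; case: i => [|i]; last by rewrite mulrAC; apply: OK_mul.
by rewrite cE (_ : t * u * (a / u) = t * a); [apply: OK_mul | field].
Qed.

End Integrality.

Section RingOfIntegersOver.
Variables (K : fieldExtType rat) (Kbar : fieldType) (iota : {rmorphism K -> Kbar}).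
Variable beta : Kbar.
Local Notation OK := (@OK K).
Local Notation OL := (ring_of_integers (adjoin iota beta)).
Local Notation "p ^i" := (map_poly iota p) (at level 2, format "p ^i").

Lemma OL_add x y : OL x -> OL y -> OL (x + y).
Proof.
move=> [[p1 [q1 [q1n xE]]] ix] [[p2 [q2 [q2n yE]]] iy]; split.
  exists (p1 * q2 + p2 * q1), (q1 * q2).
  rewrite !rmorphD !rmorphM /= !hornerD !hornerM mulf_neq0 //; split=> //.
  by rewrite xE yE addf_div.
exact: (@integral_add _ _ (intr : {rmorphism int -> Kbar})).
Qed.

Lemma OL_mul x y : OL x -> OL y -> OL (x * y).
Proof.
move=> [[p1 [q1 [q1n xE]]] ix] [[p2 [q2 [q2n yE]]] iy]; split.
  exists (p1 * p2), (q1 * q2); rewrite !rmorphM /= !hornerM mulf_neq0 //; split=> //.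
  by rewrite xE yE mulf_div.
exact: (@integral_mul _ _ (intr : {rmorphism int -> Kbar})).
Qed.

Lemma integral_iota x : OK x -> integralOver (intr : int -> Kbar) (iota x).
Proof.
move=> /OK_integral[p p_mon px]; exists p => //.
have -> : map_poly intr p = (map_poly intr p)^i.
  by rewrite -map_poly_comp; apply: eq_map_poly => z /=; rewrite rmorph_int.
by rewrite fmorph_root.
Qed.

Lemma OL_iota x : OK x -> OL (iota x).
Proof.
move=> x_int; split; last exact: integral_iota.
by exists x%:P, 1; rewrite rmorph1 map_polyC !hornerC oner_neq0 divr1.
Qed.

Lemma OL_sub x y : OL x -> OL y -> OL (x - y).
Proof.
move=> hx hy; rewrite -mulN1r; apply: OL_add => //; apply: OL_mul => //.
by rewrite -(rmorph1 iota) -rmorphN; apply: OL_iota; apply: (OK_int _ (-1)).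
Qed.

Lemma OL_sum I (r : seq I) (F : I -> Kbar) : (forall i, OL (F i)) ->
  OL (\sum_(i <- r) F i).
Proof.
move=> h; elim/big_ind: _ => //; last exact: OL_add.
by rewrite -(rmorph0 iota); apply: OL_iota; apply: OK0.
Qed.

Lemma OL_exp x k : OL x -> OL (x ^+ k).
Proof.
move=> hx; elim: k => [|k IHk]; last by rewrite exprS; apply: OL_mul.
by rewrite expr0 -(rmorph1 iota); apply: OL_iota; apply: OK1.
Qed.

Lemma OL_iota_inv x : OL (iota x) -> OK x.
Proof.
move=> [_ [p p_mon px]]; apply/OK_integral; exists p => //.
have E : map_poly intr p = (map_poly intr p)^i.
  by rewrite -map_poly_comp; apply: eq_map_poly => z /=; rewrite rmorph_int.
by rewrite E fmorph_root in px.
Qed.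

Lemma adjoin_gen : adjoin iota beta beta.
Proof. by exists 'X, 1; rewrite rmorph1 map_polyX hornerX hornerC oner_neq0 divr1. Qed.

Lemma adjoin_mul_iota a x : adjoin iota beta x -> adjoin iota beta (iota a * x).
Proof.
move=> [p [q [qn ->]]]; exists (a%:P * p), q; split=> //.
by rewrite rmorphM /= hornerM map_polyC hornerC mulrA.
Qed.

(** t beta is a root of t^e G(X/t), with e = deg G; its lower coefficients t^(e-i) G_i are integral
    as soon as all t G_i are. *)
Lemma OL_scale (G : {poly K}) t : OK t -> G \is monic -> root G^i beta ->
  (forall i, OK (t * G`_i)) -> OL (iota t * beta).
Proof.
move=> t_int G_mon Gb tG; split; first exact/adjoin_mul_iota/adjoin_gen.
pose e := (size G).-1.
have szG : size G = e.+1 by rewrite prednK // lt0n size_poly_eq0 monic_neq0.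
have eG : G`_e = 1 by rewrite -(monicP G_mon) lead_coefE.
pose B : {poly Kbar} := 'X^e + \poly_(i < e) iota (t ^+ (e - i) * G`_i).
apply: (@integral_root_monic _ _ (intr : {rmorphism int -> Kbar}) _ B).
- by rewrite monicE lead_coefDl ?lead_coefXn // size_polyXn ltnS size_poly.
- have E : B.[iota t * beta] = iota t ^+ e * G^i.[beta].
    rewrite /B hornerD hornerXn horner_poly (@horner_coef_wide _ e.+1); last first.
      by rewrite size_map_poly szG.
    rewrite big_ord_recr /= coef_map /= eG rmorph1 mul1r mulrDr addrC -exprMn; congr (_ + _).
    rewrite big_distrr /=; apply: eq_bigr => i _.
    rewrite coef_map rmorphM rmorphXn exprMn.
    have -> : iota t ^+ e = iota t ^+ (e - i) * iota t ^+ i by rewrite -exprD subnK // ltnW.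
    by rewrite /=; ring.
  by rewrite /root E (rootP Gb) mulr0.
apply/integral_poly => i; rewrite /B coefD coefXn coef_poly.
apply: (@integral_add _ _ (intr : {rmorphism int -> Kbar})).
  exact: (@integral_nat _ _ (intr : {rmorphism int -> Kbar})).
case: ifP => lti; last exact: (@mxpoly.integral0 _ _ (intr : {rmorphism int -> Kbar})).
apply: integral_iota; rewrite -(prednK (_ : 0 < e - i)%N) ?subn_gt0 // exprSr -mulrA.
by apply: OK_mul => //; apply: OK_exp.
Qed.

End RingOfIntegersOver.

(** * A prime of K(beta) above P at which beta and gamma have the same reduction *)

Section PrimeAbove.
Variables (R : realType) (K : fieldExtType rat) (P : set K).
Variables (Kbar : closedFieldType) (iota : {rmorphism K -> Kbar}).
Variables (G : {poly K}) (beta : Kbar) (gamma : K).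
Local Notation OK := (@OK K).
Local Notation abs := (prime_abs R P).
Local Notation OL := (ring_of_integers (adjoin iota beta)).
Local Notation "p ^i" := (map_poly iota p) (at level 2, format "p ^i").
Hypothesis P_prime : nonzero_prime OK P.
Hypotheses (G_mon : G \is monic) (G_int : integral_at R P G) (G_irr : irreducible_poly G).
Hypotheses (G_beta : root G^i beta) (gamma_int : abs gamma <= 1).
Hypothesis G_gamma : abs G.[gamma] < 1.
Local Notation delta := (iota gamma - beta).

(* If [delta * b = t] then [1 / delta] is integral over the local ring at [P],
   and clearing denominators in its equation gives [1 = H.[gamma] * G.[gamma]]
   with [H] integral at [P]. *)
Lemma delta_mul_neq b t : OL b -> OK t -> ~ P t -> delta * b <> iota t.
Proof.
move=> [_ [B B_mon Bb]] t_int Pt bt.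
have t_neq0 : t != 0 by apply: contra_not_neq Pt => ->; case: (prime_subgroup P_prime).
have it_neq0 : iota t != 0 by rewrite fmorph_eq0.
have b_neq0 : b != 0 by apply: contraNneq it_neq0 => b0; rewrite -bt b0 mulr0.
have delta_neq0 : delta != 0 by apply: contraNneq it_neq0 => d0; rewrite -bt d0 mul0r.
pose N := (size B).-1.
have szB : size B = N.+1 by rewrite prednK // lt0n size_poly_eq0 monic_neq0.
have BN : B`_N = 1 by rewrite -(monicP B_mon) lead_coefE.
clearbody N.
have t1 : abs t = 1 by apply/(prime_abs_eq1P R P_prime).
(* The reversed polynomial of [B], rescaled by t: it vanishes at delta = t / b, and M(0) = 1 because
   [B] is monic. Then M(gamma - X) vanishes at beta, so G divides it, and its value at gamma is
   1. *)
pose M : {poly K} := \poly_(i < N.+1) ((B`_(N - i))%:~R * t^-1 ^+ i).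
have M_int : integral_at R P M.
  move=> i; rewrite coef_poly; case: ifP => _; last by rewrite prime_abs0 ler01.
  apply: prime_absM_le1 => //; first by apply: prime_abs_int => //; apply: OK_int.
  by rewrite prime_absX // prime_absV // t1 invr1 expr1n.
have M0 : M.[0] = 1 by rewrite horner_coef0 coef_poly /= subn0 BN expr0 mulr1.
have Mdelta : M^i.[delta] = 0.
  have -> : M^i.[delta] = b^-1 ^+ N * (map_poly intr B).[b]; last by rewrite (rootP Bb) mulr0.
  rewrite (@horner_coef_wide _ N.+1); last by rewrite size_map_poly size_poly.
  rewrite (@horner_coef_wide _ N.+1 (map_poly intr B)); last by rewrite -szB; apply: size_poly.
  rewrite [in RHS](reindex_inj rev_ord_inj) /= big_distrr /=; apply: eq_bigr => k _.
  have le_k : (k <= N)%N by rewrite -ltnS.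
  have dt : delta = iota t * b^-1 by rewrite -bt mulfK.
  rewrite !coef_map /= coef_poly ltn_ord subSS rmorphM rmorphXn rmorph_int fmorphV.
  have bN : b ^+ N = b ^+ k * b ^+ (N - k) by rewrite -exprD subnKC.
  have tk : iota t ^+ k != 0 by rewrite expf_neq0.
  have bk : b ^+ k != 0 by rewrite expf_neq0.
  have bNk : b ^+ (N - k) != 0 by rewrite expf_neq0.
  by rewrite dt exprMn !exprVn bN; field; rewrite tk bk bNk.
pose H0 := M \Po (gamma%:P - 'X).
have H0_beta : root H0^i beta.
  rewrite /root map_comp_poly horner_comp rmorphB /= map_polyC map_polyX.
  by rewrite hornerD hornerN hornerX hornerC Mdelta.
have /dvdpP[H HE] := irreducible_dvd_root G_irr G_beta H0_beta.
have H_int : integral_at R P H.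
  apply: (integral_at_quotient P_prime G_mon G_int); rewrite -HE.
  apply: integral_at_comp => //; apply: integral_atD => //; first exact: integral_atC.
  by apply: integral_atN => //; apply: integral_atX.
have : abs H.[gamma] * abs G.[gamma] = 1.
  rewrite -prime_absM // -hornerM -HE horner_comp hornerD hornerN hornerX hornerC subrr M0.
  exact: prime_abs1.
have := integral_at_horner P_prime H_int gamma_int.
have := prime_abs_ge0 R P_prime H.[gamma]; have := prime_abs_ge0 R P_prime G.[gamma].
by move: G_gamma; set u := abs G.[gamma]; set w := abs H.[gamma]; nra.
Qed.

(** These are the traces on OL of the proper ideals containing delta in the localization of OL at
    the complement of P, described without forming that localization: the fourth clause puts in all
    multiples of delta up to denominators outside P, the fifth says that the ideal stays proper. *)
Definition good_ideal (X : set Kbar) : Prop :=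
  [/\ X `<=` OL, forall x y, X x -> X y -> X (x + y), forall a x, OL a -> X x -> X (a * x),
      forall x, OL x -> (exists t b, [/\ OK t, ~ P t, OL b & iota t * x = delta * b]) -> X x &
      forall t, OK t -> ~ P t -> ~ X (iota t)].

Lemma exists_maximal_ideal : exists2 Q, good_ideal Q &
  forall X, good_ideal X -> Q `<=` X -> X = Q.
Proof.
have iota0 : OL 0 by rewrite -(rmorph0 iota); apply: OL_iota; apply: OK0.
pose J := [set x | OL x /\ exists t b, [/\ OK t, ~ P t, OL b & iota t * x = delta * b]].
have J_good : good_ideal J.
  split.
  - by move=> x [].
  - move=> x y [xL [t [b [t_int Pt bL xE]]]] [yL [u [a [u_int Pu aL yE]]]].
    split; first exact: OL_add.
    exists (t * u), (iota u * b + iota t * a); split.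
    + exact: OK_mul.
    + by case/(prime_mul P_prime).
    + by apply: OL_add; apply: OL_mul => //; apply: OL_iota.
    + rewrite rmorphM mulrDr (_ : _ * x = iota u * (iota t * x)); last by ring.
      by rewrite (_ : _ * y = iota t * (iota u * y)); [rewrite xE yE; ring | ring].
  - move=> a x aL [xL [t [b [t_int Pt bL xE]]]]; split; first exact: OL_mul.
    exists t, (a * b); split=> //; first exact: OL_mul.
    by rewrite mulrCA xE mulrCA.
  - by [].
  - move=> t t_int Pt [_ [u [b [u_int Pu bL]]]]; rewrite -rmorphM => /esym.
    by apply: delta_mul_neq => //; [exact: OK_mul | case/(prime_mul P_prime)].
have J0 : J 0.
  split=> //; exists 1, 0; split=> //; rewrite ?mulr0 //; [exact: OK1 | exact: prime1].
have [|Q [[Q0|Q_good] Qmax]] := @Zorn_bigcup _ [set X | X = set0 \/ good_ideal X].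
- move=> F FP F_tot; have [[X0 [FX0 X0_good]]|none] := pselect (exists X, F X /\ good_ideal X); last first.
    left; apply/seteqP; split=> // x [X FX Xx]; have [X0|gX] := FP X FX; first by rewrite X0 in Xx.
    by case: none; exists X.
  have [X0L _ _ X0J _] := X0_good; right.
  have memF X x : F X -> X x -> good_ideal X.
    by move=> FX Xx; have [X0'|//] := FP X FX; rewrite X0' in Xx.
  split.
  + by move=> x [X FX Xx]; case: (memF X x FX Xx) => XL _ _ _ _; apply: XL.
  + move=> x y [X FX Xx] [Y FY Yy].
    have [_ XD _ _ _] := memF X x FX Xx; have [_ YD _ _ _] := memF Y y FY Yy.
    case: (F_tot X Y FX FY) => sub; [exists Y => //; apply: YD => // | exists X => //; apply: XD => //]; exact: sub.
  + move=> a x aL [X FX Xx]; have [_ _ XM _ _] := memF X x FX Xx.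
    by exists X => //; apply: XM.
  + by move=> x xL h; exists X0 => //; apply: X0J.
  + move=> t t_int Pt [X FX Xt]; have [_ _ _ _ Xn] := memF X _ FX Xt.
    exact: Xn Xt.
- case: (Qmax J); last by right.
  by rewrite Q0; split=> // /(_ 0 J0).
exists Q => // X X_good QX; apply/seteqP; split=> // x Xx; apply: contrapT => Qx.
by apply: (Qmax X); [split=> // /(_ x Xx) | right].
Qed.

Lemma exists_prime_above : exists Q, [/\ nonzero_prime OL Q, iota @^-1` Q = P &
  reduction OL Q (iota gamma) = reduction OL Q beta].
Proof.
have [Q Q_good Qmax] := exists_maximal_ideal.
have [QL QD QM QJ Qn] := Q_good.
have Q0 : Q 0.
  have OL0 : OL 0 by rewrite -(rmorph0 iota); apply: OL_iota; apply: OK0.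
  apply: (QJ) => //; exists 1, 0; split=> //; rewrite ?mulr0 //; [exact: OK1 | exact: prime1].
(* The ideal Q + x OL is strictly larger than Q, so it is not good, and the only clause it can
   violate is the last one. *)
have ext x : OL x -> ~ Q x -> exists t a q, [/\ OK t, ~ P t, OL a, Q q & iota t = q + x * a].
  move=> xL Qx; apply: contrapT => h.
  pose X := [set y | exists q a, [/\ Q q, OL a & y = q + x * a]].
  have OL0 : OL 0 by rewrite -(rmorph0 iota); apply: OL_iota; apply: OK0.
  have OL1 : OL 1 by rewrite -(rmorph1 iota); apply: OL_iota; apply: OK1.
  have QX : Q `<=` X by move=> q Qq; exists q, 0; rewrite mulr0 addr0.
  have X_good : good_ideal X.
    split.
    - move=> _ [q [a [Qq aL ->]]]; apply: OL_add; first exact: QL.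
      exact: OL_mul.
    - move=> _ _ [q [a [Qq aL ->]]] [q' [a' [Qq' aL' ->]]]; exists (q + q'), (a + a').
      by split; [exact: QD | exact: OL_add | ring].
    - move=> b _ bL [q [a [Qq aL ->]]]; exists (b * q), (b * a).
      by split; [exact: QM | exact: OL_mul | ring].
    - by move=> y yL yJ; apply: QX; apply: (QJ).
    - by move=> t t_int Pt [q [a [Qq aL tE]]]; apply: h; exists t, a, q.
  by apply: Qx; rewrite -(Qmax X X_good QX); exists 0, 1; rewrite mulr1 add0r.
have Q_prime_mul x y : OL x -> OL y -> Q (x * y) -> Q x \/ Q y.
  move=> xL yL Qxy; have [?|Qx] := pselect (Q x); first by left.
  have [?|Qy] := pselect (Q y); first by right.
  have [t [a [q [t_int Pt aL Qq tE]]]] := ext x xL Qx.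
  have [u [b [q' [u_int Pu bL Qq' uE]]]] := ext y yL Qy.
  case: (Qn (t * u)); [exact: OK_mul | by case/(prime_mul P_prime) | ].
  rewrite rmorphM tE uE mulrDl; apply: (QD).
    rewrite mulrC; apply: (QM) => //; apply: OL_add; first exact: QL.
    exact: OL_mul.
  rewrite mulrDr; apply: (QD); first by apply: (QM) => //; apply: OL_mul.
  by rewrite mulrACA mulrC; apply: (QM) => //; apply: OL_mul.
(* Otherwise t = q + x a with t outside P. Homogenize the monic equation [B] of a: the sum of B_k
   x^(N-k) t^k is congruent modulo Q to the same sum with x a for t, namely x^N B(a) = 0. But that
   sum is t^N + x u, an element of OK outside P. *)
have PQ x : P x -> Q (iota x).
  move=> Px; apply: contrapT => Qx; have x_int := prime_int P_prime Px.
  have [t [a [q [t_int Pt aL Qq tE]]]] := ext _ (OL_iota iota beta x_int) Qx.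
  have [_ [B B_mon Ba]] := aL.
  pose N := (size B).-1.
  have szB : size B = N.+1 by rewrite prednK // lt0n size_poly_eq0 monic_neq0.
  have BN : B`_N = 1 by rewrite -(monicP B_mon) lead_coefE.
  clearbody N.
  have Ba' : \sum_(k < N.+1) (B`_k)%:~R * a ^+ k = 0.
    transitivity (map_poly intr B).[a]; last exact/rootP.
    rewrite (@horner_coef_wide _ N.+1); last by rewrite -szB; apply: size_poly.
    by apply: eq_bigr => k _; rewrite coef_map.
  pose u := \sum_(k < N) (B`_k)%:~R * x ^+ (N - k).-1 * t ^+ k.
  have u_int : OK u.
    apply: OK_sum => k _; apply: OK_mul; last exact: OK_exp.
    by apply: OK_mul; [exact: OK_int | exact: OK_exp].
  have tux_int : OK (t ^+ N + x * u) by apply: OK_add; [exact: OK_exp | exact: OK_mul].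
  apply: (Qn (t ^+ N + x * u)) => //.
    move=> h; apply: Pt; apply: (primeX P_prime (k := N)) => //.
    rewrite -[t ^+ N](addrK (x * u)); apply: primeB => //.
    exact: primeMr.
  have iE : iota (t ^+ N + x * u) = \sum_(k < N.+1) (B`_k)%:~R * iota x ^+ (N - k) * iota t ^+ k.
    rewrite big_ord_recr /= BN subnn expr0 !mul1r rmorphD rmorphXn addrC; congr (_ + _).
    rewrite rmorphM rmorph_sum big_distrr /=; apply: eq_bigr => k _.
    rewrite !rmorphM !rmorphXn rmorph_int mulrCA -[in RHS](prednK (_ : 0 < N - k)%N) ?subn_gt0 //.
    by rewrite exprS; ring.
  have -> : iota (t ^+ N + x * u) =
      \sum_(k < N.+1) (B`_k)%:~R * iota x ^+ (N - k) * (iota t ^+ k - (iota x * a) ^+ k).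
    have x0 : \sum_(k < N.+1) (B`_k)%:~R * iota x ^+ (N - k) * (iota x * a) ^+ k = 0.
      transitivity (iota x ^+ N * \sum_(k < N.+1) (B`_k)%:~R * a ^+ k).
        rewrite big_distrr /=; apply: eq_bigr => k _.
        have le_k : (k <= N)%N by rewrite -ltnS.
        have -> : iota x ^+ N = iota x ^+ (N - k) * iota x ^+ k by rewrite -exprD subnK.
        by rewrite exprMn; ring.
      by rewrite Ba' mulr0.
    by under [RHS]eq_bigr do rewrite mulrBr; rewrite sumrB x0 subr0 iE.
  have xL := OL_iota iota beta x_int; have tL := OL_iota iota beta t_int.
  elim/big_ind: _ => // k _; apply: (QM).
    apply: OL_mul; last exact: OL_exp.
    by rewrite -(rmorph_int iota); apply: OL_iota; apply: OK_int.
  rewrite subrXX tE addrK mulrC; apply: (QM) => //; rewrite -tE.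
  by apply: OL_sum => i; apply: OL_mul; apply: OL_exp => //; apply: OL_mul.
have preQ : iota @^-1` Q = P.
  apply/seteqP; split=> [x /= Qx|x Px]; last exact: PQ.
  have x_int := OL_iota_inv (QL _ Qx).
  by apply: contrapT => Px; apply: (Qn x).
have nQ t : OK t -> ~ P t -> ~ Q (iota t) by move=> t_int Pt; apply: (Qn).
have OL1 : OL 1 by rewrite -(rmorph1 iota); apply: OL_iota; apply: OK1.
have [s0 [s0_int Ps0 s0G]] := common_denominator P_prime G_int.
have s0_beta := OL_scale s0_int G_mon G_beta s0G.
have /(prime_abs_le1P R P_prime)[a [s1 [a_int s1_int Ps1 gammaE]]] := gamma_int.
have nz t : ~ P t -> iota t != 0.
  rewrite fmorph_eq0 => Pt; apply: contra_not_neq Pt => ->.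
  by case: (prime_subgroup P_prime).
have s0n := nz _ Ps0; have s1n := nz _ Ps1.
have igE : iota gamma = iota a / iota s1 by rewrite gammaE fmorph_div.
(* Neither beta nor gamma need be integral. The factors s0 and s1, both outside P, clear their
   denominators, so this multiple of delta lies in OL and therefore in Q. *)
have sdelta : Q (iota (s0 * s1) * delta).
  apply: (QJ).
    rewrite rmorphM mulrBr igE; apply: OL_sub.
      have -> : iota s0 * iota s1 * (iota a / iota s1) = iota (s0 * a) by rewrite rmorphM; field.
      by apply: OL_iota; apply: OK_mul.
    rewrite (_ : _ * beta = iota s1 * (iota s0 * beta)); last by ring.
    by apply: OL_mul => //; apply: OL_iota.
  exists 1, (iota (s0 * s1)); split; [exact: OK1 | exact: prime1 | | by rewrite rmorph1 mul1r mulrC].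
  by apply: OL_iota; apply: OK_mul.
exists Q; split=> //.
- split=> //.
  + have [_ [x Px x_neq0] _ _ _] := P_prime.
    by exists (iota x); [exact: PQ | rewrite fmorph_eq0].
  + by rewrite -(rmorph1 iota); apply: nQ; [exact: OK1 | exact: prime1].
have locg : local_ring OL Q (iota gamma).
  by exists (iota a), (iota s1); split=> //; [exact: OL_iota | exact: OL_iota | exact: nQ].
have locb : local_ring OL Q beta.
  exists (iota s0 * beta), (iota s0); split=> //; [exact: OL_iota | exact: nQ | ].
  by rewrite mulrC mulKf.
have LMB x y : local_max_ideal OL Q x -> local_max_ideal OL Q y -> local_max_ideal OL Q (x - y).
  move=> [b [r [Qb rL Qr ->]]] [b' [r' [Qb' rL' Qr' ->]]].
  have rn : r != 0 by apply: contra_not_neq Qr => ->.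
  have rn' : r' != 0 by apply: contra_not_neq Qr' => ->.
  exists (b * r' - b' * r), (r * r'); split.
  - rewrite -mulN1r mulrA; apply: (QD); first by rewrite mulrC; apply: (QM).
    rewrite mulrC; apply: (QM) => //; apply: (QM) => //.
    by rewrite -(rmorph1 iota) -rmorphN; apply: OL_iota; apply: (OK_int _ (-1)).
  - exact: OL_mul.
  - by case/Q_prime_mul.
  - by field; rewrite rn rn'.
have LMdelta : local_max_ideal OL Q delta.
  exists (iota (s0 * s1) * delta), (iota (s0 * s1)); split=> //.
  - by apply: OL_iota; apply: OK_mul.
  - by apply: nQ; [exact: OK_mul | case/(prime_mul P_prime)].
  - by rewrite mulrC mulKf // rmorphM mulf_neq0.
have LM0 : local_max_ideal OL Q 0 by rewrite -(subrr delta); apply: (LMB).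
rewrite /reduction !asboolT //; by congr Some; apply/coset_eq.
Qed.

End PrimeAbove.

(** * Eventual stability of the factorization *)

Section Factorization.
Variable F : fieldType.
Implicit Types (p q : {poly F}) (s t : seq {poly F}).

Definition all_irreducible s : Prop := forall q, q \in s -> irreducible_poly q.

Lemma eqp_irreducible p q : p %= q -> irreducible_poly p -> irreducible_poly q.
Proof.
move=> pq [p_gt1 p_irr]; split=> [|u u1 uq]; first by rewrite -(eqp_size pq).
by rewrite (eqp_trans (p_irr u u1 _) pq) // (eqp_dvdr _ pq).
Qed.

Lemma irreducible_factorization p : p != 0 ->
  exists2 s, all_irreducible s & p %= \prod_(q <- s) q.
Proof.
have [k] := ubnP (size p); elim: k p => // k IHk p; rewrite ltnS => le_k p_neq0.
have [p_irr|p_red] := pselect (irreducible_poly p).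
  by exists [:: p]; [move=> q; rewrite inE => /eqP -> | rewrite big_seq1 eqpxx].
have [sz1|sz1] := eqVneq (size p) 1%N.
  by exists [::]; [move=> q; rewrite in_nil | rewrite big_nil -size_poly_eq1 sz1].
have p_gt1 : (1 < size p)%N.
  by rewrite ltn_neqAle eq_sym sz1 lt0n size_poly_eq0.
have [q [q1 qp qnp]] : exists q, [/\ size q != 1%N, q %| p & ~~ (q %= p)].
  apply: contrapT => h; apply: p_red; split=> // q q1 qp; apply/negP => /negP qnp.
  by apply: h; exists q.
have /dvdpP[u pE] := qp.
have u_neq0 : u != 0 by apply: contraNneq p_neq0 => u0; rewrite pE u0 mul0r.
have q_neq0 : q != 0 by apply: contraNneq p_neq0 => q0; rewrite pE q0 mulr0.
have lt_q : (size q < size p)%N.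
  by rewrite ltn_neqAle dvdp_leq // andbT; apply: contraNN qnp; rewrite dvdp_size_eqp.
have lt_u : (size u < size p)%N.
  rewrite pE size_mul //.
  have : (0 < size q)%N by rewrite lt0n size_poly_eq0.
  by move: q1; case: (size q) => [|[|m]] // _ _; rewrite !addnS /= ltnS leq_addr.
have [s s_irr us] := IHk u (leq_trans lt_u le_k) u_neq0.
have [t t_irr qt] := IHk q (leq_trans lt_q le_k) q_neq0.
exists (s ++ t); first by move=> v; rewrite mem_cat => /orP[/s_irr|/t_irr].
by rewrite big_cat pE /=; apply: eqp_trans (eqp_mulr _ us) (eqp_mull _ qt).
Qed.

Lemma irreducible_dvd_prod q s : irreducible_poly q -> q %| \prod_(p <- s) p ->
  exists2 p, p \in s & q %| p.
Proof.
move=> q_irr; elim: s => [|p s IHs].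
  rewrite big_nil dvdp1; have [q1 _] := q_irr.
  by rewrite gtn_eqF.
rewrite big_cons; have [qp _|qp] := boolP (q %| p); first by exists p; rewrite ?inE ?eqxx.
rewrite Gauss_dvdpr ?irreducible_poly_coprime // => /IHs[u us qu].
by exists u; rewrite // inE us orbT.
Qed.

Lemma size_irreducible_le s t : all_irreducible s -> all_irreducible t ->
  \prod_(q <- t) q %| \prod_(q <- s) q -> (size t <= size s)%N.
Proof.
elim: t s => // q t IHt s s_irr t_irr; rewrite big_cons => dvd.
have q_irr : irreducible_poly q by apply: t_irr; rewrite inE eqxx.
have [p ps qp] := irreducible_dvd_prod q_irr (dvdp_trans (dvdp_mulr _ (dvdpp q)) dvd).
have q_neq1 : size q != 1%N by have [q1 _] := q_irr; rewrite gtn_eqF.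
have /eqp_dvdl qpE := apply_irredp (s_irr p ps) q_neq1 qp.
have : \prod_(u <- t) u %| \prod_(u <- rem p s) u.
  move: dvd; rewrite (big_rem p ps) /=.
  have /eqp_mulr/eqp_dvdl -> := apply_irredp (s_irr p ps) q_neq1 qp.
  by rewrite dvdp_mul2l // irredp_neq0 //; apply: s_irr.
move/IHt => /(_ (fun u us => s_irr u (mem_rem us))) le.
rewrite /= (leq_ltn_trans (le _)) //; last by rewrite size_rem //; case: (s) ps.
by move=> u ut; apply: t_irr; rewrite inE ut orbT.
Qed.

(** Unique factorization leaves a single candidate for the [xget] in [num_factors]. *)
Lemma num_factors_eq p s : p != 0 -> all_irreducible s -> p %= \prod_(q <- s) q ->
  num_factors p = size s.
Proof.
move=> p_neq0 s_irr ps; apply: xget_unique; first by exists s.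
move=> k [t [t_irr pt ->]]; apply/eqP; rewrite eqn_leq !size_irreducible_le //.
  by rewrite -(eqp_dvdl _ ps) (eqp_dvdl _ pt).
by rewrite -(eqp_dvdl _ pt) (eqp_dvdl _ ps).
Qed.

Lemma eqp_comp p q (u : {poly F}) : p %= q -> p \Po u %= q \Po u.
Proof.
case/eqpP => [[a b] /= /andP[a0 b0] E]; apply/eqpP; exists (a, b); first by rewrite /= a0.
by rewrite /= -!comp_polyZ E.
Qed.

Lemma prod_comp s (u : {poly F}) : (\prod_(q <- s) q) \Po u = \prod_(q <- s) (q \Po u).
Proof.
elim: s => [|q s IHs]; first by rewrite !big_nil comp_polyC.
by rewrite !big_cons comp_polyM IHs.
Qed.

(** Each q \Po u is nonconstant and contributes at least one irreducible factor, so a total of at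
    most [size s] factors allows exactly one for each q. *)
Lemma irreducible_comp_of_num_factors p s (u : {poly F}) : p != 0 -> all_irreducible s ->
  p %= \prod_(q <- s) q -> (1 < size u)%N -> (num_factors (p \Po u) <= size s)%N ->
  forall q, q \in s -> irreducible_poly (q \Po u).
Proof.
move=> p_neq0 s_irr ps u_gt1 le_s.
have comp_neq0 q : irreducible_poly q -> q \Po u != 0.
  move=> [q1 _]; rewrite -size_poly_eq0 -lt0n.
  exact: ltn_trans (size_comp_gt1 q1 u_gt1).
have fac q : exists t, irreducible_poly q -> all_irreducible t /\ q \Po u %= \prod_(v <- t) v.
  have [q_irr|] := pselect (irreducible_poly q); last by exists [::].
  by have [t t_irr qt] := irreducible_factorization (comp_neq0 q q_irr); exists t.
pose f q := projT1 (cid (fac q)).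
have fP q : q \in s -> all_irreducible (f q) /\ q \Po u %= \prod_(v <- f q) v.
  by move=> /s_irr; apply: (projT2 (cid (fac q))).
have f_gt0 q : q \in s -> (0 < size (f q))%N.
  move=> qs; have [_] := fP q qs; case: (f q) => //; rewrite big_nil -size_poly_eq1.
  by have [q1 _] := s_irr q qs; rewrite gtn_eqF // size_comp_gt1.
have pu_neq0 : p \Po u != 0 by rewrite comp_poly_eq0.
pose T := flatten [seq f q | q <- s].
have T_irr : all_irreducible T.
  by move=> v /flatten_mapP[q qs vq]; have [fq_irr _] := fP q qs; apply: fq_irr.
have pT : p \Po u %= \prod_(v <- T) v.
  apply: eqp_trans (eqp_comp u ps) _; rewrite prod_comp /T big_flatten big_map.
  rewrite big_seq [X in _ %= X]big_seq.
  elim/big_rec2: _ => [|q a b qs ab]; first exact: eqpxx.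
  by apply: eqp_trans (eqp_mulr _ (fP q qs).2) (eqp_mull _ ab).
have size_T : (size T = \sum_(q <- s) size (f q))%N.
  by rewrite /T size_flatten /shape -map_comp sumnE big_map.
move: le_s; rewrite (num_factors_eq pu_neq0 T_irr pT) size_T => le_s q qs.
have fq1 : size (f q) = 1%N.
  apply/eqP; rewrite eqn_leq f_gt0 // andbT.
  have : (size (rem q s) <= \sum_(v <- rem q s) size (f v))%N.
    rewrite -sum1_size big_seq [leqRHS]big_seq; apply: leq_sum => v /mem_rem vs.
    exact: f_gt0.
  have s_gt0 : (0 < size s)%N by case: (s) qs.
  move: le_s; rewrite (big_rem q) //= size_rem //; move: s_gt0 (f_gt0 q qs).
  by move: (\sum_(v <- rem q s) _)%N (size s) (size (f q)) => x y z; lia.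
have [fq_irr] := fP q qs; case: (f q) fq1 fq_irr => [|v [|]] // _ v_irr.
rewrite big_seq1 eqp_sym => /eqp_irreducible; apply; apply: v_irr.
by rewrite inE eqxx.
Qed.

End Factorization.

Section Stability.
Variable F : fieldType.
Variables (f : {poly F}) (a : F).
Hypothesis f_gt2 : (2 < size f)%N.
Local Notation fiter n := (iter_poly f n).
Local Notation p n := (fiter n - a%:P).

Lemma iter_poly_add m k : fiter (m + k) = fiter m \Po fiter k.
Proof.
elim: m => [|m IHm]; first by rewrite comp_polyX.
by rewrite addSn /iter_poly !iterS -!/(iter_poly _ _) IHm comp_polyA.
Qed.

Lemma size_iter_poly_gt1 n : (1 < size (fiter n))%N.
Proof.
elim: n => [|n IHn]; first by rewrite size_polyX.
by rewrite /iter_poly iterS; apply: size_comp_gt1 => //; apply: ltn_trans f_gt2.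
Qed.

Lemma iter_poly_sub_neq0 n : p n != 0.
Proof.
rewrite subr_eq0; apply/eqP => E; have := size_iter_poly_gt1 n.
by rewrite E ltnNge size_polyC_leq1.
Qed.

Lemma iter_poly_sub_add m k : p (m + k) = p m \Po fiter k.
Proof. by rewrite iter_poly_add comp_polyB comp_polyC. Qed.

(** The level m is one where the number of factors, bounded by [B], is largest; composing with a
    further iterate then cannot split any factor. *)
Lemma eventually_stable B : (forall n, (1 <= n)%N -> (num_factors (p n) <= B)%N) ->
  exists m s, [/\ (1 <= m)%N, all_irreducible s, p m %= \prod_(q <- s) q &
    forall k q, q \in s -> irreducible_poly (q \Po fiter k)].
Proof.
move=> le_B; pose Q N := `[< exists2 m, (1 <= m)%N & num_factors (p m) = N >].
have exQ : exists N, Q N by exists (num_factors (p 1)); apply/asboolP; exists 1%N.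
have ubQ N : Q N -> (N <= B)%N by move=> /asboolP[m m1 <-]; apply: le_B.
case: (ex_maxnP exQ ubQ) => N /asboolP[m m1 mN] maxN.
have [s s_irr ps] := irreducible_factorization (iter_poly_sub_neq0 m).
exists m, s; split=> // k q; move: q.
apply: (irreducible_comp_of_num_factors (iter_poly_sub_neq0 m) s_irr ps).
  exact: size_iter_poly_gt1.
rewrite -iter_poly_sub_add -(num_factors_eq (iter_poly_sub_neq0 m) s_irr ps) mN.
by apply: maxN; apply/asboolP; exists (m + k)%N; rewrite // ltn_addr.
Qed.

End Stability.

(** * Backward orbits *)

Lemma iter_horner (F : fieldType) (f : {poly F}) k x :
  iter k (horner f) x = (iter_poly f k).[x].
Proof.
elim: k => [|k IHk]; first by rewrite hornerX.
by rewrite iterS IHk /iter_poly iterS horner_comp.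
Qed.

Lemma orbit_injective (F : fieldType) (f : {poly F}) x : ~ preperiodic f x ->
  injective (fun k => iter k (horner f) x).
Proof.
move=> npp; suff h i j : (i < j)%N -> iter i (horner f) x <> iter j (horner f) x.
  move=> i j e; have [lt|lt|//] := ltngtP i j; first by case: (h i j lt e).
  by case: (h j i lt (esym e)).
move=> lt_ij e; apply: npp.
apply: (@sub_finite_set _ _ [set iter k (horner f) x | k in `I_j]); last first.
  by apply: finite_image; apply: finite_II.
move=> _ [k _ <-]; have [l] := ubnP k; elim: l k => // l IHl k; rewrite ltnS => le_l.
have [lt_k|le_k] := ltnP k j; first by exists k.
have -> : iter k (horner f) x = iter (k - j + i) (horner f) x.
  by rewrite iterD e -iterD subnK.
by apply: IHl; rewrite (leq_trans _ le_l) // -{2}(subnK le_k) ltn_add2l.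
Qed.

(** [S] consists of absolute values, and P is recovered from its own as the set of integers of
    absolute value less than 1. *)
Lemma finite_places_of_set (R : realType) (K : fieldExtType rat) (S : set (K -> R)) :
  finite_set S -> finite_set [set P | primesK P /\ S (prime_abs R P)].
Proof.
move=> S_fin; apply: sub_finite_set (finite_image (fun v => [set x | @OK K x /\ v x < 1]) S_fin).
move=> P [P_prime SP]; exists (prime_abs R P) => //.
apply/seteqP; split=> [x [x_int lt1]|x Px]; first by apply/(prime_abs_lt1P R P_prime).
have x_int := prime_int P_prime Px; split=> //.
exact/(prime_abs_lt1P R P_prime).
Qed.

Lemma monic_comp (F : fieldType) (p q : {poly F}) : (1 < size q)%N ->
  p \is monic -> q \is monic -> p \Po q \is monic.
Proof.
move=> q1 p_mon q_mon; rewrite monicE lead_coef_comp // (monicP p_mon) (monicP q_mon).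
by rewrite expr1n mulr1.
Qed.

Section BackwardOrbit.
Variables (R : realType) (K : fieldExtType rat) (Kbar : closedFieldType).
Variable iota : {rmorphism K -> Kbar}.
Local Notation "p ^i" := (map_poly iota p) (at level 2, format "p ^i").
Hypothesis abcK : abc_conjecture R K.

Lemma finite_unit_values (g : {poly K}) (T0 : set (set K)) :
  irreducible_poly g -> (2 < size g)%N -> finite_set T0 ->
  finite_set [set y | forall P, primesK P -> ~ T0 P ->
                prime_abs R P y <= 1 /\ 1 <= prime_abs R P g.[y]].
Proof.
move=> g_irr g_gt2; have [D [N [Phi [W [r [szPhi r0 szr E]]]]]] := belyi_factor iota g_irr g_gt2.
move=> T0_fin; exact: (abc_finite_units abcK szPhi r0 szr E T0_fin).
Qed.

Variables (f : {poly K}) (alpha gamma : K) (S : set (K -> R)) (B : nat).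
Hypotheses (f_mon : f \is monic) (f_gt2 : (2 < size f)%N).
Hypothesis f_factors : forall n, (1 <= n)%N ->
  (num_factors (iter_poly f n - alpha%:P) <= B)%N.
Hypothesis gamma_npp : ~ preperiodic f gamma.
Hypothesis S_fin : finite_set S.

Lemma finite_integral_backward_orbit :
  finite_set (backward_orbit iota f alpha `&` S_integral iota S gamma).
Proof.
have f_gt1 : (1 < size f)%N by apply: ltn_trans f_gt2.
have [m [s [m1 s_irr ps stable]]] := eventually_stable f_gt2 f_factors.
(* One composition with [f] brings the degree to at least 2 even when q is linear, and [G q] is made
   monic so that divisibility by it preserves integrality at P. *)
pose G q := (lead_coef (q \Po f))^-1 *: (q \Po f).
have qf_neq0 q : q \in s -> q \Po f != 0.
  by move=> /s_irr/irredp_neq0; rewrite comp_poly_eq0.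
have lc_neq0 q : q \in s -> (lead_coef (q \Po f))^-1 != 0.
  by move=> /qf_neq0; rewrite invr_eq0 lead_coef_eq0.
have G_mon q : q \in s -> G q \is monic.
  by move=> /qf_neq0 h; rewrite monicE lead_coefZ mulVf // lead_coef_eq0.
have G_comp q k : q \in s -> irreducible_poly (G q \Po iter_poly f k) /\
    (forall x, root (q \Po iter_poly f k.+1)^i x -> root (G q \Po iter_poly f k)^i x).
  move=> qs; have E : q \Po iter_poly f k.+1 = (q \Po f) \Po iter_poly f k.
    by rewrite /iter_poly iterS comp_polyA.
  have h : q \Po iter_poly f k.+1 %= G q \Po iter_poly f k.
    by rewrite E /G comp_polyZ eqp_sym eqp_scale // lc_neq0.
  split; first exact: eqp_irreducible h (stable k.+1 q qs).
  by move=> x; rewrite (eqp_root (_ : _ %= (G q \Po iter_poly f k)^i)) // eqp_map.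
have G_irr q : q \in s -> irreducible_poly (G q).
  by move=> /(G_comp q 0%N)[]; rewrite /iter_poly comp_polyXr.
have G_gt2 q : q \in s -> (2 < size (G q))%N.
  move=> qs; rewrite size_scale ?lc_neq0 //.
  have [q1 _] := s_irr q qs; have := size_comp_poly q f.
  by case: (size q) q1 => [|[|a]] //; case: (size f) f_gt2 => [|[|[|b]]] //; case: (size _) => [|[|[|]]] //=; nia.
(* Outside of these primes [f] and all [G q] have integral coefficients and gamma is integral, hence
   so are its whole forward orbit and every [G q \Po iter_poly f k]. One finite set thus serves all
   levels k. *)
pose T0 := [set P | primesK P /\ (S (prime_abs R P) \/ bad_primes R f P \/
  1 < prime_abs R P gamma \/ exists2 q, q \in s & bad_primes R (G q) P)].
have T0_fin : finite_set T0.
  apply: (@sub_finite_set _ _ ([set P | primesK P /\ S (prime_abs R P)] `|` bad_primes R f `|`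
    [set P | primesK P /\ 1 < prime_abs R P gamma] `|` \bigcup_(q in [set` s]) bad_primes R (G q))).
    move=> P [P_prime [SP|[fP|[gP|[q qs qP]]]]]; last by right; exists q.
    - by left; left; left.
    - by left; left; right.
    - by left; right.
  rewrite !finite_setU; split; [split; [split|]|].
  - exact: finite_places_of_set.
  - exact: finite_bad_primes.
  - exact: finite_prime_abs_gt1.
  - by apply: bigcup_finite => // q _; apply: finite_bad_primes.
pose Y := \bigcup_(q in [set` s]) [set y | forall P, primesK P -> ~ T0 P ->
   prime_abs R P y <= 1 /\ 1 <= prime_abs R P (G q).[y]].
have Y_fin : finite_set Y.
  apply: bigcup_finite => // q qs; apply: finite_unit_values => //; first exact: G_irr.
  exact: G_gt2.
pose ks := [set k | Y (iter k (horner f) gamma)].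
have ks_fin : finite_set ks.
  by apply: finite_preimage => // i j _ _; apply: orbit_injective.
pose ns := `I_m.+1 `|` [set (m + k.+1)%N | k in ks].
have ns_fin : finite_set ns by rewrite finite_setU; split; [exact: finite_II | exact: finite_image].
apply: (@sub_finite_set _ _ (\bigcup_(n in ns) [set x | root (iter_poly f n - alpha%:P)^i x])); last first.
  apply: bigcup_finite => // n _; apply: finite_roots.
  by rewrite map_poly_eq0 iter_poly_sub_neq0.
move=> beta [[n n1 nbeta] betaS]; exists n => //.
have [le_n|lt_n] := leqP n m; first by left.
right; exists (n - m).-1; last by rewrite prednK ?subn_gt0 // subnKC // ltnW.
set k := (n - m).-1; have nE : n = (m + k.+1)%N by rewrite prednK ?subn_gt0 // subnKC // ltnW.
have [q qs qbeta] : exists2 q, q \in s & root (q \Po iter_poly f k.+1)^i beta.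
  have h : iter_poly f n - alpha%:P %= \prod_(q <- s) (q \Po iter_poly f k.+1).
    by rewrite nE iter_poly_sub_add -prod_comp; apply: eqp_comp.
  have : root (\prod_(q <- s) (q \Po iter_poly f k.+1))^i beta.
    by rewrite -(eqp_root (_ : (iter_poly f n - alpha%:P)^i %= _)) // eqp_map.
  rewrite rmorph_prod /root horner_prod prodf_seq_eq0 => /hasP[q qs /= h']; by exists q.
exists q => // P P_prime PT0.
have [nS f_ok gamma1 Gq] : [/\ ~ S (prime_abs R P), integral_at R P f, prime_abs R P gamma <= 1 &
    integral_at R P (G q)].
  split.
  - by move=> h; apply: PT0; split=> //; left.
  - by move=> i; rewrite leNgt; apply/negP => h; apply: PT0; split=> //; right; left; split=> //; exists i.
  - by rewrite leNgt; apply/negP => h; apply: PT0; split=> //; right; right; left.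
  - move=> i; rewrite leNgt; apply/negP => h; apply: PT0; split=> //; right; right; right.
    by exists q => //; split=> //; exists i.
have fk_mon : iter_poly f k \is monic.
  elim: (k) => [|j IHj]; first exact: monicX.
  by rewrite /iter_poly iterS; apply: monic_comp => //; apply: size_iter_poly_gt1.
have fk_int : integral_at R P (iter_poly f k).
  elim: (k) => [|j IHj]; first exact: integral_atX.
  by rewrite /iter_poly iterS; apply: integral_at_comp.
rewrite iter_horner; split; first exact: integral_at_horner.
rewrite leNgt; apply/negP => lt1; apply: betaS.
have [irr G_root] := G_comp q k qs.
have [Q [Q_prime QP redE]] : exists Q, [/\ nonzero_prime (ring_of_integers (adjoin iota beta)) Q,
    iota @^-1` Q = P & reduction (ring_of_integers (adjoin iota beta)) Q (iota gamma) =
      reduction (ring_of_integers (adjoin iota beta)) Q beta].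
  apply: (@exists_prime_above R K P Kbar iota (G q \Po iter_poly f k)) => //.
  - by apply: monic_comp => //; [exact: size_iter_poly_gt1 | exact: G_mon].
  - exact: integral_at_comp.
  - exact: G_root.
  - by rewrite horner_comp.
by exists Q; split=> //; exists P.
Qed.

End BackwardOrbit.

Theorem corollary1p11 (R : realType) (K : fieldExtType rat)
    (Kbar : closedFieldType) (iota : {rmorphism K -> Kbar})
    (Kbar_alg : forall x : Kbar, algebraicOver iota x)
    (abcK : abc_conjecture R K)
    (alpha : K) (C1 C2 : R) (C1_gt0 : 0 < C1) (C1_lt1 : C1 < 1)
    (C_prop : forall (d : nat) (c : K), (2 <= d)%N ->
       admissible alpha C1 C2 d c ->
       forall n : nat, (1 <= n)%N ->
         (num_factors (iter_poly (unicritical d c) n - alpha%:P)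
            <= size (divisors d))%N)
    (d : nat) (c : K) (d_ge2 : (2 <= d)%N)
    (dc_adm : admissible alpha C1 C2 d c)
    (gamma : K) (gamma_npp : ~ preperiodic (unicritical d c) gamma)
    (S : set (K -> R)) (S_fin : finite_set S) (S_places : S `<=` places R K)
    (S_arch : arch_places R K `<=` S) :
  finite_set (backward_orbit iota (unicritical d c) alpha
              `&` S_integral iota S gamma).
Proof.
have szf : size (unicritical d c) = d.+1.
  rewrite size_polyDl size_polyXn // ltnS.
  by rewrite (leq_trans (size_polyC_leq1 _)) // ltnW.
(* The bound on the number of factors, uniform in the level n, is tau(d), supplied by [C_prop]. *)
apply: (@finite_integral_backward_orbit R K Kbar iota abcK _ _ _ S (size (divisors d))) => //.
- by rewrite monicE lead_coefDl ?lead_coefXn // size_polyXn ltnS (leq_trans (size_polyC_leq1 _)) // ltnW.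
- by rewrite szf ltnS.
- exact: C_prop dc_adm.
Qed.
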